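(* Let $k\ge1$ and $\zeta\ge0$ be integers. There exists a $k$-$\gamma_c$-critical graph with exactly $\zeta$ cut-vertices that is not traceable if and only if $k\ge4$ and $0\le\zeta\le k-4$.
   Context: Graphs are finite and simple. For a connected graph $G$, a connected dominating set is a set $S\subseteq V(G)$ such that every vertex outside $S$ has a neighbor in $S$ and $G[S]$ is connected; $\gamma_c(G)$ is the minimum size of such a set. A connected graph $G$ is $k$-$\gamma_c$-critical if $\gamma_c(G)=k$ and $\gamma_c(G+uv)<k$ for every pair of non-adjacent vertices $u,v$. A graph is traceable if it has a hamiltonian path (a path through all vertices). *)

(* Defs.v *)
From mathcomp Require Import all_boot.

Set Implicit Arguments.
Unset Strict Implicit.
Unset Printing Implicit Defensive.

(* A finite simple graph is an adjacency relation e on a finite type of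
   vertices T that satisfies simple_graph e. *)

Section Graphs.

Variable T : finType.
Implicit Types (e : rel T) (A S : {set T}) (u v : T).

Definition simple_graph e : Prop := symmetric e /\ irreflexive e.

(* All vertices of T remain in this relation; those outside A are isolated.
   Hence connect (induced e A) x y is reachability in the induced subgraph
   only for x in A. *)
Definition induced e A : rel T :=
  [rel x y | [&& x \in A, y \in A & e x y]].

(* The subgraph with no vertices does not count as connected. *)
Definition connected_in e A : bool :=
  (A != set0) &&
  [forall x in A, forall y in A, connect (induced e A) x y].

Definition connected_graph e : bool := connected_in e [set: T].

Definition dominating e S : bool :=
  [forall x in ~: S, exists y in S, e x y].

Definition connected_dominating e S : bool :=
  dominating e S && connected_in e S.

(* When e is connected, [set: T] is itself a connected dominating set, so this
   is the minimum; on other graphs the value is meaningless. *)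
Definition gamma_c e : nat :=
  #|[arg min_(S < [set: T] | connected_dominating e S) #|S| ]|.

Definition add_edge e u v : rel T :=
  [rel x y | [|| e x y, (x == u) && (y == v) | (x == v) && (y == u)]].

Definition gamma_c_critical k e : Prop :=
  [/\ connected_graph e,
      gamma_c e = k &
      forall u v, u != v -> ~~ e u v -> gamma_c (add_edge e u v) < k].

Definition num_components e A : nat := n_comp (induced e A) A.

(* Counting components (rather than asking that e minus v be not connected)
   makes the single vertex of K_1 not a cut-vertex. *)
Definition cut_vertex e v : bool :=
  num_components e [set: T] < num_components e [set~ v].

Definition traceable e : Prop :=
  exists s : seq T, [/\ sorted e s, uniq s & forall v, v \in s].

End Graphs.

(* Main.v *)
(* Let D be a minimum connected dominating set and Z the set of cut-vertices.  A
   cut-vertex c splits the graph into two sides, both connected, in which its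
   neighbours form cliques, and connected dominating sets can be cut and glued at c;
   in particular Z is contained in D.  If k <= zeta + 3, then D \ Z has at most three
   elements and the graph is traceable:
   - without cut-vertices, k <= 3 and any two vertices of an independent triple are
     comparable: some edge at one of them dominates every vertex but the other; a
     longest path that is not hamiltonian then gives too large an independent set;
   - two disjoint leaves (sides without cut-vertices) cannot both contain at most
     one vertex of D: adding an edge between them would not lower the domination
     number.  Hence there are no three disjoint leaves, the cut-vertices lie on a
     line, the pieces between consecutive ones are cliques up to at most two missing
     edges, and only the leaves at both ends, with at most three vertices of D each,
     are not obvious.  In such a leaf a minimum path cover of the non-neighbours of c
     is linked up through the clique of the neighbours of c.
   Conversely, an explicit non-traceable graph with (k, zeta) = (4, 0) has a
   simplicial vertex x all of whose neighbours lie in minimum connected dominating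
   sets.  Doubling x, or not, and attaching a new simplicial vertex to the resulting
   twins increases k by 1 and zeta by 0, respectively 1, and keeps these properties. *)

Require Import Defs.
From mathcomp Require Import all_boot.
From mathcomp Require Import zify.
From Stdlib Require Classical_Prop.

Set Implicit Arguments.
Unset Strict Implicit.
Unset Printing Implicit Defensive.

(** * Connectivity and cut-vertices *)

Section Connectivity.

Variable T : finType.
Implicit Types (e : rel T) (A B P S : {set T}) (u v x y : T).

Definition closed_within e S P :=
  forall x y, x \in P -> y \in S -> e x y -> y \in P.

Lemma connected_inP e S :
  reflect (S != set0 /\
           forall P, P \subset S -> P != set0 -> closed_within e S P -> S \subset P)
          (connected_in e S).
Proof.
apply: (iffP andP) => -[S0 HS]; split=> //.
  move=> P sPS /set0Pn[x xP] Pcl; apply/subsetP=> y yS.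
  have xS := subsetP sPS _ xP.
  have /forall_inP/(_ _ xS)/forall_inP/(_ _ yS) := HS.
  case/connectP=> p; elim: p x xP {xS} => [|z p IH] x xP /=; first by move=> _ ->.
  case/andP=> /and3P[_ zS exz] pth ylast.
  exact: (IH z (Pcl _ _ xP zS exz)).
apply/forall_inP=> x xS; apply/forall_inP=> y yS.
pose P := [set z in S | connect (induced e S) x z].
have : S \subset P.
  apply: HS.
  - by apply/subsetP=> z; rewrite inE => /andP[].
  - by apply/set0Pn; exists x; rewrite inE xS connect0.
  - move=> z w; rewrite !inE => /andP[zS cz] wS ezw; rewrite wS.
    by apply: (connect_trans cz); apply: connect1; rewrite /induced /= zS wS.
by move/subsetP=> /(_ _ yS); rewrite inE => /andP[].
Qed.

Lemma connected_in_base e S x0 : symmetric e -> x0 \in S ->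
  (forall P, P \subset S -> P != set0 -> closed_within e S P -> x0 \in P) ->
  connected_in e S.
Proof.
move=> sym x0S H; apply/connected_inP; split; first by apply/set0Pn; exists x0.
move=> P sPS P0 Pcl; apply/negPn/negP=> nsSP.
have : x0 \in S :\: P.
  apply: H; first exact: subsetDl.
  - by apply: contra nsSP; rewrite setD_eq0.
  - move=> x y; rewrite !inE => /andP[xP xS] yS exy; rewrite yS andbT.
    by apply: contra xP => yP; apply: (Pcl y x) => //; rewrite sym.
by rewrite inE (H P) ?andbF.
Qed.

Lemma connected_in_closed e S P : connected_in e S -> P \subset S ->
  P != set0 -> closed_within e S P -> P = S.
Proof.
by case/connected_inP=> _ H sPS P0 Pcl; apply/eqP; rewrite eqEsubset sPS H.
Qed.

Lemma connected_in1 e x : symmetric e -> connected_in e [set x].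
Proof.
move=> sym; apply: (connected_in_base (x0 := x)) => //; rewrite ?inE //.
by move=> P; rewrite subset1 => /orP[] /eqP -> //; rewrite ?eqxx // inE.
Qed.

Lemma connected_inU e S1 S2 x0 : symmetric e -> x0 \in S1 -> x0 \in S2 ->
  connected_in e S1 -> connected_in e S2 -> connected_in e (S1 :|: S2).
Proof.
move=> sym x1 x2 c1 c2; apply: (connected_in_base (x0 := x0)) => //.
  by rewrite inE x1.
move=> P sP /set0Pn[z zP] Pcl.
have [zS|zS] := orP (etrans (esym (in_setU _ _ _)) (subsetP sP _ zP)).
- have E : P :&: S1 = S1.
    apply: (connected_in_closed c1); first exact: subsetIr.
      by apply/set0Pn; exists z; rewrite inE zP.
    move=> x y; rewrite !inE => /andP[xP xS] yS exy; rewrite yS andbT.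
    by apply: (Pcl x) => //; rewrite inE yS.
  by move: x1; rewrite -E inE => /andP[].
- have E : P :&: S2 = S2.
    apply: (connected_in_closed c2); first exact: subsetIr.
      by apply/set0Pn; exists z; rewrite inE zP.
    move=> x y; rewrite !inE => /andP[xP xS] yS exy; rewrite yS andbT.
    by apply: (Pcl x) => //; rewrite inE yS orbT.
  by move: x2; rewrite -E inE => /andP[].
Qed.

Lemma connected_in_add e S x y : symmetric e -> connected_in e S ->
  y \in S -> e x y -> connected_in e (x |: S).
Proof.
move=> sym cS yS exy.
have -> : x |: S = [set x; y] :|: S.
  by apply/setP=> z; rewrite !inE; case: eqVneq => //= _; case: eqVneq => //= ->.
apply: (connected_inU (x0 := y)) => //; first by rewrite !inE eqxx orbT.
apply: (connected_in_base (x0 := y)) => //; first by rewrite !inE eqxx orbT.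
move=> P sP /set0Pn[z zP] Pcl; move: (subsetP sP _ zP); rewrite !inE.
case/orP=> /eqP zE; move: zP; rewrite zE // => xP.
by apply: (Pcl x) => //; rewrite !inE eqxx orbT.
Qed.

Lemma connected_in_edge e S P : connected_in e S -> P \subset S -> P != set0 ->
  P != S -> exists x y, [/\ x \in P, y \in S :\: P & e x y].
Proof.
move=> cS sP P0 PS.
case: (boolP [exists x in P, exists y in S :\: P, e x y]).
  case/exists_inP=> x xP /exists_inP[y yP exy].
  by exists x, y.
rewrite negb_exists_in => /forall_inP H; case/eqP: PS.
apply: (connected_in_closed cS) => // x y xP yS exy.
apply/negPn/negP=> yP; move: (H _ xP); rewrite negb_exists_in => /forall_inP/(_ y).
by rewrite !inE yP yS exy => /(_ isT).
Qed.

Lemma connected_in_nbr e S x y : connected_in e S -> x \in S -> y \in S -> y != x ->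
  exists z, [/\ z \in S, z != x & e x z].
Proof.
move=> cS xS yS yx; have [|||x' [z []]] := connected_in_edge cS (_ : [set x] \subset S).
- by rewrite sub1set.
- by rewrite -card_gt0 cards1.
- by apply: contraNneq yx => E; rewrite -E inE in yS.
by rewrite !inE => /eqP -> /andP[zx zS] exz; exists z.
Qed.

Lemma connected_in_mono e e' S : subrel e e' -> connected_in e S -> connected_in e' S.
Proof.
move=> sub /connected_inP[S0 H]; apply/connected_inP; split=> // P sP P0 Pcl.
by apply: H => // x y xP yS exy; apply: (Pcl x) => //; apply: sub.
Qed.

Definition cds_on e B S :=
  [/\ S \subset B, connected_in e S &
      forall x, x \in B -> x \notin S -> exists2 y, y \in S & e x y].

Lemma connected_dominatingP e S :
  reflect (cds_on e [set: T] S) (connected_dominating e S).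
Proof.
apply: (iffP andP) => [[/forall_inP dS cS]|[_ cS dS]]; split=> //.
- move=> x _ xS; by have := dS x; rewrite inE => /(_ xS)/exists_inP[y yS exy]; exists y.
- apply/forall_inP=> x; rewrite inE => xS.
  by have [//|//|y yS exy] := dS x; apply/exists_inP; exists y.
Qed.

Lemma setT_cds e : connected_graph e -> connected_dominating e [set: T].
Proof.
move=> ce; rewrite /connected_dominating (ce : connected_in e _) andbT.
by apply/forall_inP=> x; rewrite !inE.
Qed.

Lemma gamma_c_ex e : connected_graph e ->
  exists2 S, cds_on e [set: T] S & #|S| = gamma_c e.
Proof.
move=> ce; rewrite /gamma_c; case: arg_minnP => [|S cS _]; first exact: setT_cds.
by exists S => //; apply/connected_dominatingP.
Qed.

Lemma gamma_c_le e S : connected_graph e -> cds_on e [set: T] S -> gamma_c e <= #|S|.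
Proof.
move=> ce /connected_dominatingP cS; rewrite /gamma_c.
by case: arg_minnP => [|S' _]; [exact: setT_cds|apply].
Qed.

Lemma add_edge_sym e u v : symmetric e -> symmetric (add_edge e u v).
Proof.
move=> sym x y; rewrite /add_edge /= sym; congr orb.
by rewrite orbC andbC [in X in _ || X]andbC.
Qed.

Lemma sub_add_edge e u v : subrel e (add_edge e u v).
Proof. by move=> x y exy; rewrite /add_edge /= exy. Qed.

Lemma add_edge_neq e u v x y : x != u -> x != v -> add_edge e u v x y = e x y.
Proof. by move=> /negbTE xu /negbTE xv; rewrite /add_edge /= xu xv /= orbF. Qed.

Lemma add_edge_connected e u v : connected_graph e -> connected_graph (add_edge e u v).
Proof. exact/connected_in_mono/sub_add_edge. Qed.

Lemma critical_add k e u v : gamma_c_critical k e -> u != v -> ~~ e u v ->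
  exists2 S, cds_on (add_edge e u v) [set: T] S & #|S| < k.
Proof.
case=> ce _ H uv euv.
have [S cS E] := gamma_c_ex (add_edge_connected u v ce).
by exists S => //; rewrite E H.
Qed.

Lemma critical_ex k e : gamma_c_critical k e -> exists2 S, cds_on e [set: T] S & #|S| = k.
Proof. by case=> con <- _; apply: gamma_c_ex. Qed.

Lemma critical_min k e S : gamma_c_critical k e -> cds_on e [set: T] S -> k <= #|S|.
Proof. by case=> ce <- _; apply: gamma_c_le. Qed.

(* A set which is a union of connected components of the graph minus c, and
   leaves out at least one of them. *)
Definition side e c P :=
  [/\ c \notin P, P != set0, exists2 w, w \notin P & w != c &
      forall x y, x \in P -> y \notin P -> e x y -> y = c].

Lemma side_compl e c P : symmetric e -> side e c P -> side e c (~: (c |: P)).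
Proof.
move=> sym [cP /set0Pn[x xP] [w wP wc] Pe]; split.
- by rewrite !inE eqxx.
- by apply/set0Pn; exists w; rewrite !inE negb_or wc.
- by exists x; [rewrite !inE xP orbT | apply: contraNneq cP => <-].
- move=> y z; rewrite !inE negbK negb_or => /andP[yc yP] /orP[/eqP//|zP] eyz.
  by case/eqP: yc; apply: (Pe z) => //; rewrite sym.
Qed.

Lemma cut_vertexP e v : symmetric e -> connected_graph e ->
  reflect (exists P, side e v P) (cut_vertex e v).
Proof.
move=> sym ce.
have csym A : connect_sym (induced e A).
  by apply: sym_connect_sym => x y; rewrite /induced /= sym andbCA.
have clA A x y : x \in A -> connect (induced e A) x y -> y \in A.
  move=> xA /connectP[p]; elim: p x xA => [|z p IH] x xA /=; first by move=> _ ->.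
  by case/andP=> /and3P[_ zA _]; apply: IH.
have one A : connected_in e A -> num_components e A = 1.
  case/andP=> /set0Pn[x xA] /forall_inP/(_ _ xA)/forall_inP H.
  rewrite -(n_comp_connect (csym A) x) /num_components.
  by apply: eq_n_comp_r => y; apply/idP/idP => [/H//|]; apply: clA.
rewrite /cut_vertex (one _ ce).
apply: (iffP idP) => [lt1|[P [vP /set0Pn[x xP] [w wP wv] Pe]]]; last first.
  apply/card_gt1P; exists (root (induced e [set~ v]) x), (root (induced e [set~ v]) w).
  have xv : x != v by apply: contraNneq vP => <-.
  split.
  - rewrite !inE roots_root //=; have := connect_root (induced e [set~ v]) x.
    by move/(clA _ _ _); rewrite !inE; apply.
  - rewrite !inE roots_root //=; have := connect_root (induced e [set~ v]) w.
    by move/(clA _ _ _); rewrite !inE; apply.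
  - rewrite (root_connect (csym _)); apply: contra wP => /connectP[p].
    elim: p x xP {xv} => [|z p IH] x xP /=; first by move=> _ ->.
    case/andP=> /and3P[_]; rewrite !inE => zv exz; apply: IH.
    by apply: contraNT zv => zP; apply/eqP; apply: (Pe x).
have /set0Pn[x xv] : [set~ v] != set0.
  apply: contraTneq lt1 => E; rewrite -leqNgt /num_components /n_comp_mem E.
  by rewrite eq_card0 // => x; rewrite !inE andbF.
pose P := [set y | connect (induced e [set~ v]) x y].
have sP : {subset P <= [set~ v]} by move=> y; rewrite inE; apply: clA.
exists P; split.
- by apply/negP=> /sP; rewrite !inE eqxx.
- by apply/set0Pn; exists x; rewrite inE connect0.
- case: (boolP [exists w in [set~ v], w \notin P]) => [/exists_inP[w]|].
    by rewrite !inE => wv wP; exists w; rewrite // inE.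
  rewrite negb_exists_in => /forall_inP H; move: lt1; rewrite one //.
  apply/andP; split; first by apply/set0Pn; exists x.
  have H' y : y \in [set~ v] -> connect (induced e [set~ v]) x y.
    by move/H; rewrite negbK inE.
  apply/forall_inP=> y /H' cy; apply/forall_inP=> z /H' cz.
  by apply: connect_trans cz; rewrite csym.
- move=> y z yP zP eyz; apply/eqP; apply: contraNT zP => zv.
  move: (yP); rewrite !inE => cy; apply: (connect_trans cy); apply: connect1.
  by rewrite /induced /= (sP _ yP) !inE zv.
Qed.

End Connectivity.

(** * Walks *)

Section Walks.

Variables (T : finType) (e : rel T).
Hypothesis sym : symmetric e.
Implicit Types (x y z : T) (s t : seq T).

Definition walk x s y :=
  if s is z :: s' then [&& z == x, path e z s' & last z s' == y] else false.

Lemma walk1 x : walk x [:: x] x.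
Proof. by rewrite /= !eqxx. Qed.

Lemma walk_cat x s y x' s' y' :
  walk x s y -> walk x' s' y' -> e y x' -> walk x (s ++ s') y'.
Proof.
case: s => //= z s /and3P[-> p1 /eqP <-]; case: s' => //= z' s' /and3P[/eqP <- p2 l2] ey.
by rewrite cat_path p1 last_cat /= ey p2.
Qed.

Lemma walk_cons x y s z : e x y -> walk y s z -> walk x (x :: s) z.
Proof. by move=> exy w; apply: (walk_cat (walk1 x) w). Qed.

Lemma walk_rev x s y : walk x s y -> walk y (rev s) x.
Proof.
elim: s x => //= z s IH x /and3P[/eqP -> p /eqP l].
case: s p l IH => [|z' s] /=; first by move=> _ -> _; exact: walk1.
case/andP=> exz p l /(_ z'); rewrite eqxx p l eqxx => /(_ isT) w.
by rewrite [rev (x :: _)]rev_cons -cats1; apply: walk_cat w (walk1 x) _; rewrite sym.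
Qed.

Lemma walk_head x s y : walk x s y -> x \in s.
Proof. by case: s => //= z s /andP[/eqP -> _]; rewrite mem_head. Qed.

Lemma walk_last x s y : walk x s y -> y \in s.
Proof. by move/walk_rev/walk_head; rewrite mem_rev. Qed.

Lemma walk_sorted x s y : walk x s y -> sorted e s.
Proof. by case: s => //= z s /and3P[]. Qed.

Lemma sorted_walk s : sorted e s -> s != [::] -> exists x y, walk x s y.
Proof. by case: s => //= z s p _; exists z, (last z s); rewrite !eqxx p. Qed.

Lemma walk_single x s : walk x s x -> uniq s -> s = [:: x].
Proof.
case: s => //= z s /and3P[/eqP -> _ /eqP l] /andP[].
by case/lastP: s l => //= s w; rewrite last_rcons => ->; rewrite mem_rcons mem_head.
Qed.

Lemma walk_split x s y z : walk x s y -> z \in s -> z != y ->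
  exists s1 s2 z', [/\ s = s1 ++ s2, walk x s1 z, walk z' s2 y & e z z'].
Proof.
elim: s x => //= a s IH x /and3P[/eqP -> p /eqP l].
rewrite inE => /orP[/eqP ->|zs] zy.
  case: s p l {IH} => [|b s] /=; first by move=> _ l; rewrite l eqxx in zy.
  case/andP=> exb p l; exists [:: x], (b :: s), b.
  by rewrite /= !eqxx p l eqxx.
case: s p l IH zs => // b s /= /andP[exb p] l IH zs.
have [|s1 [s2 [z' [E w1 w2 ez]]]] := IH b _ zs zy; first by rewrite eqxx p l eqxx.
by exists (x :: s1), s2, z'; rewrite E; split=> //; apply: walk_cons w1.
Qed.

Lemma walk_split_before x s y z : walk x s y -> z \in s -> z != x ->
  exists s1 s2 z', [/\ s = s1 ++ s2, walk x s1 z', walk z s2 y & e z' z].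
Proof.
move=> w zs zx; have [|s1 [s2 [z' [E w1 w2 ez]]]] := walk_split (walk_rev w) _ zx.
  by rewrite mem_rev.
exists (rev s2), (rev s1), z'; split; last by rewrite sym.
- by rewrite -rev_cat -E revK.
- exact: walk_rev.
- exact: walk_rev.
Qed.

Lemma connect_walk (A : {set T}) x y : x \in A -> connect (induced e A) x y ->
  exists s, [/\ walk x s y, uniq s & {subset s <= A}].
Proof.
move=> xA /connectP[p pp ly]; case: (shortenP pp) ly => q qp uq _ ly {pp}.
exists (x :: q); split=> //=.
  rewrite eqxx -ly eqxx andbT /= (sub_path _ qp) // => a b.
  by case/and3P.
move=> z; rewrite inE => /orP[/eqP -> //|zq].
elim: q x xA qp zq {uq ly} => //= b q IH x xA /andP[/and3P[_ bA _] qp].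
by rewrite inE => /orP[/eqP -> //|]; apply: IH qp.
Qed.

Definition nx s x := nth x s (index x s).+1.

Lemma nxE a s1 z z' s2 b : uniq (s1 ++ s2) -> walk a s1 z -> walk z' s2 b ->
  nx (s1 ++ s2) z = z'.
Proof.
move=> u w1 w2; case: s2 u w2 => //= c s2 u /andP[/eqP -> _].
case/lastP: s1 u w1 => [//|s1 d] u w1.
have dz : d = z.
  have := walk_rev w1; rewrite rev_rcons /= => /andP[/eqP //].
rewrite dz in u *; rewrite /nx.
move: u; rewrite cat_rcons cat_uniq => /and3P[_ /norP[zs1 _] _].
rewrite cat_rcons index_cat (negbTE zs1) /= eqxx addn0 nth_cat ltnNge leqnSn /=.
by rewrite subSnn /=.
Qed.

End Walks.

Ltac perm_count :=
  apply/permP => ?; rewrite ?(count_cat, count_rev) /= ?(count_cat, count_rev) /=;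
  repeat move: (count _ _) => ?; repeat move: (nat_of_bool _) => ?;
  clear; lia.

(** * Traceability without cut-vertices *)

Section Splitting.

Variables (T : finType) (e : rel T).
Hypothesis sym : symmetric e.
Implicit Types (x y z : T) (s t : seq T) (X : {set T}).

Lemma walk_split_last X a s b z : walk e a s b -> b \notin X -> z \in s -> z \in X ->
  exists s1 s2 x x', [/\ s = s1 ++ s2, walk e a s1 x, walk e x' s2 b, e x x' &
    x \in X /\ {in s2, forall w, w \notin X}].
Proof.
have [n] := ubnP (size s); elim: n s a z => // n IH s a z lt w bX zs zX.
have [|s1 [s2 [z' [E w1 w2 ez]]]] := walk_split w zs; first by apply: contraNneq bX => <-.
case: (boolP (has (mem X) s2)) => [/hasP[u us2 uX]|/hasPn no]; last first.
  by exists s1, s2, z, z'; split.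
have lt2 : size s2 < n.
  by move: lt; rewrite E size_cat; case: (s1) w1 => // ? ? _ /=; lia.
have [t1 [t2 [x [x' [E2 v1 v2 ex [xX no]]]]]] := IH _ _ _ lt2 w2 bX us2 uX.
exists (s1 ++ t1), t2, x, x'; split=> //; first by rewrite E E2 catA.
exact: walk_cat w1 v1 ez.
Qed.

Lemma walk_split_first X a s b z : walk e a s b -> a \notin X -> z \in s -> z \in X ->
  exists s1 s2 x x', [/\ s = s1 ++ s2, walk e a s1 x', walk e x s2 b, e x' x &
    x \in X /\ {in s1, forall w, w \notin X}].
Proof.
move=> w aX zs zX.
have [|s1 [s2 [x [x' [E w1 w2 ex [xX no]]]]]] :=
  walk_split_last (walk_rev sym w) aX (_ : z \in rev s) zX; first by rewrite mem_rev.
exists (rev s2), (rev s1), x, x'; split.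
- by rewrite -rev_cat -E revK.
- exact: walk_rev w2.
- exact: walk_rev w1.
- by rewrite sym.
- by split=> // u; rewrite mem_rev => /no.
Qed.

Lemma nx_inj s x y : uniq s -> x \in s -> y \in s ->
  nx s x \in s -> nx s x != x -> nx s y != y -> nx s x = nx s y -> x = y.
Proof.
move=> u xs ys; rewrite /nx.
have nxlt z : z \in s -> nth z s (index z s).+1 != z -> (index z s).+1 < size s.
  by move=> zs; apply: contraNltn => le; rewrite nth_default.
move=> _ /(nxlt _ xs) ltx /(nxlt _ ys) lty.
rewrite (set_nth_default x y) // => /eqP; rewrite nth_uniq // eqSS => /eqP E.
by rewrite -[x](nth_index x xs) E nth_index.
Qed.

End Splitting.

Section Traceability.

Variables (T : finType) (e : rel T).
Hypothesis sym : symmetric e.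
Hypothesis irr : irreflexive e.
Implicit Types (x y z : T) (p q : seq T).

(* {s, y} is a connected dominating set once the edge st is added, and not before. *)
Definition fork s y t :=
  [&& e s y, ~~ e y t & [forall x, (x != t) ==> [|| x == s, x == y, e s x | e y x]]].

Definition arrow s t := [exists y, fork s y t].

Hypothesis triple : forall u v w, u != v -> u != w -> v != w ->
  ~~ e u v -> ~~ e u w -> ~~ e v w -> arrow u v || arrow v u.

Section Longest.

Variables (V0 : {set T}) (h : T).
Hypothesis Vmax : forall s, sorted e s -> uniq s -> size s <= #|V0|.
Hypothesis hV0 : h \notin V0.

Definition spans x p y := [/\ walk e x p y, uniq p & p =i V0].

Lemma no_longer a p b x t y q : spans a p b -> walk e x t y -> uniq q ->
  {in q, forall w, w \notin V0} -> q != [::] -> perm_eq t (q ++ p) -> False.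
Proof.
case=> [wp up pV] wt uq qV q0 pt.
have ut : uniq t.
  rewrite (perm_uniq pt) cat_uniq uq up andbT; apply/hasPn=> w wp'.
  by apply: contraTN wp' => /qV; rewrite pV.
have := Vmax (walk_sorted wt) ut; rewrite (perm_size pt) size_cat.
by rewrite -(eq_card pV) (card_uniqP up); case: q q0 {uq qV pt} => //= *; lia.
Qed.

Lemma no_longer_cons a p b x t y w : spans a p b -> w \notin V0 -> walk e x t y ->
  perm_eq t (w :: p) -> False.
Proof.
move=> sp wV wt pt; apply: (@no_longer _ _ _ _ _ _ [:: w] sp wt _ _ _ pt) => // z.
by rewrite inE => /eqP ->.
Qed.

Lemma no_longer1 a p b x t y : spans a p b -> walk e x t y ->
  perm_eq t (h :: p) -> False.
Proof. by move=> sp; apply: no_longer_cons sp hV0. Qed.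

Definition off := [set w | (w \notin V0) && connect (induced e (~: V0)) h w].
Definition X := [set x in V0 | [exists w in off, e x w]].

Lemma h_off : h \in off.
Proof. by rewrite inE hV0 connect0. Qed.

Lemma off_walk w w' : w \in off -> w' \in off ->
  exists q, [/\ walk e w q w', uniq q & {in q, forall z, z \notin V0}].
Proof.
have cs : connect_sym (induced e (~: V0)).
  by apply: sym_connect_sym => x y; rewrite /induced /= sym andbCA.
rewrite !inE => /andP[wV cw] /andP[w'V cw'].
have [||q [wq uq qV]] := @connect_walk _ e (~: V0) w w'; first by rewrite inE.
  by apply: connect_trans cw'; rewrite cs.
by exists q; split=> // z /qV; rewrite inE.
Qed.

Lemma off_closed w y : w \in off -> e w y -> y \notin V0 -> y \in off.
Proof.
rewrite !inE => /andP[wV cw] ewy yV; rewrite yV; apply: (connect_trans cw).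
by apply: connect1; rewrite /induced /= !inE wV yV.
Qed.

Definition K p v := v |: [set nx p x | x in X].

Lemma spans_rev x p y : spans x p y -> spans y (rev p) x.
Proof.
case=> w u pV; split; rewrite ?rev_uniq //; first exact: walk_rev.
by move=> z; rewrite mem_rev pV.
Qed.

Lemma X_V x : x \in X -> x \in V0.
Proof. by rewrite inE => /andP[]. Qed.

Lemma X_off x : x \in X -> exists2 w, w \in off & e x w.
Proof. by rewrite inE => /andP[_ /exists_inP]. Qed.

Lemma off_X w y : w \in off -> e w y -> y \in V0 -> y \in X.
Proof.
by move=> wo ewy yV; rewrite inE yV; apply/exists_inP; exists w; rewrite // sym.
Qed.

Lemma off_V w : w \in off -> w \notin V0.
Proof. by rewrite inE => /andP[]. Qed.

Lemma start_X v p u : spans v p u -> v \notin X.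
Proof.
move=> sp; apply/negP=> /X_off[w wo evw]; have [wp _ _] := sp.
apply: (no_longer_cons sp (off_V wo) (walk_cons (_ : e w v) wp) (perm_refl _)).
by rewrite sym.
Qed.

Lemma split_X v p u x : spans v p u -> x \in X ->
  exists s1 s2 x', [/\ p = s1 ++ s2, walk e v s1 x, walk e x' s2 u, e x x' & nx p x = x'].
Proof.
move=> sp xX; have [wp up pV] := sp.
have [||s1 [s2 [x' [E w1 w2 ex]]]] := walk_split (z := x) wp.
- by rewrite pV X_V.
- by apply: contraTneq xX => ->; apply: (start_X (spans_rev sp)).
by exists s1, s2, x'; split=> //; rewrite E in up *; apply: nxE w1 w2.
Qed.

Lemma K_V v p u : spans v p u -> {subset K p v <= V0}.
Proof.
move=> sp z; have [wp up pV] := sp; rewrite !inE => /orP[/eqP ->|/imsetP[x xX ->]].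
  by rewrite -pV (walk_head wp).
have [s1 [s2 [x' [E _ w2 _ ->]]]] := split_X sp xX.
by rewrite -pV E mem_cat (walk_head w2) orbT.
Qed.

Lemma K_off v p u w a : spans v p u -> w \in off -> a \in K p v -> ~~ e w a.
Proof.
move=> sp wo aK; apply/negP=> ewa; move: aK; rewrite !inE => /orP[/eqP E|/imsetP[x xX E]].
  have := start_X sp; rewrite -E (off_X wo ewa) // E.
  by have [wp _ pV] := sp; rewrite -pV (walk_head wp).
have [s1 [s2 [x' [Ep w1 w2 _ nE]]]] := split_X sp xX; rewrite nE in E.
have [w' wo' exw'] := X_off xX; have [q [wq uq qV]] := off_walk wo' wo.
rewrite E in ewa.
apply: (no_longer sp (walk_cat w1 (walk_cat wq w2 ewa) exw') uq qV).
  by case: q wq {uq qV}.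
by rewrite Ep; perm_count.
Qed.

Lemma nx_K_neq v p u x : spans v p u -> x \in X -> nx p x != v.
Proof.
move=> sp xX; have [s1 [s2 [x' [Ep w1 w2 _ ->]]]] := split_X sp xX.
have [_ up _] := sp; move: up; rewrite Ep cat_uniq => /and3P[_ /hasPn/(_ x') H _].
by apply: contraTneq (H (walk_head w2)) => ->; rewrite negbK /= (walk_head w1).
Qed.

Lemma nx_X_neq v p u x : spans v p u -> x \in X -> nx p x != x.
Proof.
by move=> sp xX; have [s1 [s2 [x' [_ _ _ ex ->]]]] := split_X sp xX;
  apply: contraTneq ex => ->; rewrite irr.
Qed.

Lemma nx_X_inj v p u : spans v p u -> {in X &, injective (nx p)}.
Proof.
move=> sp x y xX yX; have [wp up pV] := sp; apply: nx_inj => //.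
- by rewrite pV X_V.
- by rewrite pV X_V.
- by rewrite pV; apply: (K_V sp); rewrite !inE imset_f ?orbT.
- exact: nx_X_neq sp _.
- exact: nx_X_neq sp _.
Qed.

Lemma card_K v p u : spans v p u -> #|K p v| = #|X|.+1.
Proof.
move=> sp; rewrite cardsU1 (card_in_imset (nx_X_inj sp)).
case: imsetP => // -[x xX E]; by have := nx_K_neq sp xX; rewrite -E eqxx.
Qed.

Lemma start_nx v p u x : spans v p u -> x \in X -> ~~ e v (nx p x).
Proof.
move=> sp xX; have [s1 [s2 [x' [Ep w1 w2 _ ->]]]] := split_X sp xX.
apply/negP=> ev; have [w wo exw] := X_off xX.
apply: (no_longer_cons sp (off_V wo) (walk_cons (_ : e w x) (walk_cat (walk_rev sym w1) w2 ev))).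
  by rewrite sym.
by rewrite Ep; perm_count.
Qed.

Lemma nx_nx v p u x y : spans v p u -> x \in X -> y \in X -> x != y ->
  ~~ e (nx p x) (nx p y).
Proof.
move=> sp.
(* wlog y comes after x on p *)
suff H x1 y1 s1 s2 x1' y1' t1 t2 : x1 \in X -> y1 \in X -> p = s1 ++ s2 ->
    walk e v s1 x1 -> s2 = t1 ++ t2 -> walk e x1' t1 y1 -> walk e y1' t2 u ->
    ~~ e x1' y1'.
  move=> xX yX xy; have [wp up pV] := sp.
  have [s1 [s2 [x' [Ep w1 w2 ex nE]]]] := split_X sp xX.
  have yu : y != u by apply: contraTneq yX => ->; apply: (start_X (spans_rev sp)).
  have : (y \in s1) || (y \in s2) by rewrite -mem_cat -Ep pV X_V.
  case/orP=> ys.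
    have yx : y != x by rewrite eq_sym.
    have [r1 [r2 [y' [E1 v1 v2 ey]]]] := walk_split w1 ys yx.
    have -> : nx p y = y'.
      rewrite Ep E1 -catA; rewrite Ep E1 -catA in up.
      exact: nxE up v1 (walk_cat v2 w2 ex).
    rewrite nE sym.
    by apply: (H y x r1 (r2 ++ s2) y' x' r2 s2) => //; rewrite Ep E1 catA.
  have [r1 [r2 [y' [E1 v1 v2 ey]]]] := walk_split w2 ys yu.
  have -> : nx p y = y'.
    rewrite Ep E1 catA; rewrite Ep E1 catA in up.
    exact: nxE up (walk_cat w1 v1 ex) v2.
  by rewrite nE; apply: (H x y s1 s2 x' y' r1 r2).
move=> xX yX Ep w1 Es wt1 wt2; apply/negP=> exy.
have [w wo exw] := X_off xX; have [w' wo' eyw'] := X_off yX.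
have [q [wq uq qV]] := off_walk wo wo'.
apply: (no_longer sp (walk_cat w1 (walk_cat wq (walk_cat (walk_rev sym wt1) wt2 exy) _) exw) uq qV).
- by rewrite sym.
- by case: q wq {uq qV}.
- by rewrite Ep Es; perm_count.
Qed.

Definition independent (L : {set T}) := forall a b, a \in L -> b \in L -> ~~ e a b.

Lemma K_independent v p u : spans v p u -> independent (K p v).
Proof.
move=> sp a b; rewrite !inE => /orP[/eqP ->|/imsetP[x xX ->]] /orP[/eqP ->|/imsetP[y yX ->]].
- by rewrite irr.
- exact: start_nx sp _.
- by rewrite sym; apply: start_nx sp _.
- by case: (eqVneq x y) => [->|xy]; [rewrite irr | apply: nx_nx sp _ _ _].
Qed.

(* In an independent set with more than two elements at most one vertex has no
   arrow into it; the witnesses of the others are distinct and, except for the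
   one of h, lie in X. *)
Section Extremal.

Variable L : {set T}.
Hypothesis indL : independent L.
Hypothesis offL : forall w a, w \in off -> a \in L -> ~~ e w a.
Hypothesis L2 : 1 < #|L|.

Lemma h_L : h \notin L -> #|h |: L| = #|L|.+1.
Proof. by rewrite cardsU1 => ->. Qed.

Definition target t := [exists s in h |: L, arrow s t].

Lemma target_or a b : h \notin L -> a \in h |: L -> b \in h |: L -> a != b ->
  target a || target b.
Proof.
move=> hL aJ bJ ab.
have indJ c d : c \in h |: L -> d \in h |: L -> ~~ e c d.
  rewrite !inE => /orP[/eqP ->|cL] /orP[/eqP ->|dL].
  - by rewrite irr.
  - exact: offL h_off dL.
  - by rewrite sym; apply: offL h_off cL.
  - exact: indL.
have : (h |: L) :\: [set a; b] != set0.
  rewrite -card_gt0 cardsD (setIidPr _); last by apply/subsetP=> z /set2P[] ->.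
  by rewrite h_L // cards2 ab; lia.
case/set0Pn=> c; rewrite in_setD in_set2 negb_or => /andP[/andP[ca cb] cJ].
have := @triple a b c ab; rewrite ![_ == c]eq_sym ca cb !indJ // => /(_ isT isT isT isT isT).
case/orP=> H; apply/orP; [right|left]; apply/exists_inP; by [exists a|exists b].
Qed.

Definition misses t y :=
  [&& y \in X, e h y, ~~ e y t & [forall a in L, (a != t) ==> e y a]].

Lemma fork_adj s y t a : s \in h |: L -> fork s y t -> t \in h |: L ->
  a \in h |: L -> a != t -> e y a.
Proof.
have indJ c d : c \in h |: L -> d \in h |: L -> ~~ e c d.
  rewrite !inE => /orP[/eqP ->|cL] /orP[/eqP ->|dL].
  - by rewrite irr.
  - exact: offL h_off dL.
  - by rewrite sym; apply: offL h_off cL.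
  - exact: indL.
move=> sJ /and3P[esy eyt /forallP H] tJ aJ at_; have := implyP (H a) at_.
case/or4P => [/eqP ->|/eqP E||//]; first by rewrite sym.
  by move: esy; rewrite -E (negbTE (indJ _ _ _ _)).
by rewrite (negbTE (indJ _ _ _ _)).
Qed.

Lemma target_misses t : h \notin L -> t \in L -> target t -> exists y, misses t y.
Proof.
move=> hL tL /exists_inP[s sJ /existsP[y fy]]; exists y.
have tJ : t \in h |: L by rewrite !inE tL orbT.
have ht : h != t by apply: contraNneq hL => ->.
have hy : e h y by rewrite sym; apply: (fork_adj sJ fy) => //; rewrite !inE eqxx.
have adj a : a \in L -> a != t -> e y a.
  by move=> aL; apply: (fork_adj sJ fy) => //; rewrite !inE aL orbT.
apply/and4P; split=> //; last by apply/forall_inP=> a aL; apply/implyP; apply: adj.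
  apply: (off_X h_off hy); apply/negPn/negP=> yV.
  have [a /andP[aL at_]] : exists a, (a \in L) && (a != t).
    have /set0Pn[a] : L :\ t != set0 by rewrite -card_gt0; move: L2; rewrite (cardsD1 t L) tL.
    by rewrite !inE andbC => H; exists a.
  by have := offL (off_closed h_off hy yV) aL; rewrite adj.
by case/and3P: fy.
Qed.

Let w t := odflt h [pick y | misses t y].

Lemma w_misses t : h \notin L -> t \in L -> target t -> misses t (w t).
Proof.
move=> hL tL /(target_misses hL tL)[y my]; rewrite /w; case: pickP => //= H.
by rewrite H in my.
Qed.

Let D := [set t in L | target t].

Lemma w_inj : h \notin L -> {in D &, injective w}.
Proof.
move=> hL s t; rewrite !inE => /andP[sL /(w_misses hL sL)] /and4P[_ _ ws _].
case/andP=> tL /(w_misses hL tL) /and4P[_ _ _ /forall_inP/(_ _ sL)] H E.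
by apply/eqP; apply: contraNT ws => st; rewrite E; apply: (implyP H).
Qed.

Lemma w_sub : h \notin L -> w @: D \subset X.
Proof.
move=> hL; apply/subsetP=> _ /imsetP[t tD ->]; move: tD; rewrite inE => /andP[tL].
by case/(w_misses hL tL)/and4P.
Qed.

Lemma card_LD : h \notin L -> #|L :\: D| <= 1.
Proof.
move=> hL; rewrite leqNgt; apply/card_gt1P=> -[a [b [aD bD ab]]].
move: aD bD; rewrite !inE; case: (boolP (a \in L)) => // aL; case: (boolP (b \in L)) => // bL.
rewrite /= !andbT => /negbTE ta /negbTE tb.
by have := target_or hL (_ : a \in h |: L) (_ : b \in h |: L) ab; rewrite ta tb !inE aL bL !orbT => /(_ isT isT).
Qed.

Lemma card_DX : h \notin L -> #|D| <= #|X|.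
Proof. by move=> hL; rewrite -(card_in_imset (w_inj hL)) subset_leq_card // w_sub. Qed.

Lemma card_D : #|L| = #|D| + #|L :\: D|.
Proof. by rewrite -(cardsID D L) (setIidPr _) //; apply/subsetP=> t; rewrite inE => /andP[]. Qed.

Lemma independent_card : h \notin L -> #|L| <= #|X|.+1.
Proof. by move=> hL; rewrite card_D; have := card_DX hL; have := card_LD hL; lia. Qed.

Lemma extremal : h \notin L -> #|L| = #|X|.+1 ->
  [/\ exists s y, [/\ s \in L, fork s y h & forall a, a \in L -> e y a],
      forall x, x \in X -> e h x &
      forall t x x', t \in L -> x \in X -> x' \in X -> ~~ e x t -> ~~ e x' t -> x = x'].
Proof.
move=> hL cL; have cD := card_D; have lt1 := card_LD hL; have le := card_DX hL.
have eX : w @: D = X.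
  by apply/eqP; rewrite eqEcard w_sub // (card_in_imset (w_inj hL)); lia.
have Xw x : x \in X -> exists t, [/\ t \in L, misses t x & x = w t].
  rewrite -eX => /imsetP[t]; rewrite inE => /andP[tL tt] E; exists t; split=> //.
  by rewrite E; apply: w_misses.
split.
- have /set0Pn[u0] : L :\: D != set0 by rewrite -card_gt0; lia.
  rewrite !inE => /andP[nt uL].
  have hu : h != u0 by apply: contraNneq hL => ->.
  have := target_or hL (_ : h \in h |: L) (_ : u0 \in h |: L) hu.
  rewrite !inE eqxx uL orbT => /(_ isT isT)/orP[/exists_inP[s sJ /existsP[y fy]]|tu].
    have sL : s \in L.
      move: sJ fy; rewrite !inE => /orP[/eqP ->|//] /and3P[ehy].
      by rewrite sym ehy.
    exists s, y; split=> // a aL; apply: (fork_adj _ fy); rewrite ?inE ?eqxx ?sL ?aL ?orbT //.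
    by apply: contraNneq hL => <-.
  by move: nt; rewrite uL tu.
- by move=> x /Xw[t [_ /and4P[]]].
- move=> t x x' tL /Xw[r [rL /and4P[_ _ _ /forall_inP/(_ _ tL) H] E]].
  case/Xw => [r' [r'L /and4P[_ _ _ /forall_inP/(_ _ tL) H'] E']] nx nx'.
  have : t = r by apply/eqP; apply: contraNT nx; apply: (implyP H).
  have : t = r' by apply/eqP; apply: contraNT nx'; apply: (implyP H').
  by move=> Er Er'; rewrite E E' -Er -Er'.
Qed.

End Extremal.

Hypothesis X2 : 1 < #|X|.

Lemma h_K v p u : spans v p u -> h \notin K p v.
Proof. by move=> sp; apply: contra hV0 => /(K_V sp). Qed.

Lemma K_extremal v p u : spans v p u ->
  [/\ exists s y, [/\ s \in K p v, fork s y h & forall a, a \in K p v -> e y a],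
      forall x, x \in X -> e h x &
      forall t x x', t \in K p v -> x \in X -> x' \in X -> ~~ e x t -> ~~ e x' t -> x = x'].
Proof.
move=> sp; apply: extremal; rewrite ?(card_K sp) ?(h_K sp) //.
- exact: K_independent sp.
- by move=> w a; apply: (K_off sp).
- exact: ltnW.
Qed.

Lemma off1 v p u w : spans v p u -> w \in off -> w = h.
Proof.
move=> sp wo; have [[s [y [sK /and3P[esy eyh /forallP dom] yK]]] Xh _] := K_extremal sp.
apply/eqP/negPn/negP=> wh; have := implyP (dom w) wh.
have yo : y \notin off by apply/negP=> yo; have := K_off sp yo sK; rewrite yK.
case/or4P=> [/eqP E|/eqP E|esw|eyw].
- by have := off_V wo; rewrite E (K_V sp).
- by rewrite -E wo in yo.
- by have := K_off sp wo sK; rewrite sym esw.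
- have yV : y \in V0.
    by apply: contraR yo => yV; apply: (off_closed wo); rewrite // sym.
  have yX : y \in X by apply: (off_X wo _ yV); rewrite sym.
  by move: (Xh _ yX); rewrite sym (negbTE eyh).
Qed.

Lemma adj_h v p u x : spans v p u -> e h x -> x \in X.
Proof.
move=> sp ehx; have [xV|xV] := boolP (x \in V0); first exact: off_X h_off ehx xV.
by have := off1 sp (off_closed h_off ehx xV) => E; rewrite E irr in ehx.
Qed.

Lemma end_closed v s1 x x' s2 u : spans v (s1 ++ s2) u -> x \in X ->
  walk e v s1 x -> walk e x' s2 u -> e x x' -> {in s2, forall w, w \notin X} ->
  u = x' \/ e u x'.
Proof.
move=> sp xX w1 w2 ex no; have [wp up pV] := sp.
have [_ Xh _] := K_extremal sp; have uX := start_X (spans_rev sp).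
case: (eqVneq u x') => [|ux']; first by left.
case: (boolP (e u x')) => [|nux]; first by right.
have uv : u != v.
  apply/eqP=> E; rewrite -E in w1 wp sp uX *; have := walk_single wp up => E1.
  by have := xX; rewrite inE -pV E1 inE => /andP[/eqP E2]; rewrite E2 (negbTE uX) in xX.
have indK := K_independent sp.
have Kx z : z \in X -> z != x -> exists t1 t2 z',
    [/\ s1 = t1 ++ t2, walk e v t1 z, walk e z' t2 x, e z z' & nx (s1 ++ s2) z = z'].
  move=> zX zx; have zs1 : z \in s1.
    have : z \in s1 ++ s2 by rewrite pV X_V.
    by rewrite mem_cat => /orP[//|/no]; rewrite zX.
  have [t1 [t2 [z' [E v1 v2 ez]]]] := walk_split w1 zs1 zx; exists t1, t2, z'; split=> //.
  rewrite E -catA in up *; exact: nxE up v1 (walk_cat v2 w2 ex).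
have nxx : nx (s1 ++ s2) x = x' by apply: nxE up w1 w2.
have uK : u \notin K (s1 ++ s2) v.
  rewrite !inE (negbTE uv) /=; apply/imsetP=> -[z zX].
  case: (eqVneq z x) => [->|zx]; first by rewrite nxx; apply/eqP.
  have [t1 [t2 [z' [E v1 v2 ez ->]]]] := Kx _ zX zx => E'.
  move: up; rewrite E cat_uniq => /and3P[_ /hasPn/(_ u (walk_last sym w2))].
  by rewrite /= mem_cat E' (walk_head v2) orbT.
have ind : independent (u |: K (s1 ++ s2) v).
  have nu a : a \in K (s1 ++ s2) v -> ~~ e u a.
    rewrite !inE => /orP[/eqP ->|/imsetP[z zX ->]].
      apply/negP=> euv.
      apply: (no_longer1 sp (walk_cons (Xh _ xX) (walk_cat (walk_rev sym w1) (walk_rev sym w2) _))).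
        by rewrite sym.
      by perm_count.
    case: (eqVneq z x) => [->|zx]; first by rewrite nxx.
    have [t1 [t2 [z' [E v1 v2 ez ->]]]] := Kx _ zX zx; apply/negP=> euz.
    apply: (no_longer1 sp (walk_cat v1 (walk_cons (Xh _ xX)
      (walk_cat (walk_rev sym v2) (walk_rev sym w2) _)) _)).
    - by rewrite sym.
    - by rewrite sym Xh.
    - by rewrite E; perm_count.
  move=> a b; rewrite in_setU1 => /orP[/eqP ->|aK]; rewrite in_setU1 => /orP[/eqP ->|bK].
  - by rewrite irr.
  - exact: nu.
  - by rewrite sym nu.
  - exact: indK.
have := independent_card ind; rewrite cardsU1 uK (card_K sp) add1n => H.
suff : #|X|.+2 <= #|X|.+1 by rewrite ltnn.
apply: H.
- move=> w a wo; rewrite in_setU1 => /orP[/eqP ->|]; last exact: (K_off sp).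
  rewrite (off1 sp wo); apply: contra uX; exact: (adj_h sp).
- by [].
- rewrite in_setU1 negb_or (h_K sp) andbT; apply: contraNneq hV0 => ->.
  by rewrite -pV (walk_last sym wp).
Qed.

Lemma start_closed v s1 x x' s2 u : spans v (s1 ++ s2) u -> x \in X ->
  walk e v s1 x' -> walk e x s2 u -> e x' x -> {in s1, forall w, w \notin X} ->
  v = x' \/ e v x'.
Proof.
move=> sp xX w1 w2 ex no; have := spans_rev sp; rewrite rev_cat => sp'.
apply: (end_closed sp' xX (walk_rev sym w2) (walk_rev sym w1)); first by rewrite sym.
by move=> w; rewrite mem_rev; apply: no.
Qed.

Lemma no_spans v p u : spans v p u -> False.
Proof.
move=> sp; have [wp up pV] := sp.
have [[s [y [sK /and3P[_ nyh _] yK]]] Xh _] := K_extremal sp.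
have hX x : x \in X -> e x h by move=> xX; rewrite sym Xh.
have vX := start_X sp; have uX := start_X (spans_rev sp).
have yv : e v y by rewrite sym yK // !inE eqxx.
have yX : y \notin X by apply/negP=> /hX; rewrite (negbTE nyh).
have ynx x x' : x \in X -> nx p x = x' -> e y x'.
  by move=> xX <-; apply: yK; rewrite !inE imset_f ?orbT.
have yp : y \in p.
  apply/negPn/negP=> yp; apply: (no_longer_cons sp (w := y) _ (walk_cons (_ : e y v) wp) (perm_refl _)).
    by rewrite -pV.
  by rewrite sym.
have yv' : y != v by apply: contraTneq yv => ->; rewrite irr.
have /card_gt0P[x0 x0X] : 0 < #|X| := ltnW X2.
have yu : y != u.
  apply: contraTneq yv => ->; apply/negP=> evu.
  have [s1 [s2 [x' [E w1 w2 ex _]]]] := split_X sp x0X.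
  apply: (no_longer1 sp (walk_cons (Xh _ x0X) (walk_cat (walk_rev sym w1) (walk_rev sym w2) evu))).
  by rewrite E; perm_count.
have [B1 [B2 [f [Ep wB1 wB2 eyf]]]] := walk_split wp yp yu.
have nyy : nx p y = f by rewrite Ep; rewrite Ep in up; apply: nxE up wB1 wB2.
have memp z : z \in X -> (z \in B1) || (z \in B2) by move=> zX; rewrite -mem_cat -Ep pV X_V.
have [/hasP[z1 z1B z1X]|/hasPn noB1] := boolP (has (mem X) B1); last first.
  (* y comes before all the vertices of X *)
  have {}noB1 z : z \in B1 -> z \notin X := noB1 z.
  have [S1 [S2 [g [E1 wS1 wS2 egy]]]] := walk_split_before sym wB1 (walk_last sym wB1) yv'.
  have uB1 : uniq B1 by move: up; rewrite Ep cat_uniq => /andP[].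
  have ES2 : S2 = [:: y] by apply: walk_single wS2 _; move: uB1; rewrite E1 cat_uniq => /and3P[].
  have wS' : walk e y (y :: B2) u by apply: walk_cons wB2.
  have x0S : x0 \in y :: B2.
    by rewrite inE; case/orP: (memp _ x0X) => [/noB1|->]; rewrite ?x0X ?orbT.
  have [S3 [R [x [b [ES' wS3 wR ebx [xX noS3]]]]]] := walk_split_first sym wS' yX x0S x0X.
  have Ep' : p = (S1 ++ S3) ++ R by rewrite Ep E1 ES2 -!catA cat_cons -ES'.
  have noS z : z \in S1 ++ S3 -> z \notin X.
    rewrite mem_cat => /orP[zS|/noS3//]; apply: noB1; by rewrite E1 mem_cat zS.
  have evb : e v b.
    have [||//] := start_closed (s1 := S1 ++ S3) (s2 := R) (x := x) _ xX (walk_cat wS1 wS3 egy) wR ebx noS.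
      by rewrite -Ep'.
    move=> E; move: up; rewrite Ep' -catA cat_uniq => /and3P[_ /hasPn/(_ v) H _].
    by have := H; rewrite mem_cat E (walk_last sym wS3) -E /= (walk_head wS1) => /(_ isT).
  have sp' : spans g (rev S1 ++ y :: B2) u.
    have pp : perm_eq (rev S1 ++ y :: B2) p by rewrite Ep E1 ES2; perm_count.
    split; [exact: walk_cat (walk_rev sym wS1) wS' yv | by rewrite (perm_uniq pp) |].
    by move=> z; rewrite -pV (perm_mem pp).
  have [_ _ inj] := K_extremal sp'.
  have gK : g \in K (rev S1 ++ y :: B2) g by rewrite !inE eqxx.
  have XR z : z \in X -> z \in R.
    move=> zX; have : z \in p by rewrite pV X_V.
    by rewrite Ep' mem_cat => /orP[/noS|//]; rewrite zX.
  have wT : walk e y (S3 ++ S1) g by apply: walk_cat wS3 wS1 _; rewrite sym.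
  have xu : x != u by apply: contraNneq uX => <-.
  have uR : uniq R by move: up; rewrite Ep' cat_uniq => /and3P[].
  have [r1 [r2 [q [ER wr1 wr2 exq]]]] := walk_split wR (walk_head wR) xu.
  have Er1 : r1 = [:: x] by apply: walk_single wr1 _; move: uR; rewrite ER cat_uniq => /andP[].
  have eyq : e y q.
    apply: (ynx x) => //; rewrite Ep' ER catA; rewrite Ep' ER catA in up.
    exact: nxE up (walk_cat (walk_cat wS1 wS3 egy) wr1 ebx) wr2.
  have [egx|negx] := boolP (e x g).
    apply: (no_longer1 sp (walk_cons (Xh _ xX) (walk_cons egx (walk_cat (walk_rev sym wT) wr2 eyq)))).
    by rewrite Ep' ER Er1; perm_count.
  have [M [D [xl [d [ER' wM wD exd [xlX noD]]]]]] := walk_split_last wR uX (XR _ xX) xX.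
  have xlx : xl != x.
    apply/eqP=> E; rewrite E in wM.
    have EM : M = [:: x] by apply: walk_single wM _; move: uR; rewrite ER' cat_uniq => /andP[].
    have : X \subset [set x].
      apply/subsetP=> z zX; rewrite inE; have := XR _ zX; rewrite ER' mem_cat EM inE.
      by case/orP => // /noD; rewrite zX.
    by move/subset_leq_card; rewrite cards1 leqNgt X2.
  have egxl : e g xl.
    rewrite sym; apply/negPn/negP=> ngxl; case/eqP: xlx.
    exact: (inj g xl x gK xlX xX ngxl negx).
  have eyd : e d y.
    rewrite sym; apply: (ynx xl) => //; rewrite Ep' ER' catA; rewrite Ep' ER' catA in up.
    exact: nxE up (walk_cat (walk_cat wS1 wS3 egy) wM ebx) wD.
  apply: (no_longer1 sp (walk_cat (walk_rev sym wD) (walk_cat wT (walk_cat (walk_rev sym wM)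
            (walk1 e h) (hX _ xX)) egxl) eyd)).
  by rewrite Ep' ER'; perm_count.
have [A [B [x [q [EB1 wA wB exq [xX noB]]]]]] := walk_split_last wB1 yX z1B z1X.
have uq : nx p x = q.
  by rewrite Ep EB1 -catA; rewrite Ep EB1 -catA in up; apply: nxE up wA (walk_cat wB wB2 eyf).
have eyq : e y q := ynx _ _ xX uq.
have [/hasP[z2 z2B z2X]|/hasPn noB2] := boolP (has (mem X) B2); last first.
  (* y comes after all the vertices of X *)
  have {}noB2 z : z \in B2 -> z \notin X := noB2 z.
  have noS z : z \in B ++ B2 -> z \notin X by rewrite mem_cat => /orP[/noB|/noB2].
  have [|E|euq] := end_closed (s1 := A) (s2 := B ++ B2) _ xX wA (walk_cat wB wB2 eyf) exq noS.
  - by rewrite catA -EB1 -Ep.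
  - move: up; rewrite Ep EB1 cat_uniq => /and3P[_ /hasPn/(_ u (walk_last sym wB2))].
    by rewrite /= mem_cat E (walk_head wB) orbT.
  apply: (no_longer1 sp (walk_cons (Xh _ xX) (walk_cat (walk_rev sym wA) (walk_cat (walk_rev sym wB)
            (walk_rev sym wB2) _) yv))); first by rewrite sym.
  by rewrite Ep EB1; perm_count.
have [fX|fX] := boolP (f \in X).
  apply: (no_longer1 sp (walk_cat (walk_rev sym wB2) (walk_cons (Xh _ xX)
     (walk_cat (walk_rev sym wA) (walk_rev sym wB) yv)) (hX _ fX))).
  by rewrite Ep EB1; perm_count.
have [C0 [R [x' [b [EB2 wC0 wR ebx [x'X noC]]]]]] := walk_split_first sym wB2 fX z2B z2X.
have x'u : x' != u by apply: contraNneq uX => <-.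
have [r1 [D [q' [ER wr1 wD ex'q]]]] := walk_split wR (walk_head wR) x'u.
have wC : walk e f (C0 ++ r1) x' by apply: walk_cat wC0 wr1 ebx.
have Er1 : r1 = [:: x'].
  apply: walk_single wr1 _; move: up; rewrite Ep EB2 ER !cat_uniq.
  by case/and3P=> _ _ /and3P[_ _ /andP[]].
set C := C0 ++ r1 in wC *.
have Ep' : p = A ++ B ++ C ++ D by rewrite Ep EB1 EB2 ER /C -!catA.
have CX z : z \in C -> z \in X -> z = x'.
  rewrite /C mem_cat Er1 inE => /orP[/noC|/eqP //]; by move=> /negbTE ->.
clearbody C.
have wAB : walk e v (A ++ B) y := walk_cat wA wB exq.
have uq' : nx p x' = q'.
  rewrite Ep' !catA; rewrite Ep' !catA in up.
  exact: nxE up (walk_cat wAB wC eyf) wD.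
have eyq' : e y q' := ynx _ _ x'X uq'.
have nfv : ~~ e f v.
  apply/negP=> efv; apply: (no_longer1 sp (walk_cons (Xh _ x'X) (walk_cat (walk_rev sym wC)
     (walk_cat wAB wD eyq') efv))).
  by rewrite Ep'; perm_count.
have nfK a : a \in K p v -> ~~ e f a.
  rewrite !inE => /orP[/eqP -> //|/imsetP[z zX ->]].
  have zp : z \in p by rewrite pV X_V.
  apply/negP=> efz; move: zp; rewrite Ep' !mem_cat => /or4P[zA|/noB|zC|zD]; rewrite ?zX //.
  - case: (eqVneq z x) => [E|zx].
      rewrite E uq in efz.
      apply: (no_longer1 sp (walk_cat wA (walk_cons (Xh _ x'X) (walk_cat (walk_rev sym wC)
         (walk_cat wB wD eyq') efz)) (hX _ xX))).
      by rewrite Ep'; perm_count.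
    have [A1 [A2 [zn [EA wA1 wA2 ezn]]]] := walk_split wA zA zx.
    have nz : nx p z = zn.
      rewrite Ep' EA -catA; rewrite Ep' EA -catA in up.
      exact: nxE up wA1 (walk_cat wA2 (walk_cat wB (walk_cat wC wD ex'q) eyf) exq).
    rewrite nz in efz.
    apply: (no_longer1 sp (walk_cat wA1 (walk_cons (Xh _ x'X) (walk_cat (walk_rev sym wC)
         (walk_cat (walk_cat wA2 wB exq) wD eyq') efz)) (hX _ zX))).
    by rewrite Ep' EA; perm_count.
  - rewrite (CX z zC zX) uq' in efz.
    apply: (no_longer1 sp (walk_cat (walk_rev sym wD) (walk_cat wC (walk_cons _
        (walk_cat (walk_rev sym wA) (walk_rev sym wB) yv)) (hX _ x'X)) _)).
    + exact: Xh.
    + by rewrite sym.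
    + by rewrite Ep'; perm_count.
  - have zu : z != u by apply: contraNneq uX => <-.
    have [D1 [D2 [zn [ED wD1 wD2 ezn]]]] := walk_split wD zD zu.
    have nz : nx p z = zn.
      rewrite Ep' ED !catA; rewrite Ep' ED !catA in up.
      exact: nxE up (walk_cat (walk_cat wAB wC eyf) wD1 ex'q) wD2.
    rewrite nz in efz.
    apply: (no_longer1 sp (walk_cat wAB (walk_cat wD1 (walk_cons (Xh _ x'X)
         (walk_cat (walk_rev sym wC) wD2 efz)) (hX _ zX)) eyq')).
    by rewrite Ep' ED; perm_count.
have fV : f \in V0 by rewrite -pV Ep mem_cat (walk_head wB2) orbT.
have fK : f \notin K p v.
  rewrite !inE negb_or; apply/andP; split.
    apply: contraTneq up => E; rewrite Ep cat_uniq; apply/negP=> /and3P[_ /hasPn/(_ f (walk_head wB2))].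
    by rewrite /= E (walk_head wB1).
  apply/imsetP=> -[z zX E]; have : y = z; last by move=> E'; rewrite E' zX in yX.
  have zp : z \in p by rewrite pV X_V.
  apply: (nx_inj up yp zp).
  - by rewrite nyy pV.
  - by rewrite nyy; apply: contraTneq eyf => ->; rewrite irr.
  - exact: nx_X_neq sp zX.
  - by rewrite nyy.
have ind : independent (f |: K p v).
  move=> a c; rewrite in_setU1 => /orP[/eqP ->|aK]; rewrite in_setU1 => /orP[/eqP ->|cK].
  - by rewrite irr.
  - exact: nfK.
  - by rewrite sym nfK.
  - exact: (K_independent sp).
have := independent_card ind; rewrite cardsU1 fK (card_K sp) add1n => H.
suff : #|X|.+2 <= #|X|.+1 by rewrite ltnn.
apply: H.
- move=> w a wo; rewrite in_setU1 => /orP[/eqP ->|]; last exact: (K_off sp).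
  by rewrite (off1 sp wo); apply: contra fX; apply: (adj_h sp).
- by [].
- by rewrite in_setU1 negb_or (h_K sp) andbT; apply: contraNneq hV0 => ->.
Qed.

End Longest.
End Traceability.

Lemma longest_path (T : finType) (e : rel T) : exists p, [/\ sorted e p, uniq p &
  forall q, sorted e q -> uniq q -> size q <= size p].
Proof.
pose P n := [exists t : n.-tuple T, sorted e t && uniq t].
have P0 : exists n, P n by exists 0; apply/existsP; exists [tuple].
have Pb n : P n -> n <= #|T|.
  by case/existsP=> t /andP[_ /card_uniqP]; rewrite size_tuple => <-; apply: max_card.
case: (ex_maxnP P0 Pb) => n /existsP[t /andP[st ut]] max; exists t; split=> // q sq uq.
rewrite size_tuple; apply: max; apply/existsP; exists (in_tuple q).
by rewrite /= sq.
Qed.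

Lemma traceable_triples (T : finType) (e : rel T) :
  symmetric e -> irreflexive e -> connected_graph e -> (forall v P, ~ side e v P) ->
  (forall u v w, u != v -> u != w -> v != w ->
    ~~ e u v -> ~~ e u w -> ~~ e v w -> arrow e u v || arrow e v u) ->
  traceable e.
Proof.
move=> sym irr ce nocut triple; have [p [sp up maxp]] := longest_path e.
exists p; split=> // h; apply/negPn/negP=> hp.
pose V0 := [set x in p].
have cV0 : #|V0| = size p by rewrite cardsE; apply/card_uniqP.
have Vmax q : sorted e q -> uniq q -> size q <= #|V0| by rewrite cV0; apply: maxp.
have hV0 : h \notin V0 by rewrite inE.
have p0 : p != [::] by case: (p) (maxp [:: h] isT isT).
have [v [u wp]] := sorted_walk sp p0.
have spn : spans e V0 v p u by split=> // z; rewrite inE.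
have vX := start_X sym Vmax hV0 spn; have vp := walk_head wp.
have offE a b : a \in off e V0 h -> b \notin off e V0 h -> e a b -> b \in X e V0 h.
  move=> ao bo eab; apply: (off_X sym ao eab); apply: contraR bo.
  exact: off_closed ao eab.
have voff : v \notin off e V0 h by rewrite !inE vp.
apply: (no_spans sym irr triple Vmax hV0 _ spn); rewrite ltnNge; apply/negP=> X1.
case: (pickP (mem (X e V0 h))) => [x xX|X0]; last first.
  have E : off e V0 h = [set: T]; last by rewrite E inE in voff.
  apply: (connected_in_closed ce (subsetT _)).
    by apply/set0Pn; exists h; apply: h_off.
  move=> a b ao _ eab; apply/negPn/negP=> bo.
  by have := X0 b; rewrite /= (offE a b).
case: (nocut x (off e V0 h)); split.
- by apply/negP=> /off_V; rewrite (X_V xX).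
- by apply/set0Pn; exists h; apply: h_off.
- by exists v => //; apply: contraNneq vX => ->.
- move=> a b ao bo eab; have bX := offE _ _ ao bo eab.
  by apply: (card_le1_eqP X1).
Qed.

(** * Path covers of a leaf *)

Section Insertion.

Variables (T : eqType) (r : rel T).

Lemma insert_sorted v (M : seq T) : sorted r M ->
  {in M, forall m, r m v || r v m} ->
  exists M', [/\ perm_eq M' (v :: M), sorted r M' & has (r^~ v) M -> ohead M' = ohead M].
Proof.
elim: M => [|m M IH] sM tot; first by exists [:: v].
have sM' : sorted r M by case: (M) sM => //= a b /andP[].
have [hM|nM] := boolP (has (r^~ v) M).
  have [|M' [pM' sM1 /(_ hM) hd]] := IH sM'.
    by move=> z zM; apply: tot; rewrite inE zM orbT.
  exists (m :: M'); split=> //.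
    by rewrite (perm_trans (_ : perm_eq _ (m :: v :: M))) ?perm_cons // (perm_catCA [:: m] [:: v]).
  by case: M' M hd sM1 sM {IH sM' tot hM pM'} => [|a M'] [|b M] //= [->] -> /andP[->].
have [rm|nrm] := boolP (r m v); last first.
  exists (v :: m :: M); split=> //=; last by rewrite (negbTE nrm) (negbTE nM).
  by have := tot m (mem_head _ _); rewrite (negbTE nrm) /= => ->.
exists (m :: v :: M); split=> //=; first by rewrite (perm_catCA [:: m] [:: v]).
rewrite rm; case: M nM tot sM' {IH sM} => //= a M; rewrite negb_or => /andP[na _] tot ->.
by have := tot a; rewrite !inE eqxx orbT (negbTE na) /= => /(_ isT) ->.
Qed.

Lemma sort_total (M : seq T) : uniq M -> {in M &, forall a b, a != b -> r a b || r b a} ->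
  exists2 M', perm_eq M' M & sorted r M'.
Proof.
elim: M => [|m M IH] /=; first by exists [::].
case/andP=> mM uM tot; have [|M1 pM1 sM1] := IH uM.
  by move=> a b aM bM; apply: tot; rewrite inE ?aM ?bM orbT.
have [|M' [pM' sM' _]] := @insert_sorted m M1 sM1.
  move=> a; rewrite (perm_mem pM1) => aM; apply: tot; rewrite ?inE ?eqxx ?aM ?orbT //.
  by apply: contraNneq mM => <-.
by exists M' => //; apply: perm_trans pM' _; rewrite perm_cons.
Qed.

Lemma sort_total_head v w (M : seq T) : uniq M ->
  {in M &, forall a b, a != b -> r a b || r b a} -> v \in M -> w \in M -> w != v -> r w v ->
  exists m M', [/\ perm_eq (m :: M') M, sorted r (m :: M') & v \in M'].
Proof.
move=> uM tot vM wM wv rwv; have pM := perm_to_rem vM.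
have uM' : uniq (rem v M) by apply: rem_uniq.
have memr z : z \in rem v M -> (z \in M) /\ z != v.
  by rewrite mem_rem_uniq // !inE => /andP[].
have [|M1 pM1 sM1] := sort_total uM'.
  by move=> a b /memr[aM _] /memr[bM _]; apply: tot.
have [|M2 [pM2 sM2 hd]] := @insert_sorted v M1 sM1.
  move=> a; rewrite (perm_mem pM1) => /memr[aM av]; exact: tot.
have wM1 : w \in M1 by rewrite (perm_mem pM1) mem_rem_uniq // !inE wv.
have {}hd : ohead M2 = ohead M1 by apply: hd; apply/hasP; exists w.
case: M1 hd pM2 pM1 wM1 {sM1} => // m M1; case: M2 sM2 => // m' M2 sM2 [E] pM2 pM1 _.
rewrite {m'}E in sM2 pM2.
have p2 : perm_eq (m :: M2) M.
  rewrite (perm_trans pM2) // (perm_trans _ (_ : perm_eq (v :: rem v M) M)) 1?perm_sym //.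
  by rewrite perm_sym perm_cons.
exists m, M2; split=> //.
have : v \in m :: M2 by rewrite (perm_mem p2).
rewrite inE => /orP[/eqP E|//].
by have := memr m; rewrite -(perm_mem pM1) mem_head E eqxx => /(_ isT)[].
Qed.

End Insertion.

Section Cover.

Variables (T : finType) (e : rel T).
Hypothesis sym : symmetric e.
Hypothesis irr : irreflexive e.
Variables A R : {set T}.
Implicit Types (x y z a b s t u v p r : T) (q : seq T).

(* A and R are the neighbours and the non-neighbours of the cut-vertex c in a leaf;
   {c, s, a} dominates the leaf once the edge st is added, and not before. *)
Definition fan s a t :=
  [&& a \in A, e s a, ~~ e a t &
      [forall x in R, (x != t) ==> [|| x == s, e s x | e a x]]].

Definition fanned s t := [exists a, fan s a t].

Hypothesis clique : {in A &, forall a b, a != b -> e a b}.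
Hypothesis AR : forall x, x \in A -> x \notin R.
Hypothesis A0 : A != set0.
Hypothesis R0 : R != set0.
Hypothesis fans : {in R &, forall u v, u != v -> ~~ e u v -> fanned u v || fanned v u}.
Hypothesis miss : {in A &, forall a b, a != b -> exists2 r, r \in R & ~~ e a r && ~~ e b r}.
Hypothesis exits : forall a (S : {set T}), a \in A -> S \subset R -> S != set0 ->
  exists x y, [/\ x \in S, y \in (A :|: R) :\: S, y != a & e x y].

Definition hooked := exists a q y, [/\ a \in A, walk e a q y, uniq q,
  {subset q <= A :|: R} & {subset R <= q}].

Lemma hook a (p : seq T) x y q : a \in A -> walk e x p y -> e a x ->
  perm_eq p (q ++ enum R) -> uniq (a :: q) -> {subset q <= A} -> hooked.
Proof.
move=> aA wp eax pp uq qA; exists a, (a :: p), y.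
have memp z : (z \in p) = (z \in q) || (z \in R) by rewrite (perm_mem pp) mem_cat mem_enum.
split=> //; first exact: walk_cons wp.
- move: uq => /= /andP[aq uq]; rewrite memp negb_or aq (AR aA) (perm_uniq pp) cat_uniq uq.
  rewrite enum_uniq /= andbT; apply/hasPn=> z; rewrite mem_enum => zR.
  by apply/negP=> /qA /AR; rewrite zR.
- move=> z; rewrite inE memp !inE => /or3P[/eqP ->|/qA ->|->]; by rewrite ?aA ?orbT.
- by move=> z zR; rewrite inE memp zR !orbT.
Qed.

Lemma fan_head s a t : fan s a t -> a \in A /\ e s a.
Proof. by case/and4P. Qed.

Lemma fan_miss s a t : fan s a t -> e a t = false.
Proof. by case/and4P=> _ _ /negbTE. Qed.

Lemma fan_dom s a t x : fan s a t -> x \in R -> x != t -> x != s -> ~~ e s x -> e a x.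
Proof.
case/and4P=> _ _ _ /forall_inP H xR xt /negbTE xs /negbTE nsx.
by have := implyP (H _ xR) xt; rewrite xs nsx.
Qed.

Lemma fan_dom' s a t x : fan s a t -> x \in R -> x != t -> x != s -> ~~ e a x -> e s x.
Proof. by move=> f xR xt xs; apply: contraNT; apply: fan_dom f _ _ _. Qed.

Lemma one_path (p : seq T) u v : walk e u p v -> perm_eq p (enum R) -> hooked.
Proof.
move=> wp pp; have memp z : (z \in p) = (z \in R) by rewrite (perm_mem pp) mem_enum.
have up : uniq p by rewrite (perm_uniq pp) enum_uniq.
have endA x y q : walk e x q y -> perm_eq q p -> (exists2 a, a \in A & e x a) -> hooked.
  move=> wq pq [a aA exa]; apply: (hook (q := [::]) aA wq) => //; first by rewrite sym.
  exact: perm_trans pq pp.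
have [a0 a0A] := set0Pn _ A0.
have [x [y [xR]]] := exits a0A (subxx R) R0; rewrite !inE => /andP[yR yA] _ exy.
have {yR} yA : y \in A by move: yA; rewrite (negbTE yR) orbF.
have [xu|xu] := eqVneq x u.
  by apply: (endA _ _ _ wp) => //; exists y; rewrite // -xu.
have [p1 [p2 [x' [Ep w1 w2 ex]]]] := walk_split_before sym wp (etrans (memp x) xR) xu.
have [euv|nuv] := boolP (e v u).
  apply: (endA _ _ _ (walk_cat w2 w1 euv)); first by rewrite Ep perm_catC.
  by exists y.
have uv : u != v.
  apply/eqP=> E; rewrite -E in wp; have Eq := walk_single wp up.
  by move: xR xu; rewrite -memp Eq inE => ->.
have := fans _ _ uv; rewrite -!memp (walk_head wp) (walk_last sym wp) sym => /(_ isT isT nuv).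
case/orP=> /existsP[a /fan_head[aA ea]].
  by apply: (endA _ _ _ wp) => //; exists a.
by apply: (endA _ _ _ (walk_rev sym wp)); [rewrite perm_rev|exists a].
Qed.

Section TwoPaths.

Hypothesis noham : forall (p : seq T) u v, walk e u p v -> ~~ perm_eq p (enum R).

Lemma join2 x1 (p1 : seq T) x2 y1 (p2 : seq T) y2 a1 a2 a3 :
  walk e x1 p1 x2 -> walk e y1 p2 y2 -> perm_eq (p1 ++ p2) (enum R) ->
  a1 \in A -> a2 \in A -> a3 \in A -> e a1 x1 -> e a2 x2 -> e a3 y1 ->
  a1 != a2 -> a1 != a3 -> hooked.
Proof.
move=> w1 w2 pp a1A a2A a3A e1 e2 e3 n12 n13.
have [E|n23] := eqVneq a2 a3.
  apply: (hook (q := [:: a2]) a1A (walk_cat w1 (walk_cons (_ : e a2 y1) w2) _) e1).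
  - by rewrite E.
  - by rewrite sym.
  - by rewrite (perm_trans (_ : perm_eq _ (a2 :: p1 ++ p2))) ?perm_cons // (perm_catCA p1 [:: a2]).
  - by rewrite /= inE n12.
  - by move=> z; rewrite inE => /eqP ->.
apply: (hook (q := [:: a2; a3]) a1A
         (walk_cat w1 (walk_cons (clique a2A a3A n23) (walk_cons e3 w2)) _) e1).
- by rewrite sym.
- by rewrite (perm_trans (_ : perm_eq _ (a2 :: a3 :: p1 ++ p2))) ?perm_cons // (perm_catCA p1 [:: a2; a3]).
- by rewrite /= !inE negb_or n12 n13 n23.
- by move=> z; rewrite !inE => /orP[] /eqP ->.
Qed.

Lemma ends_nonadj x1 (p1 : seq T) x2 y1 (p2 : seq T) y2 : walk e x1 p1 x2 -> walk e y1 p2 y2 ->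
  perm_eq (p1 ++ p2) (enum R) -> ~~ e x2 y1.
Proof.
move=> w1 w2 pp; apply/negP=> exy; have := noham (walk_cat w1 w2 exy).
by rewrite pp.
Qed.

Lemma two_R (p1 p2 : seq T) x : perm_eq (p1 ++ p2) (enum R) -> (x \in p1) || (x \in p2) = (x \in R).
Proof. by move/perm_mem/(_ x); rewrite mem_cat mem_enum. Qed.

Lemma two_neq (p1 p2 : seq T) x y : perm_eq (p1 ++ p2) (enum R) -> x \in p1 -> y \in p2 -> x != y.
Proof.
move/perm_uniq; rewrite enum_uniq cat_uniq => /and3P[_ /hasPn H _] xp /H.
by apply: contraNneq => <-.
Qed.

Lemma two_fan_nontrivial s (p1 : seq T) t p (p2 : seq T) r a : walk e s p1 t -> walk e p p2 r ->
  perm_eq (p1 ++ p2) (enum R) -> p != r -> fan s a p -> hooked.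
Proof.
move=> w1 w2 pp pr fa.
have pp' : perm_eq (p2 ++ p1) (enum R) by rewrite perm_catC.
have w1r := walk_rev sym w1; have w2r := walk_rev sym w2.
have r1 q : perm_eq (rev p1 ++ q) (p1 ++ q) by rewrite perm_cat2r perm_rev.
have r2 q : perm_eq (q ++ rev p2) (q ++ p2) by rewrite perm_cat2l perm_rev.
have nsp : ~~ e s p := ends_nonadj w1r w2 (perm_trans (r1 _) pp).
have nsr : ~~ e s r := ends_nonadj w1r w2r (perm_trans (r1 _) (perm_trans (r2 _) pp)).
have ntp : ~~ e t p := ends_nonadj w1 w2 pp.
have ntr : ~~ e t r := ends_nonadj w1 w2r (perm_trans (r2 _) pp).
have sp1 := walk_head w1; have tp1 := walk_last sym w1.
have pp2 := walk_head w2; have rp2 := walk_last sym w2.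
have sR : s \in R by rewrite -(two_R _ pp) sp1.
have tR : t \in R by rewrite -(two_R _ pp) tp1.
have pR : p \in R by rewrite -(two_R _ pp) pp2 orbT.
have rR : r \in R by rewrite -(two_R _ pp) rp2 orbT.
have sr := two_neq pp sp1 rp2; have sp := two_neq pp sp1 pp2.
have tr := two_neq pp tp1 rp2; have tp := two_neq pp tp1 pp2.
have [aA esa] := fan_head fa; have eas : e a s by rewrite sym.
have ear : e a r by apply: (fan_dom fa rR); rewrite // eq_sym.
have nap := fan_miss fa.
have toward b : fan s b r -> hooked.
  move=> fb; have [bA esb] := fan_head fb.
  apply: (join2 w2 w1 pp' bA aA aA _ ear eas).
  - by apply: (fan_dom fb pR) => //; rewrite eq_sym.
  - by apply: contraTneq ear => <-; rewrite (fan_miss fb).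
  - by apply: contraTneq ear => <-; rewrite (fan_miss fb).
have /orP[/existsP[b]|/existsP[b fb]] := fans sR rR sr nsr; first exact: toward.
have [bA erb] := fan_head fb.
have ba : b != a by apply: contraTneq eas => <-; rewrite (fan_miss fb).
have [st|st] := eqVneq s t; last first.
  apply: (join2 w1r w2r _ bA aA aA _ eas ear) => //.
    exact: perm_trans (r1 _) (perm_trans (r2 _) pp).
  apply: (fan_dom fb tR) => //; first by rewrite eq_sym.
  by rewrite sym.
rewrite -{}st in w1 w1r tp1 ntp ntr tR tr tp *.
have up1 : uniq p1 by move: (enum_uniq (mem R)); rewrite -(perm_uniq pp) cat_uniq => /andP[].
have E1 := walk_single w1 up1.
have [/exists_inP[a' a'A /andP[a'a a'p]]|/exists_inPn noP] :=
    boolP [exists a' in A, (a' != a) && e a' p].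
  exact: (join2 w2 w1 pp' a'A aA aA a'p ear eas).
have [/exists_inP[a' a'A /andP[a'a a's]]|/exists_inPn noS] :=
    boolP [exists a' in A, (a' != a) && e a' s].
  exact: (join2 w1 w2r (perm_trans (r2 _) pp) a'A aA aA a's eas ear).
have noPA c : c \in A -> e c p = false.
  move=> cA; have [->//|ca] := eqVneq c a.
  by have := noP _ cA; rewrite ca /= => /negbTE.
have [||x [y []]] := exits aA (_ : [set s] \subset R).
- by rewrite sub1set.
- by rewrite -card_gt0 cards1.
rewrite !inE => /eqP -> /andP[ys yAR] ya esy.
have yR : y \in R.
  case/orP: yAR => // yA; have := noS _ yA; by rewrite ya sym esy.
have yp2 : y \in p2.
  by have := two_R y pp; rewrite yR E1 inE (negbTE ys).
have yp : y != p by apply: contraNneq nsp => <-.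
have yr : y != r by apply: contraNneq nsr => <-.
have [q1 [q2 [z [Eq wq1 wq2 ezy]]]] := walk_split_before sym w2 yp2 yp.
have [q3 [q4 [z' [Eq' wq3 wq4 eyz]]]] := walk_split wq2 (walk_head wq2) yr.
have up2 : uniq p2 by move: (enum_uniq (mem R)); rewrite -(perm_uniq pp) cat_uniq => /and3P[].
have Eq3 : q3 = [:: y].
  by apply: walk_single wq3 _; move: up2; rewrite Eq Eq' cat_uniq => /and3P[_ _]; rewrite cat_uniq => /andP[].
have w3 : walk e s (s :: y :: rev q1) p.
  by apply: walk_cons esy (walk_cons _ (walk_rev sym wq1)); rewrite sym.
have pp3 : perm_eq ((s :: y :: rev q1) ++ q4) (enum R).
  by apply: (perm_trans _ pp); rewrite E1 Eq Eq' Eq3; perm_count.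
have pp4 : perm_eq (rev q4 ++ (s :: y :: rev q1)) (enum R).
  by apply: (perm_trans _ pp3); perm_count.
have wq4r := walk_rev sym wq4.
have z'q := walk_head wq4.
have z'R : z' \in R by rewrite -(two_R _ pp3) z'q orbT.
have npz : ~~ e p z' := ends_nonadj w3 wq4 pp3.
have nsz : ~~ e s z'.
  rewrite sym; exact: ends_nonadj wq4r w3 pp4.
have pz : p != z' := two_neq pp3 (walk_last sym w3) z'q.
have sz : s != z' := two_neq pp3 (walk_head w3) z'q.
have [/existsP[c /fan_head[cA epc]]|/existsP[c fc]] := orP (fans pR z'R pz npz).
  by rewrite sym noPA in epc.
have [cA ezc] := fan_head fc.
have ecs : e c s.
  by apply: (fan_dom fc sR) => //; rewrite sym.
have Ec : c = a.
  by apply/eqP/negPn/negP=> ca; have := noS _ cA; rewrite ca ecs.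
rewrite {}Ec in ezc.
apply: (join2 wq4r w3 pp4 bA aA aA _ _ eas) => //; by rewrite sym.
Qed.

Lemma two_paths s (p1 : seq T) t p (p2 : seq T) r : walk e s p1 t -> walk e p p2 r ->
  perm_eq (p1 ++ p2) (enum R) -> hooked.
Proof.
suff triv s1 q1 t1 p3 : walk e s1 q1 t1 -> perm_eq (q1 ++ [:: p3]) (enum R) -> hooked.
  move=> w1 w2 pp; have pp' : perm_eq (p2 ++ p1) (enum R) by rewrite perm_catC.
  have u2 : uniq (p2 ++ p1) by rewrite (perm_uniq pp') enum_uniq.
  have [E|st] := eqVneq s t.
    rewrite -E in w1; have E1 : p1 = [:: s].
      by apply: walk_single w1 _; move: u2; rewrite cat_uniq => /and3P[].
    by apply: (triv _ _ _ s w2); rewrite -E1.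
  have [E|pr] := eqVneq p r.
    rewrite -E in w2; have E2 : p2 = [:: p].
      by apply: walk_single w2 _; move: u2; rewrite cat_uniq => /and3P[].
    by apply: (triv _ _ _ p w1); rewrite -E2.
  have sp1 := walk_head w1; have pp2 := walk_head w2.
  have sR : s \in R by rewrite -(two_R _ pp) sp1.
  have pR : p \in R by rewrite -(two_R _ pp) pp2 orbT.
  have nsp : ~~ e s p.
    by apply: (ends_nonadj (walk_rev sym w1) w2); rewrite (perm_trans _ pp) // perm_cat2r perm_rev.
  have /orP[/existsP[a fa]|/existsP[a fa]] := fans sR pR (two_neq pp sp1 pp2) nsp.
    exact: two_fan_nontrivial w1 w2 pp pr fa.
  exact: two_fan_nontrivial w2 w1 pp' st fa.
move=> w1 pp {s p1 t p p2 r}; move: s1 q1 t1 p3 w1 pp => s p1 t p w1 pp.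
have pp' : perm_eq ([:: p] ++ p1) (enum R) by rewrite (perm_catC [:: p]).
have wp : walk e p [:: p] p := walk1 e p.
have pR : p \in R by rewrite -(two_R _ pp) mem_head orbT.
have p1R x : x \in p1 -> x \in R by move=> xp; rewrite -(two_R _ pp) xp.
have p1p x : x \in p1 -> x != p by move=> xp; apply: (two_neq pp) => //; apply: mem_head.
have [a0 a0A] := set0Pn _ A0.
have reh x q y : walk e x q y -> perm_eq q p1 ->
    ~~ e x p /\ (x != y -> hooked \/ exists a, fan x a p).
  move=> wq pq; have ppq : perm_eq (q ++ [:: p]) (enum R).
    by rewrite (perm_trans _ pp) // perm_cat2r.
  have nxp : ~~ e x p.
    apply: (ends_nonadj (walk_rev sym wq) wp).
    by rewrite (perm_trans _ ppq) // perm_cat2r perm_rev.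
  split=> // xy; have xp1 : x \in p1 by rewrite -(perm_mem pq) (walk_head wq).
  have /orP[/existsP[a fa]|/existsP[a fa]] := fans (p1R _ xp1) pR (p1p _ xp1) nxp.
    by right; exists a.
  left; apply: (two_fan_nontrivial wp wq _ xy fa).
  by rewrite perm_catC.
have exitp (a : T) : a \in A -> exists y, [/\ y != a, y != p, y \in A :|: R & e p y].
  move=> aA; have [||x [y []]] := exits aA (_ : [set p] \subset R).
  - by rewrite sub1set.
  - by rewrite -card_gt0 cards1.
  by rewrite in_set1 in_setD1 => /eqP -> /andP[yp yAR] ya epy; exists y.
have ps := walk_head w1; have pt := walk_last sym w1.
have [E|st] := eqVneq s t.
  have E1 : p1 = [:: s].
    rewrite -E in w1; apply: walk_single w1 _.
    by move: (enum_uniq (mem R)); rewrite -(perm_uniq pp) cat_uniq => /andP[].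
  have nsp := (reh _ _ _ w1 (perm_refl _)).1.
  have Rsp x : x \in R -> x = s \/ x = p.
    by rewrite -(two_R _ pp) E1 !inE => /orP[]/eqP ->; [left|right].
  have done_ u v : u \in R -> v \in R -> (forall x, x \in R -> x = u \/ x = v) ->
      ~~ e u v -> fanned u v -> False.
    move=> uR vR Ruv nuv /existsP[a fa]; have [aA eua] := fan_head fa.
    have [||x [y []]] := exits aA (_ : [set v] \subset R).
    - by rewrite sub1set.
    - by rewrite -card_gt0 cards1.
    rewrite in_set1 in_setD1 => /eqP -> /andP[yv yAR] ya evy.
    have yA : y \in A.
      move: yAR; rewrite inE => /orP[//|/Ruv[] E']; last by rewrite E' eqxx in yv.
      by rewrite E' sym (negbTE nuv) in evy.
    have [|z zR /andP[naz nyz]] := miss aA yA; first by rewrite eq_sym.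
    case: (Ruv _ zR) => E'; rewrite {z}E' in zR naz nyz.
      by rewrite sym eua in naz.
    by rewrite sym evy in nyz.
  have sR := p1R _ ps.
  have sp : s != p := p1p _ ps.
  case/orP: (fans sR pR sp nsp) => [/(done_ _ _ sR pR Rsp nsp)//|].
  move/(done_ _ _ pR sR _ _); case=> //; last by rewrite sym.
  by move=> x /Rsp[]; [right|left].
have ts : t != s by rewrite eq_sym.
have [nsp /(_ st)[//|[a fa]]] := reh _ _ _ w1 (perm_refl _).
have [|ntp /(_ ts)[//|[b fb]]] := reh _ _ _ (walk_rev sym w1); first by rewrite perm_rev.
have [aA esa] := fan_head fa; have [bA etb] := fan_head fb.
have sR := p1R _ ps; have tR := p1R _ pt.
have fan_st c u v : fan u c v -> u \in R -> u != p -> ~~ e u p -> v != p -> e c p.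
  by move=> fc uR up nup vp; apply: (fan_dom fc pR); rewrite 1?eq_sym.
(* a cyclic order on p1 lets p be attached to it *)
have cyc x : e s t -> x \in p1 -> e p x -> hooked.
  move=> est xp epx; have [E|xs] := eqVneq x s.
    by rewrite E sym (negbTE nsp) in epx.
  have [q1 [q2 [x' [Eq wq1 wq2 exx]]]] := walk_split_before sym w1 xp xs.
  have ets : e t s by rewrite sym.
  case/negP: (noham (walk_cons epx (walk_cat wq2 wq1 ets))).
  by apply: (perm_trans _ pp); rewrite Eq; perm_count.
have nst_fan : ~~ e s t -> exists u c v, [/\ fan u c v, u \in [:: s; t], v \in [:: s; t] & u != v].
  move=> nst; case/orP: (fans sR tR st nst) => /existsP[c fc]; [exists s, c, t|exists t, c, s];
  by rewrite !inE !eqxx ?orbT.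
have in_st u : u \in [:: s; t] -> [/\ u \in R, u != p & ~~ e u p].
  by rewrite !inE => /orP[] /eqP ->; split=> //; apply: p1p.
have [/exists_inP[a2 a2A ea2p]|/exists_inPn noA] := boolP [exists a2 in A, e a2 p]; last first.
  have [y [ya yp yAR epy]] := exitp a0 a0A.
  have yp1 : y \in p1.
    move: yAR; rewrite inE => /orP[yA|yR]; first by have := noA _ yA; rewrite sym epy.
    by move: yR; rewrite -(two_R _ pp) inE (negbTE yp) orbF.
  have [est|nst] := boolP (e s t); first exact: cyc est yp1 epy.
  have [u [c [v [fc /in_st[uR up nup] /in_st[_ vp _] uv]]]] := nst_fan nst.
  have [cA _] := fan_head fc.
  by have := noA _ cA; rewrite (fan_st _ _ _ fc).
have notp c : e c p = false -> c != a2 by move=> ncp; apply: contraTneq ea2p => <-; rewrite ncp.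
have aa2 := notp _ (fan_miss fa); have ba2 := notp _ (fan_miss fb).
have w1r := walk_rev sym w1.
have ppr : perm_eq (rev p1 ++ [:: p]) (enum R) by rewrite (perm_trans _ pp) // perm_cat2r perm_rev.
have eas : e a s by rewrite sym. have ebt : e b t by rewrite sym.
have [E|ab] := eqVneq b a; last exact: (join2 w1r wp ppr bA aA a2A ebt eas ea2p ab ba2).
rewrite {}E {ba2 bA} in fb etb ebt.
have only (u v : T) q : walk e u q v -> perm_eq (q ++ [:: p]) (enum R) -> e a u ->
    forall c, c \in A -> e c v -> c = a \/ hooked.
  move=> wq ppq eau c cA ecv; have [->|ca] := eqVneq c a; first by left.
  by right; apply: (join2 wq wp ppq aA cA a2A eau ecv ea2p _ aa2); rewrite eq_sym.
have [est|nst] := boolP (e s t); last first.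
  have [u [c [v [fc ust vst uv]]]] := nst_fan nst; have [cA euc] := fan_head fc.
  have eac u' : u' \in [:: s; t] -> e a u' by rewrite !inE => /orP[] /eqP ->.
  have : c = a \/ hooked.
    have ecu : e c u by rewrite sym.
    move: ust; rewrite !inE => /orP[] /eqP E; rewrite E in ecu.
      exact: only w1r ppr ebt c cA ecu.
    exact: only w1 pp eas c cA ecu.
  by case=> // E; have := fan_miss fc; rewrite E (eac _ vst).
have [||x [y []]] := exits aA (_ : [set x in p1] \subset R).
- by apply/subsetP=> x; rewrite inE; apply: p1R.
- by apply/set0Pn; exists s; rewrite inE.
rewrite inE => xp; rewrite in_setD inE => /andP[yp1 yAR] ya exy.
have yA : y \in A.
  move: yAR; rewrite inE => /orP[//|]; rewrite -(two_R _ pp) inE (negbTE yp1) /= => /eqP E.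
  exfalso; rewrite E in exy; have [|xs] := eqVneq x s.
    by move=> E'; rewrite -E' exy in nsp.
  have [q1 [q2 [x' [Eq wq1 wq2 exx]]]] := walk_split_before sym w1 xp xs.
  have ets : e t s by rewrite sym.
  have epx : e p x by rewrite sym.
  case/negP: (noham (walk_cons epx (walk_cat wq2 wq1 ets))).
  by apply: (perm_trans _ pp); rewrite Eq; perm_count.
pose Y := [set v | [exists c in A, (c != a) && e c v]].
have xY : x \in Y by rewrite inE; apply/exists_inP; exists y; rewrite // ya sym.
have inY v : v \in Y -> exists c, [/\ c \in A, c != a & e c v].
  by rewrite inE => /exists_inP[c cA /andP[ca ecv]]; exists c.
have [sY|sY] := boolP (s \in Y).
  have [c [cA ca ecs]] := inY _ sY.
  by case: (only _ _ _ w1r ppr ebt c cA ecs) => // E; rewrite E eqxx in ca.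
have [q1 [q2 [z' [z [Eq wq1 wq2 ezz [z'Y noY]]]]]] := walk_split_first sym w1 sY xp xY.
have wq : walk e z (rev q1 ++ rev q2) z' := walk_cat (walk_rev sym wq1) (walk_rev sym wq2) est.
have pq : perm_eq (rev q1 ++ rev q2) p1 by rewrite Eq; perm_count.
have zz : z != z' by apply: contraTneq ezz => ->; rewrite irr.
have [_ /(_ zz)[//|[c fc]]] := reh _ _ _ wq pq.
have [cA ezc] := fan_head fc.
have Ec : c = a.
  apply/eqP/negPn/negP=> ca; have := noY _ (walk_last sym wq1).
  by rewrite inE => /negP; apply; apply/exists_inP; exists c; rewrite // ca sym.
have [d [dA da edz]] := inY _ z'Y.
have eaz : e a z by rewrite sym -Ec.
have ppq : perm_eq ((rev q1 ++ rev q2) ++ [:: p]) (enum R) by rewrite (perm_trans _ pp) // perm_cat2r.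
by case: (only _ _ _ wq ppq eaz d dA edz) => // E; rewrite E eqxx in da.
Qed.

End TwoPaths.

Section ManyPaths.

Variable x0 : T.

Let hd q := head x0 q.
Let lst q := last x0 q.
Definition pth q := (q != [::]) && sorted e q.
Definition cover (L : seq (seq T)) := all pth L && perm_eq (flatten L) (enum R).
Definition mincover L := cover L /\ forall L', cover L' -> size L <= size L'.
Definition is_end x q := (x == hd q) || (x == lst q).

Lemma pth_walk q : pth q -> walk e (hd q) q (lst q).
Proof. by case: q => //= x q; rewrite /pth /= !eqxx => ->. Qed.

Lemma walk_pth x q y : walk e x q y -> pth q.
Proof. by case: q => //= z q /and3P[_]. Qed.

Lemma walk_hd x q y : walk e x q y -> hd q = x.
Proof. by case: q => //= z q /and3P[/eqP]. Qed.

Lemma walk_lst x q y : walk e x q y -> lst q = y.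
Proof. by case: q => //= z q /and3P[_ _ /eqP]. Qed.

Lemma orient q x : pth q -> is_end x q ->
  exists q' y, [/\ walk e y q' x, perm_eq q' q & is_end y q].
Proof.
move=> /pth_walk wq /orP[]/eqP ->.
  by exists (rev q), (lst q); rewrite walk_rev // perm_rev /is_end eqxx orbT.
by exists q, (hd q); rewrite wq perm_refl /is_end eqxx.
Qed.

Lemma is_end_in q x : pth q -> is_end x q -> x \in q.
Proof. by move=> /pth_walk wq /orP[]/eqP ->; [apply: walk_head wq|apply: walk_last wq]. Qed.

Lemma hd_end q : is_end (hd q) q. Proof. by rewrite /is_end eqxx. Qed.
Lemma lst_end q : is_end (lst q) q. Proof. by rewrite /is_end eqxx orbT. Qed.

Lemma mincover_perm L L' : perm_eq L L' -> mincover L -> mincover L'.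
Proof.
move=> pL [/andP[aL pf] min]; split; last by rewrite -(perm_size pL).
by rewrite /cover -(perm_all _ pL) aL (perm_trans _ pf) // perm_sym; apply: perm_flatten.
Qed.

Lemma cover_uniq L : cover L -> uniq L.
Proof.
case/andP=> aL /perm_uniq; rewrite enum_uniq.
elim: L aL => //= q L IH /andP[/pth_walk wq aL]; rewrite cat_uniq => /and3P[_ /hasPn nq uL].
rewrite /= IH // andbT; apply/negP=> qL; have := nq (hd q).
rewrite /= (walk_head wq) => H; have : hd q \in flatten L.
  by apply/flattenP; exists q; last exact: walk_head wq.
by move/H.
Qed.

Lemma cover_pth L P : cover L -> P \in L -> pth P.
Proof. by case/andP=> /allP H _ /H. Qed.

Lemma cover_R L P x : cover L -> P \in L -> x \in P -> x \in R.
Proof.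
case/andP=> _ pf PL xP; rewrite -mem_enum -(perm_mem pf).
by apply/flattenP; exists P.
Qed.

Lemma cover_pair (L : seq (seq T)) (P Q : seq T) : P \in L -> Q \in L -> P != Q ->
  perm_eq L (P :: Q :: rem Q (rem P L)).
Proof.
move=> PL QL PQ; rewrite (perm_trans (perm_to_rem PL)) // perm_cons perm_to_rem //.
by apply: contraR PQ => QP; rewrite (_ : P = Q) //; move: QL; rewrite (perm_mem (perm_to_rem PL)) inE (negbTE QP) orbF => /eqP.
Qed.

Lemma cover_disjoint L P Q x : cover L -> P \in L -> Q \in L -> P != Q ->
  x \in P -> x \notin Q.
Proof.
case/andP=> _ pf PL QL PQ xP; have /perm_flatten pp := cover_pair PL QL PQ.
have : uniq (flatten L) by rewrite (perm_uniq pf) enum_uniq.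
rewrite (perm_uniq pp) /= cat_uniq => /and3P[_ /hasPn H _]; apply/negP=> xQ.
by have := H x; rewrite mem_cat xQ /= xP => /(_ isT).
Qed.

Lemma ends_far L P Q x y : mincover L -> P \in L -> Q \in L -> P != Q ->
  is_end x P -> is_end y Q -> [/\ x \in R, y \in R, x != y & ~~ e x y].
Proof.
move=> [cL min] PL QL PQ xP yQ; have pP := cover_pth cL PL; have pQ := cover_pth cL QL.
have xp := is_end_in pP xP; have yq := is_end_in pQ yQ.
split; first exact: cover_R cL PL xp.
- exact: cover_R cL QL yq.
- by apply: contraTneq yq => <-; apply: cover_disjoint cL PL QL PQ xp.
apply/negP=> exy.
have [P' [x' [wP pp _]]] := orient pP xP; have [Q' [y' [wQ pq _]]] := orient pQ yQ.
have pL := cover_pair PL QL PQ; set L0 := rem Q (rem P L) in pL.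
have : cover ((P' ++ rev Q') :: L0).
  apply/andP; split=> /=.
    rewrite (walk_pth (walk_cat wP (walk_rev sym wQ) exy)) /=.
    by case/andP: cL; rewrite (perm_all _ pL) /= => /and3P[].
  case/andP: cL => _; apply: perm_trans; rewrite perm_sym.
  rewrite (perm_trans (perm_flatten pL)) //= -catA.
  by rewrite perm_sym (perm_cat pp) // perm_cat2r perm_rev.
by move/min; rewrite (perm_size pL) /= ltnn.
Qed.

Let wit s t := odflt x0 [pick a | fan s a t].

Lemma witP s t : fanned s t -> fan s (wit s t) t.
Proof. by case/existsP=> a fa; rewrite /wit; case: pickP => //= /(_ a); rewrite fa. Qed.

Let to P Q := fanned (hd P) (hd Q).

Lemma fan_ends L P S s a t x : mincover L -> P \in L -> S \in L -> S != P ->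
  is_end s P -> is_end x S -> fan s a t -> x != t -> e a x.
Proof.
move=> mL PL SL SP sP xS fa xt; have [xR sR xs nxs] := ends_far mL SL PL SP xS sP.
by apply: (fan_dom fa xR xt xs); rewrite sym.
Qed.

Fixpoint wits P M := if M is Q :: M' then wit (hd P) (hd Q) :: wits Q M' else [::].

Fixpoint assemble W P M :=
  if M is Q :: M' then assemble (rev P ++ wit (hd P) (hd Q) :: W) Q M' else W.

Section Chain.

Variable L : seq (seq T).
Hypothesis mL : mincover L.

Lemma witsP P M a : path to P M -> a \in wits P M ->
  exists P' Q', [/\ P' \in P :: M, Q' \in M & fan (hd P') a (hd Q')].
Proof.
elim: M P => //= Q M IH P /andP[PQ pM]; rewrite inE => /orP[/eqP ->|/(IH _ pM)].
  by exists P, Q; rewrite !inE !eqxx; split=> //; apply: witP.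
by case=> P' [Q' [P'M Q'M fa]]; exists P', Q'; split; rewrite // in_cons ?P'M ?Q'M orbT.
Qed.

Lemma wits_head P M a : path to P M -> uniq (P :: M) -> {subset P :: M <= L} ->
  a \in wits P M -> e a (hd P).
Proof.
move=> pM /andP[nP _] sL /(witsP pM)[P' [Q' [P'M Q'M fa]]].
have PL : P \in L by apply: sL; rewrite mem_head.
have [E|PP'] := eqVneq P P'; first by rewrite sym E; case: (fan_head fa).
have PQ' : P != Q' by apply: contraNneq nP => ->.
have Q'L : Q' \in L by apply: sL; rewrite inE Q'M orbT.
have [_ _ hh _] := ends_far mL PL Q'L PQ' (hd_end P) (hd_end Q').
exact: (fan_ends mL (sL _ P'M) PL PP' (hd_end _) (hd_end _) fa).
Qed.

Lemma wits_uniq P M : path to P M -> uniq (P :: M) -> {subset P :: M <= L} ->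
  uniq (wits P M).
Proof.
elim: M P => //= Q M IH P /andP[PQ pM] /andP[nP uM] sL.
have sL' : {subset Q :: M <= L} by move=> z zM; apply: sL; rewrite inE zM orbT.
rewrite IH // andbT; apply/negP=> aM.
by have := wits_head pM uM sL' aM; rewrite (fan_miss (witP PQ)).
Qed.

Lemma assemble_walk P M W x y : path to P M -> uniq (P :: M) -> {subset P :: M <= L} ->
  walk e x W y -> (if M is Q :: _ then e (wit (hd P) (hd Q)) x else true) ->
  exists z, walk e z (assemble W P M) y.
Proof.
elim: M P W x => [|Q M IH] P W x /=; first by exists x.
move=> /andP[PQ pM] /andP[nP uM] sL wW ewx.
have PL : P \in L by apply: sL; rewrite mem_head.
have QL : Q \in L by apply: sL; rewrite !inE eqxx orbT.
have sL' : {subset Q :: M <= L} by move=> z zM; apply: sL; rewrite inE zM orbT.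
have QP : P != Q by move: nP; rewrite inE negb_or => /andP[].
have wP : walk e (lst P) (rev P ++ wit (hd P) (hd Q) :: W) y.
  apply: (walk_cat (walk_rev sym (pth_walk (cover_pth mL.1 PL))) (walk_cons ewx wW)).
  by case: (fan_head (witP PQ)).
apply: IH wP _ => //; case: M pM uM nP sL' {sL} => // Q2 M /= /andP[QQ2 _] _ nP sL'.
have Q2L : Q2 \in L by apply: sL'; rewrite !inE eqxx orbT.
have PQ2 : P != Q2 by move: nP; rewrite !inE !negb_or => /and3P[].
have [_ _ ll _] := ends_far mL PL Q2L PQ2 (lst_end P) (hd_end Q2).
exact: (fan_ends mL QL PL QP (hd_end _) (lst_end _) (witP QQ2)).
Qed.

Lemma assemble_perm W P M :
  perm_eq (assemble W P M) (W ++ wits P M ++ flatten (belast P M)).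
Proof.
elim: M W P => [|Q M IH] W P /=; first by rewrite cats0.
by apply: (perm_trans (IH _ _)); perm_count.
Qed.

(* The paths of a chain are joined backwards, from the last but one to the
   first, and then to the last one. *)
Lemma chain_hook P M a x : path to P M -> uniq (P :: M) -> perm_eq (P :: M) L ->
  1 < size M -> a \in A -> a \notin wits P M -> is_end x (last P M) -> e a x -> hooked.
Proof.
move=> pM uM pL sM aA aw xq eax.
have sL : {subset P :: M <= L} by move=> z; rewrite (perm_mem pL).
have lastM : last P M \in M by case: (M) sM => //= *; apply: mem_last.
have lL : last P M \in L by apply: sL; rewrite inE lastM orbT.
have [W [y [wW pW yq]]] := orient (cover_pth mL.1 lL) xq.
have [z wz] : exists z, walk e z (assemble W P M) x.
  apply: (assemble_walk pM uM sL wW).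
  case: M pM uM lastM lL sL yq sM {pL aw pW xq wW} => // Q M /= /andP[PQ _].
  move=> /andP[nP /andP[nQ _]] lM lL sL yq sM.
  have PL : P \in L by apply: sL; rewrite mem_head.
  have QL : Q \in L by apply: sL; rewrite !inE eqxx orbT.
  have lQ : last Q M != Q.
    by apply: contraNneq nQ => E; rewrite -{1}E; case: (M) sM => //= *; apply: mem_last.
  have lP : last Q M != P by apply: contraNneq nP => <-.
  have [_ _ yQ _] := ends_far mL lL QL lQ yq (hd_end Q).
  exact: (fan_ends mL PL lL lP (hd_end _) yq (witP PQ)).
apply: (hook (q := wits P M) aA (walk_rev sym wz) eax).
- rewrite perm_rev (perm_trans (assemble_perm _ _ _)) //.
  case/andP: mL.1 => _ pf; rewrite perm_catCA perm_cat2l; apply: perm_trans pf.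
  rewrite (perm_trans _ (perm_flatten pL)) // lastI flatten_rcons perm_catC.
  by rewrite perm_cat2l.
- by rewrite cons_uniq aw wits_uniq.
- by move=> b /(witsP pM)[P' [Q' [_ _ /fan_head[]]]].
Qed.

Lemma chain_nontrivial P M Q : path to P M -> uniq (P :: M) -> perm_eq (P :: M) L ->
  1 < size M -> Q \in M -> hd Q != lst Q -> hooked.
Proof.
move=> pM uM pL sM QM hl.
have sL : {subset P :: M <= L} by move=> z; rewrite (perm_mem pL).
have lastM : last P M \in M by case: (M) sM => //= *; apply: mem_last.
have PL : P \in L by apply: sL; rewrite mem_head.
have ML Z : Z \in M -> Z \in L by move=> ZM; apply: sL; rewrite inE ZM orbT.
have MP Z : Z \in M -> Z != P by move=> ZM; apply: contraTneq ZM => ->; case/andP: uM.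
have [vR uR vu nvu] := ends_far mL (ML _ QM) PL (MP _ QM) (lst_end Q) (hd_end P).
have hdM Z : Z \in M -> [/\ hd Z \in R, hd Z != lst Q, hd Z != hd P & ~~ e (hd P) (hd Z)].
  move=> ZM; have [h1 h2 h3 h4] := ends_far mL (ML _ ZM) PL (MP _ ZM) (hd_end Z) (hd_end P).
  split=> //; last by rewrite sym.
  have [->//|ZQ] := eqVneq Z Q.
  by have [] := ends_far mL (ML _ ZM) (ML _ QM) ZQ (hd_end Z) (lst_end Q).
case/orP: (fans vR uR vu nvu) => /existsP[b fb]; have [bA evb] := fan_head fb.
  have bw : b \notin wits P M.
    by apply/negP=> /(wits_head pM uM sL); rewrite (fan_miss fb).
  have [E|lQ] := eqVneq (last P M) Q.
    apply: (chain_hook (x := lst Q) pM uM pL sM bA bw); first by rewrite E lst_end.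
    by rewrite sym.
  apply: (chain_hook (x := hd (last P M)) pM uM pL sM bA bw); first exact: hd_end.
  have [_ _ hu _] := hdM _ lastM.
  exact: (fan_ends mL (ML _ QM) (ML _ lastM) lQ (lst_end _) (hd_end _) fb).
have adj Z : Z \in M -> e b (hd Z).
  by case/hdM=> h1 h2 h3 h4; apply: (fan_dom fb).
apply: (chain_hook (x := hd (last P M)) pM uM pL sM bA); [|exact: hd_end|exact: adj].
apply/negP=> /(witsP pM)[P' [Q' [P'M Q'M fb']]].
by have := adj _ Q'M; rewrite (fan_miss fb').
Qed.

End Chain.

Lemma chain_exists L : mincover L ->
  {in L &, forall P Q, P != Q -> to P Q || to Q P}.
Proof.
move=> mL P Q PL QL PQ; have [hP hQ PQ' nPQ] := ends_far mL PL QL PQ (hd_end P) (hd_end Q).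
exact: fans.
Qed.

Lemma many_paths L : mincover L -> 2 < size L -> hooked.
Proof.
move=> mL sL; have uL := cover_uniq mL.1.
have [[|P [|P2 [|P3 M]]] pL sP] := sort_total uL (chain_exists mL);
  try by move: sL; rewrite -(perm_size pL).
have uP : uniq [:: P, P2, P3 & M] by rewrite (perm_uniq pL).
have mP : mincover [:: P, P2, P3 & M] by apply: mincover_perm mL; rewrite perm_sym.
set L' := [:: P, P2, P3 & M] in uP mP.
have [/hasP[Q QM hl]|/hasPn triv] := boolP (has (fun Q => hd Q != lst Q) [:: P2, P3 & M]).
  exact: (chain_nontrivial mP sP uP (perm_refl _) isT QM hl).
have {}triv Q : Q \in [:: P2, P3 & M] -> Q = [:: hd Q].
  move=> QM; have QL : Q \in L' by rewrite inE QM orbT.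
  have /eqP hl := negbNE (triv _ QM); have := pth_walk (cover_pth mP.1 QL).
  rewrite -hl => /walk_single; apply.
  have : uniq (flatten L') by case/andP: mP.1 => _ /perm_uniq ->; rewrite enum_uniq.
  by rewrite (perm_uniq (perm_flatten (perm_to_rem QL))) /= cat_uniq => /andP[].
have PL : P \in L' by rewrite mem_head.
have P2L : P2 \in L' by rewrite !inE eqxx orbT.
have P3L : P3 \in L' by rewrite !inE eqxx !orbT.
have [P12 P13 P23] : [/\ P != P2, P != P3 & P2 != P3].
  by move: uP; rewrite /L' /= !inE !negb_or => /and4P[/and3P[-> -> _] /andP[-> _]].
case/and3P: (sP) => t12 t23 _.
set a1 := wit (hd P) (hd P2); set a2 := wit (hd P2) (hd P3).
have f1 : fan (hd P) a1 (hd P2) := witP t12.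
have f2 : fan (hd P2) a2 (hd P3) := witP t23.
have [[a1A e1] [a2A e2]] := (fan_head f1, fan_head f2).
have a12 : a1 != a2 by apply: contraTneq e2 => <-; rewrite sym (fan_miss f1).
have [r rR /andP[n1 n2]] := miss a1A a2A a12.
have [h2R _ h23 _] := ends_far mP P2L P3L P23 (hd_end _) (hd_end _).
have [hR _ h12 n12] := ends_far mP PL P2L P12 (hd_end _) (hd_end _).
have [_ h3R h13 n13] := ends_far mP PL P3L P13 (hd_end _) (hd_end _).
have [lR _ l12 nl12] := ends_far mP PL P2L P12 (lst_end _) (hd_end _).
have [_ _ l13 _] := ends_far mP PL P3L P13 (lst_end _) (hd_end _).
have rh2 : r != hd P2 by apply: contraNneq n2 => ->; rewrite sym.
have rh3 : r != hd P3.
  apply: contraNneq n1 => ->; apply: (fan_ends mP PL P3L _ (hd_end _) (hd_end _) f1); rewrite eq_sym //.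
have rhd : r != hd P by apply: contraNneq n1 => ->; rewrite sym.
have e1r : e (hd P) r := fan_dom' f1 rR rh2 rhd n1.
have e2r : e (hd P2) r := fan_dom' f2 rR rh3 rh2 n2.
have rl : r != lst P.
  apply: contraNneq n2 => ->; exact: (fan_ends mP P2L PL P12 (hd_end _) (lst_end _) f2).
have rP : r \in P.
  have : r \in flatten L' by case/andP: mP.1 => _ pf; rewrite (perm_mem pf) mem_enum.
  case/flattenP=> Q; rewrite inE => /orP[/eqP ->//|QM].
  rewrite (triv _ QM) inE => /eqP E.
  have QL : Q \in L' by rewrite inE QM orbT.
  have QP : Q != P by apply: contraTneq QM => ->; case/andP: uP.
  case/negP: n1; rewrite E; apply: (fan_ends mP PL QL QP (hd_end _) (hd_end _) f1).
  by rewrite -E.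
have nl2 : ~~ e (hd P2) (lst P) by rewrite sym.
have h2l : hd P2 != lst P by rewrite eq_sym.
case/orP: (fans h2R lR h2l nl2) => [/existsP[b fb]|tol].
  have [bA e2b] := fan_head fb.
  have adj Q : Q \in [:: P2, P3 & M] -> e b (hd Q).
    move=> QM; have QL : Q \in L' by rewrite inE QM orbT.
    have PQ : Q != P by apply: contraTneq QM => ->; case/andP: uP.
    have [->|Q2] := eqVneq Q P2; first by rewrite sym.
    have [_ _ hl _] := ends_far mP QL PL PQ (hd_end _) (lst_end _).
    exact: (fan_ends mP P2L QL Q2 (hd_end _) (hd_end _) fb).
  apply: (chain_hook (a := b) (x := hd (last P [:: P2, P3 & M])) mP sP uP (perm_refl _) isT bA).
  - apply/negP=> /(witsP sP)[P' [Q' [_ Q'M fb']]].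
    by have := adj _ Q'M; rewrite (fan_miss fb').
  - exact: hd_end.
  - by apply: adj; rewrite /= in_cons mem_last orbT.
(* r lies inside P; prepending P2 to the part of P before r gives another cover, with
   a nontrivial path that can be kept away from the first place of the chain *)
have wP := pth_walk (cover_pth mP.1 PL).
have [s1 [s2 [z [EP w1 w2 ezr]]]] := walk_split_before sym wP rP rhd.
have [s3 [s4 [z' [Es w3 w4 erz]]]] := walk_split w2 (walk_head w2) rl.
have u2 : uniq s2.
  have : uniq (flatten L') by case/andP: mP.1 => _ /perm_uniq ->; rewrite enum_uniq.
  by rewrite /= cat_uniq => /andP[]; rewrite EP cat_uniq => /and3P[].
have E3 : s3 = [:: r] by apply: walk_single w3 _; move: u2; rewrite Es cat_uniq => /andP[].
have wN : walk e (hd P2) (hd P2 :: r :: s1) z.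
  by apply: walk_cons e2r (walk_cons _ w1); rewrite sym.
have w4r := walk_rev sym w4.
pose N1 := hd P2 :: r :: s1; pose N2 := rev s4.
pose L2 := [:: N1, N2, P3 & M].
have hN1 : hd N1 = hd P2 by [].
have hN2 : hd N2 = lst P := walk_hd w4r.
have EP2 : P2 = [:: hd P2] by apply: triv; rewrite mem_head.
have mL2 : mincover L2.
  split; last by case: mP.
  have [/andP[/and3P[_ _ aM] pf] _] := mP; apply/andP; split.
    by rewrite /= (walk_pth wN) (walk_pth w4r).
  by apply: perm_trans pf; rewrite /L2 /L' /= EP2 EP Es E3 /N1 /N2; perm_count.
have N12 : N2 != N1 by apply: contraNneq l12 => E; rewrite -hN1 -E hN2.
have [||||m [M' [pM' sM' N1M]]] := sort_total_head (cover_uniq mL2.1) (chain_exists mL2) (v := N1) (w := N2).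
- by rewrite mem_head.
- by rewrite !inE eqxx orbT.
- by [].
- by rewrite /to hN1 hN2.
apply: (chain_nontrivial (L := m :: M') (mincover_perm _ mL2) sM' _ (perm_refl _) _ N1M).
- by rewrite perm_sym.
- by rewrite (perm_uniq pM') (cover_uniq mL2.1).
- by have := perm_size pM'; rewrite /= => -[->].
- rewrite hN1 (walk_lst wN); apply: contraTneq (walk_last sym w1) => <-.
  have hP2 := walk_head (pth_walk (cover_pth mP.1 P2L)).
  have := cover_disjoint mP.1 P2L PL; rewrite eq_sym P12 => /(_ (hd P2) isT hP2).
  by rewrite EP mem_cat => /norP[].
Qed.

End ManyPaths.

Lemma hooked_path : hooked.
Proof.
have [x0 _] := set0Pn _ R0.
have [L mL] : exists L, mincover L.
  have ex0 : cover [seq [:: x] | x <- enum R].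
    apply/andP; split; first by apply/allP=> _ /mapP[x _ ->].
    rewrite (_ : flatten _ = enum R) //; by elim: (enum R) => //= x s ->.
  move: {2}(size _) (leqnn (size [seq [:: x] | x <- enum R])) => n.
  elim: n [seq _ | _ <- _] ex0 => [|n IH] L cL sL.
    by exists L; split=> // L' _; apply: leq_trans sL _.
  have [[L' [cL' lt]]|no] := Classical_Prop.classic (exists L', cover L' /\ size L' < size L).
    by apply: (IH L') => //; rewrite -ltnS (leq_trans lt).
  by exists L; split=> // L' cL'; rewrite leqNgt; apply/negP=> lt; case: no; exists L'.
have [lt|] := ltnP 2 (size L); first exact: (many_paths x0 mL).
case: mL => /andP[aL pf] min.
case: L aL pf min => [|P [|Q [|//]]] aL pf min _.
- by have := perm_mem pf x0; rewrite mem_enum; case/set0Pn: R0 => x xR; have := perm_mem pf x; rewrite mem_enum xR.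
- have {}aL : pth P by case/andP: aL.
  by apply: (one_path (pth_walk x0 aL)); rewrite /= cats0 in pf.
- have [pP pQ] : pth P /\ pth Q by case/and3P: aL.
  rewrite /= cats0 in pf; apply: (two_paths _ (pth_walk x0 pP) (pth_walk x0 pQ) pf) => p u v wp.
  apply/negP=> pp; have : cover [:: p] by rewrite /cover /= (walk_pth wp) cats0.
  by move/min.
Qed.

End Cover.

(** * Sides of a cut-vertex *)

Section Sides.

Variables (T : finType) (e : rel T).
Hypothesis sym : symmetric e.
Implicit Types (A B C D E P S : {set T}) (u v x y z : T).

Lemma connected_in_imset (T' : finType) (f : T -> T') (e' : rel T') S : symmetric e' ->
  connected_in e S -> (forall x y, e x y -> f x = f y \/ e' (f x) (f y)) ->
  connected_in e' (f @: S).
Proof.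
move=> sym' cS fe; have [/set0Pn[x0 x0S] _] := connected_inP _ _ cS.
apply/connected_inP; split; first by apply/set0Pn; exists (f x0); apply: imset_f.
move=> P sP /set0Pn[p pP] Pcl; suff E : [set x in S | f x \in P] = S.
  by apply/subsetP=> _ /imsetP[x xS ->]; move: xS; rewrite -E inE => /andP[].
apply: (connected_in_closed cS); first by apply/subsetP=> x; rewrite inE => /andP[].
  by have /imsetP[x xS E] := subsetP sP _ pP; apply/set0Pn; exists x; rewrite inE xS -E.
move=> x y; rewrite !inE => /andP[xS xP] yS /fe[<-|exy]; rewrite yS //.
by apply: (Pcl (f x)) => //; apply: imset_f.
Qed.

Lemma cds_on_sub (e1 e2 : rel T) B S : {in B &, forall x y, e1 x y -> e2 x y} ->
  cds_on e1 B S -> cds_on e2 B S.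
Proof.
move=> sub [sS /connected_inP[S0 cS] dS]; split=> //.
  apply/connected_inP; split=> // P sP P0 Pcl; apply: cS => // x y xP yS exy.
  by apply: (Pcl x y xP yS); apply: sub exy; apply: (subsetP sS); rewrite ?(subsetP sP x).
move=> x xB xS; have [y yS exy] := dS x xB xS; exists y => //.
by apply: sub exy => //; apply: (subsetP sS).
Qed.

Lemma cds_on_addC u v B S : cds_on (add_edge e u v) B S -> cds_on (add_edge e v u) B S.
Proof. by apply: cds_on_sub => x y _ _; rewrite /add_edge /= [X in _ || X]orbC. Qed.

Lemma cds_on_add_notin u v B S : u \notin S -> v \notin S ->
  cds_on (add_edge e u v) B S -> cds_on e B S.
Proof.
move=> uS vS [sS /connected_inP[S0 cS] dS].
have neq x : x \in S -> x != u /\ x != v.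
  by move=> xS; split; apply: contraTneq xS => ->.
split=> //.
  apply/connected_inP; split=> // P sP P0 Pcl; apply: cS => // x y xP yS.
  by have [xu xv] := neq x (subsetP sP _ xP); rewrite add_edge_neq //; apply: Pcl.
move=> x xB xS; have [y yS exy] := dS x xB xS; exists y => //.
by have [yu yv] := neq y yS; move: exy; rewrite (add_edge_sym _ _ sym) add_edge_neq // sym.
Qed.

Lemma add_edge_neq2 u v x y : x != v -> y != v -> add_edge e u v x y = e x y.
Proof. by move=> /negbTE xv /negbTE yv; rewrite /add_edge /= xv yv andbF orbF. Qed.

Lemma cds_on_add_dominated u v B S y : v \notin S -> cds_on (add_edge e u v) B S ->
  y \in S -> e v y -> cds_on e B S.
Proof.
move=> vS [sS /connected_inP[S0 cS] dS] yS evy.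
have neq x : x \in S -> x != v by move=> xS; apply: contraTneq xS => ->.
split=> //.
  apply/connected_inP; split=> // P sP P0 Pcl; apply: cS => // x z xP zS.
  rewrite add_edge_neq2 ?neq //; [exact: Pcl|exact: (subsetP sP)].
move=> x xB xS; have [->|xv] := eqVneq x v; first by exists y.
by have [z zS exz] := dS x xB xS; exists z => //; move: exz; rewrite add_edge_neq2 // neq.
Qed.

Lemma cds_onU B1 B2 E1 E2 c : c \in E1 -> c \in E2 ->
  cds_on e B1 E1 -> cds_on e B2 E2 -> cds_on e (B1 :|: B2) (E1 :|: E2).
Proof.
move=> c1 c2 [s1 k1 d1] [s2 k2 d2]; split; first exact: setUSS.
  exact: connected_inU c1 c2 k1 k2.
move=> x; rewrite !inE negb_or => /orP[xB|xB] /andP[x1 x2].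
  by have [//|y yE exy] := d1 x xB; exists y; rewrite // inE yE.
by have [//|y yE exy] := d2 x xB; exists y; rewrite // inE yE orbT.
Qed.

Lemma side_mem c C S : side e c C -> cds_on e [set: T] S -> c \in S.
Proof.
move=> [cC /set0Pn[x xC] [w wC wc] out] [_ cS dS].
have [S0|] := eqVneq (S :&: C) set0.
  have notC y : y \in S -> y \notin C.
    by move=> yS; apply/negP=> yC; have /setP/(_ y) := S0; rewrite !inE yS yC.
  have xS : x \notin S by apply/negP=> /notC; rewrite xC.
  have [//|y yS exy] := dS x _ xS.
  by rewrite -(out x y xC (notC _ yS) exy).
have [E|SC] := eqVneq (S :&: C) S.
  have sub y : y \in S -> y \in C by rewrite -{1}E inE => /andP[].
  have wS : w \notin S by apply/negP=> /sub; rewrite (negbTE wC).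
  have [//|y yS ewy] := dS w _ wS.
  by move: wc; rewrite (out y w (sub _ yS) wC) ?eqxx // sym.
move=> SC0; have [y [z [yP]]] := connected_in_edge cS (subsetIl _ _) SC0 SC.
rewrite !inE in yP *; case/andP: yP => yS yC; rewrite negb_and => /andP[zC zS] eyz.
by move: zC; rewrite zS /= => zC; rewrite -(out y z yC zC eyz).
Qed.

Lemma side_nbr c C : connected_graph e -> side e c C -> exists2 a, a \in C & e c a.
Proof.
move=> con [cC C0 [w wC _] out].
have [|x [y [xC yC exy]]] := connected_in_edge con (subsetT C) C0.
  by apply: contraNneq wC => ->.
rewrite !inE andbT in yC.
by exists x; rewrite // sym -(out x y xC yC exy).
Qed.

Lemma side_restrict c C S : side e c C -> cds_on e [set: T] S ->
  cds_on e (c |: C) (S :&: (c |: C)).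
Proof.
move=> sd cds; have cS := side_mem sd cds; case: cds => _ conS dS.
case: sd => cC _ _ out; split; first exact: subsetIr.
  apply: (connected_in_base (x0 := c)) => //; first by rewrite !inE cS eqxx.
  move=> P sP P0 Pcl; have [//|cP] := boolP (c \in P).
  have : P = S; last by move=> E; rewrite E cS in cP.
  apply: (connected_in_closed conS) => //; first exact: subset_trans sP (subsetIl _ _).
  move=> x y xP yS exy; apply: (Pcl x) => //; rewrite !inE yS /=.
  have := subsetP sP _ xP; rewrite !inE => /andP[_ /orP[/eqP xc|xC]].
    by rewrite -xc xP in cP.
  by have [_|yC] := boolP (y \in C); [rewrite orbT|rewrite (out x y xC yC exy) eqxx].
move=> x; rewrite !inE => /orP[/eqP ->|xC]; first by rewrite cS eqxx.
rewrite xC orbT andbT => xS; have [//|y yS exy] := dS x _ xS; exists y => //.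
rewrite !inE yS /=.
by have [_|yC] := boolP (y \in C); [rewrite orbT|rewrite (out x y xC yC exy) eqxx].
Qed.

Lemma side_add c C u v : u \in c |: C -> v \in c |: C -> side e c C ->
  side (add_edge e u v) c C.
Proof.
move=> uC vC [cC C0 wC out]; split=> // x y xC yC.
case/or3P=> [|/andP[_ /eqP E]|/andP[_ /eqP E]]; first exact: out.
  by move: vC; rewrite -E !inE (negbTE yC) orbF => /eqP.
by move: uC; rewrite -E !inE (negbTE yC) orbF => /eqP.
Qed.

Lemma side_add_out c C u v : u \notin C -> v \notin C -> side e c C ->
  side (add_edge e u v) c C.
Proof.
move=> uC vC [cC C0 wC out]; split=> // x y xC yC.
case/or3P=> [|/andP[/eqP E _]|/andP[/eqP E _]]; first exact: out.
  by rewrite -E xC in uC.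
by rewrite -E xC in vC.
Qed.

Lemma setC_side c C : c \notin C -> c |: ~: (c |: C) = ~: C.
Proof.
move=> cC; apply/setP=> x; rewrite !inE negb_or.
by case: eqVneq => // ->; rewrite cC.
Qed.

Lemma card_side c C S : c \notin C -> c \in S ->
  #|S| = (#|S :&: C| + #|S :&: ~: (c |: C)|).+1.
Proof.
move=> cC cS; rewrite -(cardsID C S) -addnS; congr (_ + _).
rewrite (cardsD1 c (S :\: C)) !inE cC cS /= add1n; congr _.+1.
by apply: eq_card => x; rewrite !inE negb_or; case: eqP; rewrite ?andbF //= andbC.
Qed.

End Sides.

Section Critical.

Variables (T : finType) (e : rel T) (k : nat) (D : {set T}).
Hypothesis sym : symmetric e.
Hypothesis irr : irreflexive e.
Hypothesis crit : gamma_c_critical k e.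
Hypothesis cdsD : cds_on e [set: T] D.
Hypothesis cardD : #|D| = k.
Implicit Types (A B C E P S : {set T}) (u v x y z c : T).

Let con : connected_graph e. Proof. by case: crit. Qed.

Lemma side_min c C E : side e c C -> c \in E -> cds_on e (c |: C) E ->
  #|D :&: C| <= #|E :&: C|.
Proof.
move=> sd cE cdsE; have cD := side_mem sym sd cdsD; have [cC _ _ _] := sd.
have cds2 := side_restrict sym (side_compl sym sd) cdsD; rewrite setC_side // in cds2.
have c2 : c \in D :&: ~: C by rewrite !inE cD cC.
have := cds_onU sym cE c2 cdsE cds2; rewrite -setUA setUCr setUT => /(critical_min crit).
rewrite -cardD (card_side cC cD) (@card_side _ c C (E :|: _)) //; last by rewrite inE cE.
have -> : (E :|: D :&: ~: C) :&: C = E :&: C.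
  by apply/setP=> x; rewrite !inE; do !case: (_ \in _).
have -> : (E :|: D :&: ~: C) :&: ~: (c |: C) = D :&: ~: (c |: C).
  apply/setP=> x; have [/subsetP/(_ x) + _ _] := cdsE; rewrite !inE.
  by case: (x \in E) => [->//|_]; rewrite ?andbF //; case: eqP; do !case: (_ \in _).
by rewrite ltnS leq_add2r.
Qed.

Lemma side_add_min c C u v S : side e c C -> u != v -> u \notin C -> v \notin C ->
  cds_on (add_edge e u v) [set: T] S -> #|D :&: C| <= #|S :&: C|.
Proof.
move=> sd uv uC vC cdsS; have sd' := side_add_out uC vC sd.
have sym' := add_edge_sym u v sym.
have cS := side_mem sym' sd' cdsS; have := side_restrict sym' sd' cdsS.
have -> : S :&: C = S :&: (c |: C) :&: C.
  by apply/setP=> x; rewrite !inE; do !case: (_ \in _); case: eqP.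
move=> cds; apply: (side_min sd); first by rewrite !inE cS eqxx.
apply: cds_on_sub cds => x y; rewrite !inE => xB yB.
case/or3P=> // /andP[/eqP xE /eqP yE]; subst x y.
  rewrite (negbTE uC) (negbTE vC) !orbF in xB yB.
  by rewrite (eqP xB) (eqP yB) eqxx in uv.
rewrite (negbTE uC) (negbTE vC) !orbF in xB yB.
by rewrite (eqP xB) (eqP yB) eqxx in uv.
Qed.

Lemma side_fact c C u v : side e c C -> u \in c |: C -> v \in c |: C -> u != v -> ~~ e u v ->
  exists E, [/\ c \in E, cds_on (add_edge e u v) (c |: C) E, #|E :&: C| < #|D :&: C| &
                (u \in E) || (v \in E)].
Proof.
move=> sd uC vC uv nuv; have [S cdsS ltS] := critical_add crit uv nuv.
have sym' := add_edge_sym u v sym; have sd' := side_add uC vC sd.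
have cS := side_mem sym' sd' cdsS; have cD := side_mem sym sd cdsD.
have [cC _ _ _] := sd.
have notC x : x \in c |: C -> x \notin ~: (c |: C) by rewrite in_setC negbK.
have le := side_add_min (side_compl sym sd) uv (notC _ uC) (notC _ vC) cdsS.
have lt : #|S :&: C| < #|D :&: C|.
  move: ltS; rewrite -cardD (card_side cC cS) (card_side cC cD) ltnS.
  by apply: contraTltn => ge; rewrite -leqNgt leq_add.
have cE : c \in S :&: (c |: C) by rewrite !inE cS eqxx.
have EC : S :&: (c |: C) :&: C = S :&: C.
  by apply/setP=> x; rewrite !inE; do !case: (_ \in _); case: eqP.
have cdsE := side_restrict sym' sd' cdsS.
exists (S :&: (c |: C)); split; rewrite ?EC //.
apply/negPn/negP; rewrite negb_or => /andP[uE vE].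
have := side_min sd cE (cds_on_add_notin sym uE vE cdsE).
by rewrite EC leqNgt lt.
Qed.

Lemma side_clique c C : side e c C ->
  {in C &, forall a b, e c a -> e c b -> a != b -> e a b}.
Proof.
move=> sd a b aC bC eca ecb ab; apply/negPn/negP=> nab.
have [||E [cE cdsE lt _]] := side_fact sd _ _ ab nab; rewrite ?inE ?aC ?bC ?orbT //.
suff /(side_min sd cE) : cds_on e (c |: C) E by rewrite leqNgt lt.
have [cC _ _ _] := sd.
have ca : c != a by apply: contraNneq cC => ->.
have cb : c != b by apply: contraNneq cC => ->.
case: cdsE => sE conE dE; split=> //.
  apply: (connected_in_base (x0 := c)) => // P sP P0 Pcl.
  have [|cP] := boolP (c \in P); first by [].
  have : P = E; last by move=> PE; rewrite -PE (negbTE cP) in cE.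
  have aP : a \notin P by apply: contra cP => aP; apply: (Pcl a); rewrite // sym.
  have bP : b \notin P by apply: contra cP => bP; apply: (Pcl b); rewrite // sym.
  apply: (connected_in_closed conE) => // x y xP yE.
  by rewrite add_edge_neq; [apply: Pcl|apply: contraNneq aP => <-|apply: contraNneq bP => <-].
move=> x xB xE; have [y yE exy] := dE x xB xE.
have [xa|xa] := eqVneq x a; first by exists c; rewrite // xa sym.
have [xb|xb] := eqVneq x b; first by exists c; rewrite // xb sym.
by exists y => //; move: exy; rewrite add_edge_neq.
Qed.

Lemma side_connected c C : side e c C -> connected_in e C.
Proof.
move=> sd; have [cC C0 _ out] := sd.
apply/connected_inP; split=> // P sP P0 Pcl; apply/negPn/negP=> CP.
have sdP (Q : {set T}) : Q \subset C -> Q != set0 -> closed_within e C Q -> side e c Q.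
  move=> sQ Q0 Qcl; split=> //; first by apply: contra cC; apply: (subsetP sQ).
    case: sd => _ _ [w wC wc] _; exists w => //.
    by apply: contra wC; apply: (subsetP sQ).
  move=> x y xQ yQ exy; apply: (out x) => //; first exact: (subsetP sQ).
  by apply: contra yQ => yC; apply: (Qcl x).
have [a aP eca] := side_nbr sym con (sdP P sP P0 Pcl).
have [|b] := side_nbr sym con (_ : side e c (C :\: P)).
  apply: sdP; [exact: subsetDl|by rewrite setD_eq0|].
  move=> x y; rewrite !inE => /andP[xP xC] yC exy; rewrite yC andbT.
  by apply: contra xP => yP; apply: (Pcl y) => //; rewrite sym.
rewrite inE => /andP[bP bC] ecb.
have ab : a != b by apply: contraNneq bP => <-.
have := side_clique sd (subsetP sP _ aP) bC eca ecb ab.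
by move/(Pcl a b aP bC); rewrite (negbTE bP).
Qed.

Definition spanned x B := exists s y, walk e x s y /\ perm_eq s (enum B).

Lemma clique_walk x (s : seq T) y q z : {in x :: s &, forall a b, a != b -> e a b} ->
  uniq (x :: s) -> {in x :: s, forall a, e a y} -> walk e y q z -> walk e x (x :: s ++ q) z.
Proof.
elim: s x => [|b s IH] x cl /= u ey wq; first by apply: walk_cons wq; apply: ey; apply: mem_head.
have [xs us] := andP u; apply: (walk_cons _ (IH b _ us _ wq)).
- by apply: cl; rewrite ?inE ?eqxx ?orbT //; apply: contraNneq xs => ->; rewrite mem_head.
- by move=> a a' aS a'S; apply: cl; rewrite inE ?aS ?a'S orbT.
- by move=> a aS; apply: ey; rewrite inE aS orbT.
Qed.

Lemma clique_walk1 x (s : seq T) : {in x :: s &, forall a b, a != b -> e a b} ->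
  uniq (x :: s) -> exists z, walk e x (x :: s) z.
Proof.
elim: s x => [|b s IH] x cl /= u; first by exists x; apply: walk1.
have [xs us] := andP u; have [|z wz] := IH b _ us.
  by move=> a a' aS a'S; apply: cl; rewrite inE ?aS ?a'S orbT.
exists z; apply: (walk_cons _ wz).
by apply: cl; rewrite ?inE ?eqxx ?orbT //; apply: contraNneq xs => ->; rewrite mem_head.
Qed.

Lemma hooked_span c C (A := [set a in C | e c a]) : side e c C ->
  hooked e A (C :\: A) -> spanned c (c |: C).
Proof.
move=> sd [a [q [y [aA wq uq sq Rq]]]]; have [cC _ _ _] := sd.
have sqC x : x \in q -> x \in C by move/sq; rewrite !inE; case: (x \in C) => //; rewrite andbF.
have memt x : x \in enum (A :\: [set z in q]) = [&& x \notin q, x \in C & e c x].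
  by rewrite mem_enum !inE.
have adj x : x \in enum (A :\: [set z in q]) -> [/\ x != a, x \in C & e c x].
  rewrite memt => /and3P[xq -> ->]; split=> //.
  by apply: contraNneq xq => ->; apply: walk_head wq.
have [aC eca] : a \in C /\ e c a by move: aA; rewrite inE => /andP.
have ut : uniq (c :: enum (A :\: [set z in q])).
  by rewrite /= enum_uniq andbT memt irr !andbF.
exists (c :: enum (A :\: [set z in q]) ++ q), y; split.
  apply: (clique_walk _ ut _ wq).
    move=> b b'; rewrite !in_cons => /predU1P[->|/adj[_ bC eb]] /predU1P[->|/adj[_ bC' eb']] nb //.
    - by rewrite eqxx in nb.
    - by rewrite sym.
    - exact: side_clique sd _ _ bC bC' eb eb' nb.
  move=> b; rewrite in_cons => /predU1P[->//|/adj[ba bC eb]].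
  exact: side_clique sd _ _ bC aC eb eca ba.
apply: uniq_perm; last 2 [exact: enum_uniq].
  rewrite -cat_cons cat_uniq ut uq /= andbT; apply/hasPn=> x xq; rewrite in_cons memt xq orbF.
  by apply: contraNneq cC => <-; apply: sqC.
move=> x; rewrite mem_enum in_cons mem_cat memt !inE; case: eqP => //= _.
have [xq|xq] := boolP (x \in q) => /=; first by rewrite (sqC _ xq).
rewrite orbF; have [xC|//] := boolP (x \in C); apply: negbNE; apply: contra xq => nx.
by apply: Rq; rewrite !inE xC nx.
Qed.

Lemma far_clique c C : side e c C -> #|D :&: C| <= 2 ->
  {in C &, forall u v, ~~ e c u -> ~~ e c v -> u != v -> e u v}.
Proof.
move=> sd D2; have [cC _ _ _] := sd.
suff H u v E : u \in C -> ~~ e c u -> v \in C -> ~~ e c v -> u != v -> c \in E ->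
    cds_on (add_edge e u v) (c |: C) E -> #|E :&: C| < #|D :&: C| -> u \in E -> False.
  move=> u v uC vC cu cv uv; apply/negPn/negP=> nuv.
  have [||E [cE cdsE lt]] := side_fact sd _ _ uv nuv; rewrite ?inE ?uC ?vC ?orbT //.
  case/orP=> [|vE]; first exact: H uC cu vC cv uv cE cdsE lt.
  apply: (H v u E vC cv uC cu _ cE _ lt vE); first by rewrite eq_sym.
  exact: cds_on_addC cdsE.
move=> uC ncu vC ncv uv cE [sE conE _] lt uE.
have /cards1P[w Ew] : #|E :&: C| == 1.
  rewrite eqn_leq -ltnS (leq_trans lt D2) card_gt0; apply/set0Pn; exists u.
  by rewrite inE uE uC.
have inC x : x \in E -> x = c \/ x = u.
  move=> xE; have := subsetP sE _ xE; rewrite !inE => /orP[/eqP|xC]; first by left.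
  right; have : x \in E :&: C by rewrite inE xE.
  have : u \in E :&: C by rewrite inE uE.
  by rewrite Ew !inE => /eqP -> /eqP.
have cu : c != u by apply: contraNneq cC => ->.
have cv : c != v by apply: contraNneq cC => ->.
have [|y [yE yc]] := connected_in_nbr conE cE uE; first by rewrite eq_sym.
case: (inC _ yE) yc => ->; first by rewrite eqxx.
by rewrite add_edge_neq // (negbTE ncu).
Qed.

Section Leaf.

Variables (c : T) (C : {set T}).
Hypothesis sd : side e c C.
Hypothesis leaf : forall z P, z \in C -> ~ side e z P.
Let A := [set a in C | e c a].
Let R := C :\: A.

Let inA x : (x \in A) = (x \in C) && e c x. Proof. by rewrite inE. Qed.
Let inR x : (x \in R) = (x \in C) && ~~ e c x.
Proof. by rewrite !inE; case: (_ \in _); rewrite ?andbF ?andbT. Qed.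

Let AR x : x \in A -> x \notin R.
Proof. by rewrite inA inR => /andP[-> ->]. Qed.

Let ARC : A :|: R = C.
Proof. by apply/setP=> x; rewrite !inE; case: (_ \in C); case: (e c x). Qed.

Let exits a (S : {set T}) : a \in A -> S \subset R -> S != set0 ->
  exists x y, [/\ x \in S, y \in (A :|: R) :\: S, y != a & e x y].
Proof.
move=> aA sS S0; have [cC _ _ out] := sd.
have [/exists_inP[x xS /exists_inP[y yS /andP[ya exy]]]|no] :=
  boolP [exists x in S, exists y in (A :|: R) :\: S, (y != a) && e x y].
  by exists x, y.
have aC : a \in C by move: aA; rewrite inA => /andP[].
case: (leaf (z := a) (P := S) aC); split=> //.
- by apply: contraL aA => /(subsetP sS); rewrite inA inR => /andP[-> /negbTE ->].
- exists c; last by apply: contraNneq cC => ->.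
  by apply: contra cC => /(subsetP sS); rewrite inR => /andP[].
- move=> x y xS yS exy; apply/eqP/negPn/negP=> ya; case/negP: no.
  have := subsetP sS _ xS; rewrite inR => /andP[xC ncx].
  apply/exists_inP; exists x => //; apply/exists_inP; exists y; last by rewrite ya.
  rewrite ARC inE yS /=; apply/negPn/negP=> yC.
  by move: ncx; rewrite sym -(out x y xC yC exy) exy.
Qed.

Let clique : {in A &, forall a b, a != b -> e a b}.
Proof.
move=> a b; rewrite !inA => /andP[aC ca] /andP[bC cb]; exact: side_clique sd _ _ aC bC ca cb.
Qed.

Let A0 : A != set0.
Proof.
by have [a aC ca] := side_nbr sym con sd; apply/set0Pn; exists a; rewrite inA aC.
Qed.

Lemma leaf_span2 : #|D :&: C| <= 2 -> spanned c (c |: C).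
Proof.
move=> D2; apply: hooked_span => //; rewrite -/A -/R.
have [R0|R0] := eqVneq R set0.
  have [a aA] := set0Pn _ A0; exists a, [:: a], a; split; rewrite ?walk1 //.
    by move=> x; rewrite !inE => /eqP ->; move: aA; rewrite inA => /andP[-> ->].
  by move=> x; rewrite R0 inE.
have [a0 a0A] := set0Pn _ A0.
have [r [a [rR]]] := exits a0A (subxx R) R0.
rewrite in_setD ARC => /andP[aR aC] _ era.
have aA : a \in A by move: aR; rewrite inA inR aC /= negbK.
have uR : uniq (r :: enum (R :\ r)) by rewrite /= enum_uniq mem_enum !inE eqxx.
have memR x : (x \in r :: enum (R :\ r)) = (x \in R).
  by rewrite inE mem_enum in_setD1; case: eqVneq => // ->; rewrite rR.
have [|z wz] := clique_walk1 _ uR.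
  move=> u v; rewrite !memR !inR => /andP[uC cu] /andP[vC cv]; exact: (far_clique sd D2 uC vC cu cv).
exists a, (a :: r :: enum (R :\ r)), z; split=> //.
- by apply: walk_cons wz; rewrite sym.
- by rewrite cons_uniq uR memR (AR aA).
- by move=> x; rewrite in_cons memR in_setU => /predU1P[->|->]; rewrite ?aA ?orbT.
- by move=> x xR; rewrite in_cons memR xR orbT.
Qed.

Let fans u v : #|D :&: C| = 3 -> u \in R -> v \in R -> u != v -> ~~ e u v ->
  fanned e A R u v || fanned e A R v u.
Proof.
move=> D3; have [cC _ _ _] := sd.
suff H p q E : p \in R -> q \in R -> p != q -> c \in E ->
    cds_on (add_edge e p q) (c |: C) E -> #|E :&: C| < #|D :&: C| -> p \in E -> fanned e A R p q.
  move=> uR vR uv nuv.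
  have [||E [cE cdsE lt]] := side_fact sd _ _ uv nuv.
  - by move: uR; rewrite inR !inE => /andP[-> _]; rewrite orbT.
  - by move: vR; rewrite inR !inE => /andP[-> _]; rewrite orbT.
  case/orP=> [uE|vE]; first by rewrite (H _ _ _ uR vR uv cE cdsE lt uE).
  rewrite orbC (H v u E vR uR _ cE _ lt vE) //; first by rewrite eq_sym.
  exact: cds_on_addC cdsE.
rewrite !inR => /andP[pC ncp] /andP[qC ncq] pq cE cdsE lt pE.
have [sE conE dE] := cdsE.
have cp : c != p by apply: contraNneq cC => ->.
have cq : c != q by apply: contraNneq cC => ->.
have pEC : p \in E :&: C by rewrite inE pE.
(* E = {c, p, y}, and y joins p to c *)
have [|y [yE yc]] := connected_in_nbr conE cE pE; first by rewrite eq_sym.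
rewrite add_edge_neq // => ecy.
have yp : y != p by apply: contraNneq ncp => <-.
have yq : y != q by apply: contraNneq ncq => <-.
have yC : y \in C by have := subsetP sE _ yE; rewrite !inE (negbTE yc).
have EE x : x \in E -> [|| x == c, x == p | x == y].
  move=> xE; have := subsetP sE _ xE; rewrite !inE => /orP[->//|xC].
  apply/negPn/negP; rewrite !negb_or => /and3P[xc xp xy].
  have : #|[set x; p; y]| <= #|E :&: C|.
    by apply/subset_leq_card/subsetP=> z; rewrite !inE => /orP[/orP[]|] /eqP ->; rewrite ?xE ?pE ?yE.
  rewrite -setUA cardsU1 cards2 !inE negb_or xp xy eq_sym yp => le3.
  by have := leq_ltn_trans le3 lt; rewrite D3.
have qE : q \notin E by apply/negP=> /EE; rewrite eq_sym (negbTE cq) eq_sym (negbTE pq) eq_sym (negbTE yq).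
have add x z : x \notin [set q] -> z \in E -> add_edge e p q x z = e x z.
  rewrite inE => xq zE; apply: add_edge_neq2 => //; by apply: contraNneq qE => <-.
have epy : e p y.
  have [z [zE zp]] := connected_in_nbr conE pE cE cp; rewrite add ?inE //.
  by case/or3P: (EE _ zE) zp => /eqP -> //; rewrite ?eqxx // sym (negbTE ncp).
apply/existsP; exists y; rewrite /fan inA yC ecy epy /=; apply/andP; split.
  apply/negP=> eyq; suff /(side_min sd cE) : cds_on e (c |: C) E by rewrite leqNgt lt.
  by apply: cds_on_add_dominated qE cdsE yE _; rewrite // sym.
apply/forall_inP=> x; rewrite inR => /andP[xC ncx]; apply/implyP=> xq.
have [//|xp] := eqVneq x p; rewrite /=.
have xE : x \notin E.
  apply/negP=> /EE; rewrite (negbTE xp) /= => /orP[] /eqP E'; rewrite -E' ?xC in cC ecy => //.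
  by rewrite ecy in ncx.
have [|z zE] := dE x _ xE; first by rewrite !inE xC orbT.
rewrite add ?inE //; case/or3P: (EE _ zE) => /eqP ->; rewrite sym ?(negbTE ncx) //.
  by move=> ->.
by move=> ->; rewrite orbT.
Qed.

Let miss : #|D :&: C| = 3 ->
  {in A &, forall a b, a != b -> exists2 r, r \in R & ~~ e a r && ~~ e b r}.
Proof.
move=> D3 a b; have [cC _ _ _] := sd.
rewrite !inA => /andP[aC eca] /andP[bC ecb] ab.
have [/exists_inP[r rR nr]|/exists_inPn no] := boolP [exists r in R, ~~ e a r && ~~ e b r].
  by exists r.
have cE : c \in [set a; b; c] by rewrite !inE eqxx orbT.
suff /(side_min sd cE) : cds_on e (c |: C) [set a; b; c].
  have /subset_leq_card : [set a; b; c] :&: C \subset [set a; b].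
    apply/subsetP=> x; rewrite !inE => /andP[/orP[//|/eqP ->]].
    by rewrite (negbTE cC).
  by rewrite D3 cards2 ab => le2 /leq_trans/(_ le2).
split.
- by apply/subsetP=> x; rewrite !inE => /orP[/orP[]|] /eqP ->; rewrite ?aC ?bC ?eqxx ?orbT.
- rewrite -setUA; apply: (connected_in_add (y := c)); rewrite ?inE ?eqxx ?orbT //; last by rewrite sym.
  apply: (connected_in_add (y := c)); rewrite ?inE ?eqxx ?orbT //; last by rewrite sym.
  exact: connected_in1.
- move=> x; rewrite !inE => /predU1P[->|xC]; first by rewrite eqxx !orbT.
  move=> _; have [ecx|ncx] := boolP (e c x); first by exists c; rewrite ?inE ?eqxx ?orbT // sym.
  have := no x; rewrite inR xC ncx => /(_ isT); rewrite negb_and !negbK => /orP[eax|ebx].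
    by exists a; rewrite ?inE ?eqxx ?orbT // sym.
  by exists b; rewrite ?inE ?eqxx ?orbT // sym.
Qed.

Lemma leaf_span : #|D :&: C| <= 3 -> spanned c (c |: C).
Proof.
rewrite leq_eqVlt => /orP[/eqP D3|]; last exact: leaf_span2.
apply: hooked_span => //; rewrite -/A -/R.
have R0 : R != set0.
  apply/eqP=> R0; have cE : c \in [set c] by rewrite inE.
  suff /(side_min sd cE) : cds_on e (c |: C) [set c].
    have [cC _ _ _] := sd; rewrite D3 (_ : _ :&: _ = set0) ?cards0 //.
    by apply/setP=> x; rewrite !inE; case: eqP => // ->; rewrite (negbTE cC).
  split; first by rewrite sub1set !inE eqxx.
    exact: connected_in1.
  move=> x; rewrite !inE => /orP[->//|xC] _; exists c; rewrite ?inE // sym.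
  by apply/negPn/negP=> ncx; have := inR x; rewrite R0 inE xC ncx.
apply: (hooked_path sym irr clique AR A0 R0 _ (miss D3) exits).
by move=> u v; apply: fans.
Qed.

End Leaf.
End Critical.

(** * Two light sides *)

Section Links.

Variables (T : finType) (e : rel T).
Hypothesis sym : symmetric e.
Implicit Types (B P Q S : {set T}) (x y c : T).

Lemma closed_within_connect S P x y : closed_within e S P -> x \in P ->
  connect (induced e S) x y -> y \in P.
Proof.
move=> Pcl xP /connectP[p]; elim: p x xP => [|z p IH] x xP /=; first by move=> _ ->.
by case/andP=> /and3P[_ zS exz]; apply: IH; apply: Pcl exz.
Qed.

Lemma connected_in_or S c1 c2 : c1 \in S -> c2 \in S ->
  (forall P, P \subset S -> P != set0 -> closed_within e S P -> (c1 \in P) || (c2 \in P)) ->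
  connected_in e S \/
  exists P Q, [/\ S = P :|: Q, connected_in e P, connected_in e Q, c1 \in P & c2 \in Q] /\
     [/\ c1 \notin Q, c2 \notin P, closed_within e S P & closed_within e S Q].
Proof.
move=> c1S c2S H; pose P := [set z in S | connect (induced e S) c1 z].
have sPS : P \subset S by apply/subsetP=> x; rewrite inE => /andP[].
have c1P : c1 \in P by rewrite inE c1S connect0.
have Pcl : closed_within e S P.
  move=> x y; rewrite !inE => /andP[xS cx] yS exy; rewrite yS.
  by apply: (connect_trans cx); apply: connect1; rewrite /induced /= xS yS.
have [|c2P] := boolP (c2 \in P).
  rewrite inE => /andP[_ c12]; left; apply: (connected_in_base sym c1S) => P' sP P0 P'cl.
  case/orP: (H P' sP P0 P'cl) => // c2P'; apply: (closed_within_connect P'cl c2P').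
  rewrite sym_connect_sym // => x y; rewrite /induced /= sym andbCA; by case: (x \in S).
right; exists P, (S :\: P).
have Qcl : closed_within e S (S :\: P).
  move=> x y; rewrite !in_setD => /andP[xP xS] yS exy; rewrite yS andbT.
  by apply: contra xP => yP; apply: (Pcl y) => //; rewrite sym.
have c2Q : c2 \in S :\: P by rewrite in_setD c2P.
have c1Q : c1 \notin S :\: P by rewrite in_setD c1P.
have wide Q : Q \subset S -> closed_within e S Q -> forall P', P' \subset Q -> P' != set0 ->
    closed_within e Q P' -> (c1 \in P') || (c2 \in P').
  move=> sQ Qcl' P' sP P0 P'cl; apply: H => //; first exact: subset_trans sP sQ.
  move=> x y xP yS exy; apply: (P'cl x) => //; apply: (Qcl' x) => //; exact: (subsetP sP).
split; split=> //.
- apply/setP=> x; rewrite in_setU in_setD; case: (boolP (x \in P)) => //= xP.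
  exact: (subsetP sPS).
- apply: (connected_in_base sym c1P) => P' sP P0 P'cl.
  case/orP: (wide _ sPS Pcl P' sP P0 P'cl) => // c2P'.
  by rewrite (subsetP sP _ c2P') in c2P.
- apply: (connected_in_base sym c2Q) => P' sP P0 P'cl.
  case/orP: (wide _ (subsetDl _ _) Qcl P' sP P0 P'cl) => // c1P'.
  by rewrite (subsetP sP _ c1P') in c1Q.
Qed.

Lemma connected_in_link P Q x y : connected_in e P -> connected_in e Q -> x \in P -> y \in Q ->
  e x y -> connected_in e (P :|: Q).
Proof.
move=> cP cQ xP yQ exy; have -> : P :|: Q = P :|: (x |: Q).
  by apply/setP=> z; rewrite !inE; case: eqVneq => // ->; rewrite xP.
apply: (connected_inU sym xP) => //; first by rewrite !inE eqxx.
exact: connected_in_add yQ exy.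
Qed.

Lemma connected_in_two_links B P Q : connected_in e B -> connected_in e P -> connected_in e Q ->
  P \subset B -> Q \subset B ->
  (forall x, x \in B -> x \notin P :|: Q -> exists2 y, y \in P :|: Q & e x y) ->
  exists x y, connected_in e (x |: (y |: (P :|: Q))).
Proof.
move=> cB cP cQ sP sQ dB.
have add R x : connected_in e R -> (x \in R) || [exists y in R, e x y] ->
    connected_in e (x |: R).
  move=> cR /orP[xR|/exists_inP[y yR exy]]; last exact: connected_in_add yR exy.
  by rewrite (_ : x |: R = R) //; apply/setUidPr; rewrite sub1set.
pose N := [set x in B | (x \in P) || [exists y in P, e x y]].
have fin x y : (x \in P) || [exists y in P, e x y] -> (y \in Q) || [exists z in Q, e y z] ->
    e x y -> connected_in e (x |: (y |: (P :|: Q))).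
  move=> /(add _ _ cP) cxP /(add _ _ cQ) cyQ exy.
  have -> : x |: (y |: (P :|: Q)) = (x |: P) :|: (y |: Q).
    by apply/setP=> z; rewrite !inE; case: eqP; case: eqP; case: (z \in P).
  by apply: (connected_in_link cxP cyQ _ _ exy); rewrite !inE eqxx.
have [q qQ] : exists q, q \in Q by case/connected_inP: cQ => /set0Pn.
have [E|NB] := eqVneq N B.
  exists q, q; have -> : q |: (q |: (P :|: Q)) = P :|: Q.
    by apply/setP=> z; rewrite !inE; case: eqP => // ->; rewrite qQ orbT.
  have := subsetP sQ _ qQ; rewrite -E inE => /andP[_ /orP[qP|/exists_inP[p pP eqp]]].
    exact: connected_inU sym qP qQ _ _.
  by rewrite setUC; apply: connected_in_link qQ pP eqp.
have sNB : N \subset B by apply/subsetP=> x; rewrite inE => /andP[].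
have N0 : N != set0.
  by case/connected_inP: cP => /set0Pn[p pP] _; apply/set0Pn; exists p; rewrite inE pP (subsetP sP).
have [x [y [xN]]] := connected_in_edge cB sNB N0 NB.
rewrite !inE in xN *; case/andP: xN => xB xN; rewrite negb_and negb_or.
case/andP=> /orP[yB'|/andP[yP yNP]] yB exy; first by rewrite yB in yB'.
exists x, y; apply: fin => //.
have [//|yQ] := boolP (y \in Q); apply/exists_inP.
have [|z zPQ eyz] := dB y yB; first by rewrite inE negb_or yP.
exists z => //; move: zPQ; rewrite inE => /orP[zP|//].
by case/negP: yNP; apply/exists_inP; exists z.
Qed.

End Links.

Section TwoSides.

Variables (T : finType) (e : rel T) (k : nat) (D : {set T}).
Hypothesis sym : symmetric e.
Hypothesis irr : irreflexive e.
Hypothesis crit : gamma_c_critical k e.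
Hypothesis cdsD : cds_on e [set: T] D.
Hypothesis cardD : #|D| = k.
Implicit Types (C P S : {set T}) (x y z c b : T).

Lemma small_side c C : side e c C -> #|D :&: C| <= 1 ->
  exists2 b, b \in C & 0 < #|D :&: C| -> ~~ e c b.
Proof.
move=> sd D1; have [cC /set0Pn[x0 x0C] _ _] := sd.
case: (posnP #|D :&: C|) => [_|Dpos]; first by exists x0.
have [/exists_inP[b bC nb]|/exists_inPn no] := boolP [exists b in C, ~~ e c b].
  by exists b.
have cE : c \in [set c] by rewrite inE.
suff /(side_min sym crit cdsD cardD sd cE) : cds_on e (c |: C) [set c].
  rewrite (_ : [set c] :&: C = set0) ?cards0 1?leqNgt ?Dpos //.
  by apply/setP=> x; rewrite !inE; case: eqP => // ->; rewrite (negbTE cC).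
split; first by rewrite sub1set !inE eqxx.
  exact: connected_in1.
move=> x; rewrite !inE => /orP[->//|xC] _; exists c; rewrite ?inE // sym.
by have := no x xC; rewrite negbK.
Qed.

(* S cannot exist: outside of C1 and C2 it would yield a connected dominating set of
   the original graph with fewer than k vertices. *)
Record crossing c1 C1 b1 c2 C2 b2 S : Prop := Crossing {
  cr_side1 : side e c1 C1;
  cr_side2 : side e c2 C2;
  cr_disj : forall x, x \in c1 |: C1 -> x \notin c2 |: C2;
  cr_le1 : #|D :&: C1| <= 1;
  cr_le2 : #|D :&: C2| <= 1;
  cr_b1 : b1 \in C1;
  cr_b2 : b2 \in C2;
  cr_nb1 : 0 < #|D :&: C1| -> ~~ e c1 b1;
  cr_nb2 : 0 < #|D :&: C2| -> ~~ e c2 b2;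
  cr_cds : cds_on (add_edge e b1 b2) [set: T] S;
  cr_lt : #|S| < k }.

Lemma crossing_sym c1 C1 b1 c2 C2 b2 S :
  crossing c1 C1 b1 c2 C2 b2 S -> crossing c2 C2 b2 c1 C1 b1 S.
Proof.
case=> sd1 sd2 dis le1 le2 b1C b2C nb1 nb2 cds lt; split=> //.
  by move=> x x2; apply/negP=> /dis; rewrite x2.
exact: cds_on_addC cds.
Qed.

Section Facts.

Variables (c1 c2 b1 b2 : T) (C1 C2 S : {set T}).
Hypothesis cr : crossing c1 C1 b1 c2 C2 b2 S.

Lemma cr_c1C2 : c1 \notin C2.
Proof. by have := cr_disj cr (x := c1); rewrite !inE eqxx negb_or => /(_ isT)/andP[]. Qed.
Lemma cr_c2C1 : c2 \notin C1.
Proof. by apply/negP=> c2C; have := cr_disj cr (x := c2); rewrite !inE c2C eqxx orbT => /(_ isT). Qed.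
Lemma cr_neq : c1 != c2.
Proof. by have := cr_disj cr (x := c1); rewrite !inE eqxx negb_or => /(_ isT)/andP[]. Qed.
Lemma cr_C1C2 x : x \in C1 -> x \notin C2.
Proof. by move=> xC; have := cr_disj cr (x := x); rewrite !inE xC orbT negb_or => /(_ isT)/andP[]. Qed.

Lemma cr_out1 x y : x \in C1 -> y \notin C1 -> e x y -> y = c1.
Proof. by case: (cr_side1 cr) => _ _ _; apply. Qed.
Lemma cr_out2 x y : x \in C2 -> y \notin C2 -> e x y -> y = c2.
Proof. by case: (cr_side2 cr) => _ _ _; apply. Qed.

Definition middle := ~: (C1 :|: C2).

Lemma middleE x : (x \in middle) = (x \notin C1) && (x \notin C2).
Proof. by rewrite !inE negb_or. Qed.

Lemma c1_mid : c1 \in middle.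
Proof. by rewrite middleE cr_c1C2; case: (cr_side1 cr) => ->. Qed.
Lemma c2_mid : c2 \in middle.
Proof. by rewrite middleE cr_c2C1; case: (cr_side2 cr) => ->. Qed.

Lemma mid_edge x y : x \in middle -> add_edge e b1 b2 x y = e x y.
Proof.
rewrite middleE => /andP[x1 x2]; apply: add_edge_neq.
  by apply: contraNneq x1 => ->; apply: cr_b1 cr.
by apply: contraNneq x2 => ->; apply: cr_b2 cr.
Qed.

Lemma mid_nbr x y : x \in middle -> e x y ->
  [\/ y \in middle, y \in C1 /\ x = c1 | y \in C2 /\ x = c2].
Proof.
rewrite !middleE => /andP[x1 x2] exy.
have [y1|y1] := boolP (y \in C1); first by constructor 2; split=> //; apply: (cr_out1 y1 x1); rewrite sym.
have [y2|y2] := boolP (y \in C2); first by constructor 3; split=> //; apply: (cr_out2 y2 x2); rewrite sym.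
by constructor 1.
Qed.

Lemma S_dom x : x \notin S -> exists2 y, y \in S & add_edge e b1 b2 x y.
Proof. by case: (cr_cds cr) => _ _; apply. Qed.

Lemma S_closed P : P \subset S -> P != set0 ->
  (forall x y, x \in P -> y \in S -> add_edge e b1 b2 x y -> y \in P) -> P = S.
Proof. by case: (cr_cds cr) => _ cS _ sP P0; apply: connected_in_closed. Qed.

Lemma b1_nbr y : add_edge e b1 b2 b1 y -> y = b2 \/ (y \in c1 |: C1) && e b1 y.
Proof.
have b1C := cr_b1 cr; have b2C := cr_b2 cr.
case/or3P=> [eb|/andP[_ /eqP ->]|/andP[/eqP E _]]; last 2 first.
- by left.
- by have := cr_C1C2 b1C; rewrite E b2C.
right; rewrite eb andbT !inE; have [yC|yC] := boolP (y \in C1); first by rewrite orbT.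
by rewrite (cr_out1 b1C yC eb) eqxx.
Qed.

Lemma C1_nbr x y : x \in C1 -> x != b1 -> add_edge e b1 b2 x y -> (y \in c1 |: C1) /\ e x y.
Proof.
move=> xC xb; have xb2 : x != b2 by apply: contraTneq xC => ->; apply: contraL (cr_b2 cr) => /cr_C1C2.
rewrite add_edge_neq // => exy; split=> //; rewrite !inE.
have [yC|yC] := boolP (y \in C1); first by rewrite orbT.
by rewrite (cr_out1 xC yC exy) eqxx.
Qed.

Lemma S_mid_closed P : P \subset S :&: middle -> P != set0 -> closed_within e (S :&: middle) P ->
  (c1 \in P) || (c2 \in P).
Proof.
move=> sP P0 Pcl; apply/negPn/negP; rewrite negb_or => /andP[n1 n2].
have inP x : x \in P -> x \in S /\ x \in middle.
  by move=> /(subsetP sP); rewrite in_setI => /andP.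
have E : P = S.
  apply: S_closed => //; first by apply: subset_trans sP (subsetIl _ _).
  move=> x y xP yS; have [xS xm] := inP x xP; rewrite mid_edge // => exy.
  case: (mid_nbr xm exy) => [ym|[_ E]|[_ E]]; last 2 first.
  - by rewrite -E xP in n1.
  - by rewrite -E xP in n2.
  by apply: (Pcl x); rewrite // inE yS.
have b1S : b1 \notin S.
  by rewrite -E; apply/negP=> /inP[_]; rewrite middleE (cr_b1 cr).
have [y yS /b1_nbr[]] := S_dom b1S.
  move=> y2; move: yS; rewrite -E y2 => /inP[_]; rewrite middleE (cr_b2 cr).
  by rewrite andbF.
rewrite !inE => /andP[/orP[/eqP y1|y1] _]; first by rewrite -y1 E yS in n1.
by move: yS; rewrite -E => /inP[_]; rewrite middleE y1.
Qed.

Lemma card_S : #|S| = #|S :&: middle| + #|S :&: C1| + #|S :&: C2|.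
Proof.
rewrite -(cardsID C1 S) -(cardsID C2 (S :\: C1)) addnC -addnA addnC; congr (_ + _ + _).
- by apply: eq_card => x; rewrite !inE negb_or; case: (x \in C1); case: (x \in C2); rewrite ?andbF ?andbT.
- apply: eq_card => x; rewrite !inE; case: (boolP (x \in C1)) => //= x1.
  by rewrite (negbTE (cr_C1C2 x1)) !andbF.
Qed.

(* M is completed by the parts of D in C1 and C2. *)
Lemma mid_bound M : connected_in e M -> S :&: middle \subset M -> c1 \in M -> c2 \in M ->
  k <= #|M| + #|D :&: C1| + #|D :&: C2|.
Proof.
move=> cM sM c1M c2M.
have part c C : side e c C -> cds_on e (c |: C) (c |: (D :&: C)).
  move=> sd; have := side_restrict sym sd cdsD.
  rewrite (_ : D :&: (c |: C) = c |: (D :&: C)) //; apply/setP=> x; rewrite !inE.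
  by case: eqP => // ->; rewrite (side_mem sym sd cdsD).
have [s1 k1 d1] := part _ _ (cr_side1 cr); have [s2 k2 d2] := part _ _ (cr_side2 cr).
pose E := M :|: (c1 |: (D :&: C1)) :|: (c2 |: (D :&: C2)).
have inc c C x : x \in c |: (D :&: C) -> (x == c) || (x \in C).
  by rewrite !inE => /orP[->//|/andP[_ ->]]; rewrite orbT.
have : cds_on e [set: T] E.
  split; first exact: subsetT.
    apply: (connected_inU sym (x0 := c2) _ _ _ k2); rewrite ?inE ?c2M ?eqxx //.
    by apply: (connected_inU sym c1M _ cM k1); rewrite !inE eqxx.
  move=> x _ xE; have [x1|x1] := boolP (x \in C1).
    have [||y yE exy] := d1 x; first by rewrite !inE x1 orbT.
      by apply: contra xE => xD; rewrite in_setU in_setU xD orbT.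
    by exists y => //; rewrite in_setU in_setU yE orbT.
  have [x2|x2] := boolP (x \in C2).
    have [||y yE exy] := d2 x; first by rewrite !inE x2 orbT.
      by apply: contra xE => xD; rewrite in_setU xD orbT.
    by exists y => //; rewrite in_setU yE orbT.
  have xm : x \in middle by rewrite middleE x1.
  have [xM nx1 nx2] : [/\ x \notin M, x != c1 & x != c2].
    split; first by apply: contra xE => xM; rewrite !in_setU xM.
      by apply: contraNneq xE => ->; rewrite !in_setU c1M.
    by apply: contraNneq xE => ->; rewrite !in_setU c2M.
  have [|y yS] := S_dom (x := x).
    by apply: contra xM => xS; apply: (subsetP sM); rewrite inE xS.
  rewrite mid_edge // => exy; exists y => //.
  case: (mid_nbr xm exy) => [ym|[_ E']|[_ E']]; last 2 first.
  - by rewrite E' eqxx in nx1.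
  - by rewrite E' eqxx in nx2.
  by rewrite !in_setU (subsetP sM) // inE yS.
move/(critical_min crit); move=> le; apply: (leq_trans le).
have -> : E = M :|: (D :&: C1) :|: (D :&: C2).
  by apply/setP=> x; rewrite !inE; case: eqP => [->|_]; rewrite ?c1M //; case: eqP => [->|_]; rewrite ?c2M.
by rewrite (leq_trans (leq_card_setU _ _)) // leq_add2r leq_card_setU.
Qed.

Lemma sep_cross P z : P \subset S :&: middle -> c1 \in P -> c2 \notin P ->
  closed_within e (S :&: middle) P -> z \in S -> z \notin P :|: C1 -> (b1 \in S) && (b2 \in S).
Proof.
move=> sP c1P c2P Pcl zS zP; apply/negPn/negP=> nb; case/negP: zP.
have inP x : x \in P -> x \in S /\ x \in middle.
  by move=> /(subsetP sP); rewrite in_setI => /andP.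
suff E : P :|: (S :&: C1) = S by move: zS; rewrite -{1}E !inE => /orP[->|/andP[_ ->]]; rewrite ?orbT.
apply: S_closed.
- by apply/subsetP=> x; rewrite !inE => /orP[/inP[]|/andP[]].
- by apply/set0Pn; exists c1; rewrite inE c1P.
move=> x y; rewrite !in_setU !in_setI => /orP[xP|/andP[xS xC]] yS exy.
  have [_ xm] := inP x xP; rewrite mid_edge // in exy.
  case: (mid_nbr xm exy) => [ym|[yC _]|[_ E]]; last 2 first.
  - by rewrite yS yC orbT.
  - by rewrite -E xP in c2P.
  by rewrite (Pcl x) // inE yS.
have [xb|xb] := eqVneq x b1; last first.
  have [+ _] := C1_nbr xC xb exy; rewrite !inE => /orP[/eqP->|yC]; first by rewrite c1P.
  by rewrite yS yC orbT.
rewrite xb in exy xS; case: (b1_nbr exy) => [yb|]; first by rewrite xS -yb yS in nb.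
by rewrite !inE => /andP[/orP[/eqP->|yC] _]; [rewrite c1P|rewrite yS yC orbT].
Qed.

Lemma sep_big P : P \subset S :&: middle -> c1 \in P -> c2 \notin P ->
  closed_within e (S :&: middle) P -> b1 \in S -> #|D :&: C1| < #|S :&: C1|.
Proof.
move=> sP c1P c2P Pcl b1S; have b1C := cr_b1 cr.
have inP x : x \in P -> x \in S /\ x \in middle.
  by move=> /(subsetP sP); rewrite in_setI => /andP.
have b1SC : b1 \in S :&: C1 by rewrite inE b1S.
case: (posnP #|D :&: C1|) => [->|t1]; first by rewrite card_gt0; apply/set0Pn; exists b1.
apply: leq_ltn_trans (cr_le1 cr) _; rewrite ltnNge; apply/negP=> le1.
have only y : y \in S -> y \in C1 -> y = b1.
  move=> yS yC; have /card_le1_eqP := le1; apply=> //; by rewrite inE yS.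
have E : P = S.
  apply: S_closed; first exact: subset_trans sP (subsetIl _ _).
    by apply/set0Pn; exists c1.
  move=> x y xP yS; have [_ xm] := inP x xP; rewrite mid_edge // => exy.
  case: (mid_nbr xm exy) => [ym|[yC E]|[_ E]]; last 2 first.
  - by move: exy; rewrite E (only y yS yC) (negbTE (cr_nb1 cr t1)).
  - by rewrite -E xP in c2P.
  by apply: (Pcl x) => //; rewrite inE yS.
by have := b1S; rewrite -E => /inP[_]; rewrite middleE b1C.
Qed.

Lemma few_b2 : #|S :&: C1| < #|D :&: C1| -> b1 \notin S /\ (c1 \in S -> b2 \in S).
Proof.
move=> lt; have t1 := leq_ltn_trans (leq0n _) lt.
have /eqP : #|S :&: C1| = 0 by apply/eqP; rewrite -leqn0 -ltnS (leq_trans lt) // (cr_le1 cr).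
rewrite cards_eq0 => /eqP S1.
have notC y : y \in S -> y \notin C1.
  by move=> yS; apply/negP=> yC; have /setP/(_ y) := S1; rewrite !inE yS yC.
have b1S : b1 \notin S by apply/negP=> /notC; rewrite (cr_b1 cr).
split=> // _; have [y yS /b1_nbr[<-//|]] := S_dom b1S.
rewrite !inE (negbTE (notC _ yS)) orbF => /andP[/eqP ->].
by rewrite sym (negbTE (cr_nb1 cr t1)).
Qed.

Lemma mid_connected : connected_graph e -> connected_in e middle.
Proof.
move=> con; apply/connected_inP; split; first by apply/set0Pn; exists c1; apply: c1_mid.
move=> P sP /set0Pn[x0 x0P] Pcl.
pose Q := P :|: [set x in C1 | c1 \in P] :|: [set x in C2 | c2 \in P].
have E : Q = [set: T].
  apply: (connected_in_closed con) => //; first by apply/set0Pn; exists x0; rewrite !inE x0P.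
  move=> x y; rewrite !inE => /orP[/orP[xP|/andP[xC cP]]|/andP[xC cP]] _ exy.
  - case: (mid_nbr (subsetP sP _ xP) exy) => [ym|[yC <-]|[yC <-]]; rewrite ?xP ?yC ?orbT //.
    by rewrite (Pcl x).
  - have [yC|yC] := boolP (y \in C1); first by rewrite cP orbT.
    by rewrite (cr_out1 xC yC exy) cP.
  - have [yC|yC] := boolP (y \in C2); first by rewrite cP orbT.
    by rewrite (cr_out2 xC yC exy) cP.
apply/subsetP=> x; rewrite middleE => /andP[/negbTE x1 /negbTE x2].
have : x \in Q by rewrite E inE.
by rewrite !inE x1 x2 /= !orbF.
Qed.

End Facts.

Let con : connected_graph e. Proof. by case: crit. Qed.

Lemma middleC C1 C2 : middle C2 C1 = middle C1 C2.
Proof. by rewrite /middle setUC. Qed.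

Lemma crossing_count c1 C1 b1 c2 C2 b2 S M : crossing c1 C1 b1 c2 C2 b2 S ->
  connected_in e M -> S :&: middle C1 C2 \subset M -> c1 \in M -> c2 \in M ->
  #|S :&: middle C1 C2| + #|S :&: C1| + #|S :&: C2| < #|M| + #|D :&: C1| + #|D :&: C2|.
Proof.
by move=> cr cM sM c1M c2M; rewrite -(card_S cr) (leq_trans (cr_lt cr)) // (mid_bound cr).
Qed.

Lemma crossing_one c1 C1 b1 c2 C2 b2 S : crossing c1 C1 b1 c2 C2 b2 S ->
  c1 \in S -> c2 \in S.
Proof.
move=> cr c1S; apply/negPn/negP=> c2S; have rc := crossing_sym cr.
set O := middle C1 C2; have OE : middle C2 C1 = O by apply: middleC.
have count := crossing_count cr; rewrite -/O in count.
have c1O := c1_mid cr; have c2O := c2_mid cr; rewrite -/O in c1O c2O.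
have memO x : x \in O -> (x \in S :&: O) = (x \in S) by rewrite in_setI => ->; rewrite andbT.
have c1SO : c1 \in S :&: O by rewrite memO.
have c2SO : c2 \notin S :&: O by rewrite memO.
have SOcl : closed_within e (S :&: O) (S :&: O) by [].
have conSO : connected_in e (S :&: O).
  apply: (connected_in_base sym c1SO) => P sP P0 Pcl.
  have /orP[//|/(subsetP sP)] := S_mid_closed cr sP P0 Pcl.
  by rewrite (negbTE c2SO).
have b1S : b1 \in S.
  have [b2S|b2S] := boolP (b2 \in S).
    have z2 : b2 \notin (S :&: O) :|: C1.
      rewrite in_setU in_setI /O middleE (cr_b2 cr) !andbF /=.
      by apply: contraL (cr_b2 cr) => /(cr_C1C2 cr).
    by have /andP[] := sep_cross cr (subxx _) c1SO c2SO SOcl b2S z2.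
  have [y yS /(b1_nbr rc)[<-//|]] := S_dom rc b2S.
  rewrite !inE => /andP[/orP[/eqP y2|y2] _]; first by rewrite -y2 yS in c2S.
  have z2 : y \notin (S :&: O) :|: C1.
    rewrite in_setU in_setI /O middleE y2 !andbF /=.
    by apply: contraL y2 => /(cr_C1C2 cr).
  by have /andP[] := sep_cross cr (subxx _) c1SO c2SO SOcl yS z2.
have big1 := sep_big cr (subxx _) c1SO c2SO SOcl b1S.
have [/exists_inP[y ySO ey]|/exists_inPn no] := boolP [exists y in S :&: O, e c2 y].
  have := count (c2 |: (S :&: O)) (connected_in_add sym conSO ySO ey) (subsetUr _ _).
  rewrite cardsU1 c2SO in_setU1 c1SO orbT setU11 => /(_ isT isT) lt.
  have lt2 : #|S :&: C2| < #|D :&: C2| by lia.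
  have [b2S _] := few_b2 rc lt2.
  have t2 := leq_ltn_trans (leq0n _) lt2.
  have S2 y' : y' \in S -> y' \notin C2.
    move=> y'S; apply/negP=> y'2; move: lt2; rewrite ltnNge (leq_trans (cr_le2 cr)) //.
    by rewrite card_gt0; apply/set0Pn; exists y'; rewrite inE y'S.
  have [a aC eca] := side_nbr sym con (cr_side2 cr).
  have aS : a \notin S by apply: contraL aC => /S2.
  have [ab|ab] := eqVneq a b2; first by move: (cr_nb2 cr t2); rewrite -ab eca.
  have [y' y'S /(C1_nbr rc aC ab)[]] := S_dom rc aS.
  rewrite !inE (negbTE (S2 _ y'S)) orbF => /eqP E; by rewrite -E y'S in c2S.
have [y yS] := S_dom rc c2S; rewrite (mid_edge rc) ?OE // => ecy.
have y2 : y \in C2.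
  case: (mid_nbr rc _ ecy) => [|ym|[//]|[_ E]]; first by rewrite OE.
    by have := no y; rewrite in_setI yS ecy -OE ym => /(_ isT).
  by have := cr_neq cr; rewrite E eqxx.
have z2 : y \notin (S :&: O) :|: C1.
  rewrite in_setU in_setI /O middleE y2 !andbF /=.
  by apply: contraL y2 => /(cr_C1C2 cr).
have /andP[_ b2S] := sep_cross cr (subxx _) c1SO c2SO SOcl yS z2.
have big2 : #|D :&: C2| < #|S :&: C2|.
  case: (posnP #|D :&: C2|) => [->|t2].
    by rewrite card_gt0; apply/set0Pn; exists y; rewrite inE yS.
  apply: leq_ltn_trans (cr_le2 cr) _; apply/card_gt1P; exists y, b2.
  split; rewrite ?inE ?yS ?b2S ?(cr_b2 cr) //.
  by apply: contraTneq ecy => ->; apply: (cr_nb2 cr).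
have [w wC ecw] := side_nbr sym con (side_compl sym (cr_side2 cr)).
move: wC; rewrite !inE negb_or => /andP[wc2 w2].
have wO : w \in O.
  case: (mid_nbr rc _ ecw) => [||[w2']|[_ E]]; first by rewrite OE.
  - by rewrite OE.
  - by rewrite w2' in w2.
  - by have := cr_neq cr; rewrite E eqxx.
have wS : w \notin S by have := no w; rewrite memO // => H; apply: contraL ecw => /H.
have [y' y'S] := S_dom cr wS; rewrite (mid_edge cr) // => ewy.
have y'SO : y' \in S :&: O.
  case: (mid_nbr cr wO ewy) => [y'm|[_ E]|[_ E]]; first by rewrite memO.
  - by rewrite -E in c1S; rewrite c1S in wS.
  - by rewrite E eqxx in wc2.
have := count (c2 |: (w |: (S :&: O))).
rewrite !in_setU1 c1SO eqxx !orbT => /(_ _ _ isT isT) H.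
have {H} : #|S :&: O| + #|S :&: C1| + #|S :&: C2| <
   #|c2 |: (w |: S :&: O)| + #|D :&: C1| + #|D :&: C2|.
  apply: H; last by rewrite setUA subsetUr.
  apply: (connected_in_add sym (y := w)); rewrite ?setU11 //.
  exact: connected_in_add sym conSO y'SO ewy.
have := cardsU1 c2 (w |: (S :&: O)); have := cardsU1 w (S :&: O).
have := leq_b1 (c2 \notin w |: S :&: O); have := leq_b1 (w \notin S :&: O).
move: big1 big2; clear; lia.
Qed.

Lemma crossing_both c1 C1 b1 c2 C2 b2 S : crossing c1 C1 b1 c2 C2 b2 S ->
  c1 \in S -> c2 \in S -> False.
Proof.
move=> cr c1S c2S; have rc := crossing_sym cr.
set O := middle C1 C2; have OE : middle C2 C1 = O by apply: middleC.
have count := crossing_count cr; rewrite -/O in count.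
have c1O := c1_mid cr; have c2O := c2_mid cr; rewrite -/O in c1O c2O.
have memO x : x \in O -> (x \in S :&: O) = (x \in S) by rewrite in_setI => ->; rewrite andbT.
have c1SO : c1 \in S :&: O by rewrite memO.
have c2SO : c2 \in S :&: O by rewrite memO.
have [conSO|[P [Q [[EPQ cP cQ c1P c2Q] [c1Q c2P Pcl Qcl]]]]] :=
    connected_in_or sym c1SO c2SO (S_mid_closed cr).
  have lt := count _ conSO (subxx _) c1SO c2SO.
  have small a A b a' A' b' : crossing a A b a' A' b' S -> a \in S -> a' \in S ->
      #|S :&: A| < #|D :&: A| -> #|D :&: A'| < #|S :&: A'|.
    move=> cr' aS a'S lt1; have rc' := crossing_sym cr'.
    have [bS /(_ aS) b'S] := few_b2 cr' lt1.
    have b'A := cr_b2 cr'; have b'SA : b' \in S :&: A' by rewrite inE b'S.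
    case: (posnP #|D :&: A'|) => [->|t2]; first by rewrite card_gt0; apply/set0Pn; exists b'.
    apply: leq_ltn_trans (cr_le2 cr') _; rewrite ltnNge; apply/negP=> le1.
    have E : [set b'] = S.
      apply: (S_closed rc'); rewrite ?sub1set // -?card_gt0 ?cards1 // => x y.
      rewrite !inE => /eqP -> yS /(b1_nbr rc')[yb|]; first by rewrite -yb yS in bS.
      rewrite !inE => /andP[/orP[/eqP ->|yA] ey].
        by rewrite sym in ey; rewrite (negbTE (cr_nb2 cr' t2)) in ey.
      by apply/eqP; have /card_le1_eqP := le1; apply=> //; rewrite inE yS.
    by move: aS; rewrite -E inE => /eqP E'; have := cr_c1C2 cr'; rewrite E' b'A.
  have [lt1|ge1] := ltnP #|S :&: C1| #|D :&: C1|.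
    have lt2 := small _ _ _ _ _ _ cr c1S c2S lt1.
    have := cr_le1 cr; move: lt lt1 lt2; clear; lia.
  have [lt2|ge2] := ltnP #|S :&: C2| #|D :&: C2|.
    have lt1 := small _ _ _ _ _ _ rc c2S c1S lt2.
    have := cr_le2 cr; move: lt lt1 lt2; clear; lia.
  by move: lt ge1 ge2; clear; lia.
have sP : P \subset S :&: O by rewrite EPQ subsetUl.
have sQ : Q \subset S :&: O by rewrite EPQ subsetUr.
have c2z : c2 \notin P :|: C1 by rewrite in_setU negb_or c2P (cr_c2C1 cr).
have /andP[b1S b2S] := sep_cross cr sP c1P c2P Pcl c2S c2z.
have big1 := sep_big cr sP c1P c2P Pcl b1S.
have big2 : #|D :&: C2| < #|S :&: C2| by apply: (sep_big rc (P := Q)); rewrite ?OE.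
have sPO : P \subset O := subset_trans sP (subsetIr _ _).
have sQO : Q \subset O := subset_trans sQ (subsetIr _ _).
have [|x [y cM]] := connected_in_two_links sym (mid_connected cr con) cP cQ sPO sQO.
  move=> x xO; rewrite -EPQ memO // => xS; have [y yS] := S_dom cr xS.
  rewrite (mid_edge cr) // => exy; exists y => //.
  case: (mid_nbr cr xO exy) => [ym|[_ E]|[_ E]]; first by rewrite memO.
    by rewrite E c1S in xS.
  by rewrite E c2S in xS.
rewrite -EPQ in cM.
have := count _ cM; rewrite !in_setU1 c1SO c2SO !orbT setUA subsetUr => /(_ isT isT isT).
have := cardsU1 x (y |: (S :&: O)); have := cardsU1 y (S :&: O).
have := leq_b1 (x \notin y |: S :&: O); have := leq_b1 (y \notin S :&: O).
rewrite setUA; move: big1 big2; clear; lia.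
Qed.

Lemma crossing_none c1 C1 b1 c2 C2 b2 S : crossing c1 C1 b1 c2 C2 b2 S ->
  c1 \notin S -> c2 \notin S -> False.
Proof.
move=> cr c1S c2S; have rc := crossing_sym cr.
have count := crossing_count cr; have cO := mid_connected cr con.
have c1O := c1_mid cr; have c2O := c2_mid cr.
have SO0 : S :&: middle C1 C2 = set0.
  apply/eqP/negPn/negP=> SO0; have : closed_within e (S :&: middle C1 C2) (S :&: middle C1 C2) by [].
  by move/(S_mid_closed cr (subxx _) SO0); rewrite !in_setI (negbTE c1S) (negbTE c2S).
have notO x : x \in S -> x \notin middle C1 C2.
  by move=> xS; apply/negP=> xO; have /setP/(_ x) := SO0; rewrite in_setI xS xO inE.
have OE x : x \in middle C1 C2 -> (x == c1) || (x == c2).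
  move=> xO; have xS : x \notin S by apply: contraL xO => /notO.
  have [y yS] := S_dom cr xS; rewrite (mid_edge cr) // => exy.
  case: (mid_nbr cr xO exy) => [ym|[_ ->]|[_ ->]]; rewrite ?eqxx ?orbT //.
  by rewrite (negbTE (notO _ yS)) in ym.
have nbr a A b a' A' b' : crossing a A b a' A' b' S -> S :&: middle A A' = set0 ->
    a \notin S -> exists y, [/\ y \in S, y \in A & e a y].
  move=> cr' SO0' aS; have aO := c1_mid cr'.
  have [y yS] := S_dom cr' aS; rewrite (mid_edge cr') // => exy.
  exists y; split=> //; case: (mid_nbr cr' aO exy) => [ym|[//]|[_ E]].
    by have /setP/(_ y) := SO0'; rewrite in_setI yS ym inE.
  by have := cr_neq cr'; rewrite E eqxx.
have big a A b a' A' b' : crossing a A b a' A' b' S -> S :&: middle A A' = set0 ->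
    a \notin S -> (exists2 z, z \in S & z \in A') -> #|D :&: A| < #|S :&: A|.
  move=> cr' SO0' aS [z zS zA']; have [y [yS yA eay]] := nbr _ _ _ _ _ _ cr' SO0' aS.
  case: (posnP #|D :&: A|) => [->|t1].
    by rewrite card_gt0; apply/set0Pn; exists y; rewrite inE yS.
  apply: leq_ltn_trans (cr_le1 cr') _; apply/card_gt1P; exists y, b.
  split; [by rewrite inE yS| |by apply: contraTneq eay => ->; apply: (cr_nb1 cr')].
  rewrite inE (cr_b1 cr') andbT; apply/negPn/negP=> bS.
  have E : S :&: A = S.
    apply: (S_closed cr'); first exact: subsetIl.
      by apply/set0Pn; exists y; rewrite inE yS.
    move=> x x'; rewrite !inE => /andP[xS xA] x'S; rewrite x'S.
    have xb : x != b by apply: contraNneq bS => <-.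
    move/(C1_nbr cr' xA xb)=> [+ _]; rewrite !inE => /orP[/eqP Ea|//].
    by rewrite -Ea x'S in aS.
  have := zS; rewrite -E inE => /andP[_ zA]; have := cr_C1C2 cr' zA.
  by rewrite zA'.
have SO0' : S :&: middle C2 C1 = set0 by rewrite middleC.
have [y1 [y1S y1C _]] := nbr _ _ _ _ _ _ cr SO0 c1S.
have [y2 [y2S y2C _]] := nbr _ _ _ _ _ _ rc SO0' c2S.
have big1 : #|D :&: C1| < #|S :&: C1| by apply: big cr SO0 c1S _; exists y2.
have big2 : #|D :&: C2| < #|S :&: C2| by apply: big rc SO0' c2S _; exists y1.
have := count _ cO (subsetIr _ _) c1O c2O; rewrite SO0 cards0.
have /subset_leq_card : middle C1 C2 \subset [set c1; c2].
  by apply/subsetP=> x /OE; rewrite !inE.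
have : #|[set c1; c2]| <= 2 by rewrite cards2; case: (_ != _).
move: big1 big2; clear; lia.
Qed.

Lemma no_small_sides c1 C1 c2 C2 : side e c1 C1 -> side e c2 C2 ->
  (forall x, x \in c1 |: C1 -> x \notin c2 |: C2) ->
  #|D :&: C1| <= 1 -> #|D :&: C2| <= 1 -> False.
Proof.
move=> sd1 sd2 dis le1 le2.
have [b1 b1C nb1] := small_side sd1 le1; have [b2 b2C nb2] := small_side sd2 le2.
have b12 : b1 != b2.
  by apply: contraTneq b2C => <-; have := dis b1; rewrite !inE b1C orbT negb_or => /(_ isT)/andP[].
have nb12 : ~~ e b1 b2.
  apply/negP=> eb; have [_ _ _ out] := sd1; have := dis c1; rewrite !inE eqxx negb_or => /(_ isT)/andP[_].
  rewrite -(out b1 b2 b1C _ eb) ?b2C //; apply/negP=> b2C1.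
  by have := dis b2; rewrite !inE b2C1 b2C !orbT => /(_ isT).
have [S cds lt] := critical_add crit b12 nb12.
have cr : crossing c1 C1 b1 c2 C2 b2 S by [].
have rc := crossing_sym cr.
have [c1S|c1S] := boolP (c1 \in S).
  exact: crossing_both cr c1S (crossing_one cr c1S).
apply: (crossing_none cr c1S); apply: contra c1S; exact: crossing_one rc.
Qed.

End TwoSides.

(** * Graphs with few vertices of D outside of Z *)

Section Chain.

Variables (T : finType) (e : rel T) (k : nat) (D : {set T}).
Hypothesis sym : symmetric e.
Hypothesis irr : irreflexive e.
Hypothesis crit : gamma_c_critical k e.
Hypothesis cdsD : cds_on e [set: T] D.
Hypothesis cardD : #|D| = k.
Implicit Types (C P L S W : {set T}) (x y z c d : T).

Let con : connected_graph e. Proof. by case: crit. Qed.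

Let Z := [set v | cut_vertex e v].

Lemma cutP z : reflect (exists P, side e z P) (z \in Z).
Proof. by rewrite inE; apply: cut_vertexP. Qed.

Lemma side_cut z P : side e z P -> z \in Z.
Proof. by move=> sd; apply/cutP; exists P. Qed.

Lemma avoiding_side c z : z \in Z -> c != z -> exists2 P, side e z P & c \notin P.
Proof.
move=> /cutP[P sd] cz; have [cP|cP] := boolP (c \in P); last by exists P.
by exists (~: (z |: P)); [apply: side_compl|rewrite !inE cP orbT].
Qed.

Lemma side_sub c C z P : side e c C -> z \in C -> side e z P -> c \notin P -> P \subset C.
Proof.
move=> [cC _ _ out] zC sdP cP.
have cP' := side_connected sym crit cdsD cardD sdP.
rewrite -setD_eq0; apply/negPn/negP=> Q0.
have E : P :\: C = P.
  apply: (connected_in_closed cP') => //; first exact: subsetDl.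
  move=> x y; rewrite !inE => /andP[xC xP] yP exy; rewrite yP andbT.
  apply/negP=> yC; case/negP: cP; rewrite -(out y x yC xC) ?xP // sym //.
have [y yP ezy] := side_nbr sym con sdP.
have yC : y \notin C by move: yP; rewrite -E inE => /andP[].
by move: cP; rewrite -(out z y zC yC ezy) yP.
Qed.

Lemma side_mem' z P : side e z P -> z \notin P.
Proof. by case. Qed.

Lemma leaf_in c C : side e c C -> exists d L, [/\ side e d L, L \subset C, d \in c |: C &
  forall z, z \in L -> z \notin Z].
Proof.
have [n] := ubnP #|C|; elim: n c C => // n IH c C le sd; have [cC _ _ _] := sd.
have [/exists_inP[z zC zZ]|/exists_inPn no] := boolP [exists z in C, z \in Z]; last first.
  by exists c, C; split; rewrite ?subxx ?setU11.
have cz : c != z by apply: contraNneq cC => ->.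
have [P sdP cP] := avoiding_side zZ cz.
have sPC := side_sub sd zC sdP cP; have zP := side_mem' sdP.
have ltP : #|P| < #|C|.
  by apply/proper_card/properP; split=> //; exists z.
have [|d [L [sdL sLP dP noZ]]] := IH z P _ sdP; first exact: leq_trans ltP _.
exists d, L; split=> //; first exact: subset_trans sLP sPC.
by move: dP; rewrite !inE => /orP[/eqP ->|/(subsetP sPC) ->]; rewrite ?zC orbT.
Qed.

Let F := D :\: Z.

Lemma two_sides c1 C1 c2 C2 : side e c1 C1 -> side e c2 C2 ->
  (forall x, x \in c1 |: C1 -> x \notin c2 |: C2) -> (1 < #|F :&: C1|) || (1 < #|F :&: C2|).
Proof.
move=> sd1 sd2 dis.
have [d1 [L1 [sdL1 sL1 d1C no1]]] := leaf_in sd1.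
have [d2 [L2 [sdL2 sL2 d2C no2]]] := leaf_in sd2.
have big L C : L \subset C -> (forall z, z \in L -> z \notin Z) -> 1 < #|D :&: L| -> 1 < #|F :&: C|.
  move=> sL no /leq_trans; apply; apply/subset_leq_card/subsetP=> x; rewrite !in_setI in_setD.
  by case/andP=> -> xL; rewrite (no _ xL) (subsetP sL).
have [le1|/(big _ _ sL1 no1) -> //] := leqP #|D :&: L1| 1.
have [le2|/(big _ _ sL2 no2) ->] := leqP #|D :&: L2| 1; last by rewrite orbT.
case: (no_small_sides sym crit cdsD cardD sdL1 sdL2 _ le1 le2) => x.
have sub d L c C : L \subset C -> d \in c |: C -> x \in d |: L -> x \in c |: C.
  by move=> sL dC; rewrite !inE => /orP[/eqP ->|/(subsetP sL) ->]; rewrite ?orbT // -in_setU1.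
move=> /(sub _ _ _ _ sL1 d1C)/dis; apply: contra; exact: sub.
Qed.

Lemma Z_sub S : cds_on e [set: T] S -> Z \subset S.
Proof. by move=> cds; apply/subsetP=> z /cutP[P sd]; exact: (side_mem sym sd cds). Qed.

Section Between.

Variables (c z : T) (C P : {set T}).
Hypothesis sdC : side e c C.
Hypothesis zC : z \in C.
Hypothesis sdP : side e z P.
Hypothesis cP : c \notin P.
Let W := C :\: (z |: P).
Hypothesis noW : forall x, x \in W -> x \notin Z.
Hypothesis leW : #|D :&: W| <= 1.

Let cC : c \notin C. Proof. by case: sdC. Qed.
Let zP : z \notin P. Proof. by case: sdP. Qed.
Let sPC : P \subset C. Proof. exact: side_sub sdC zC sdP cP. Qed.
Let WE x : (x \in W) = [&& x \in C, x != z & x \notin P].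
Proof. by rewrite !inE negb_or andbC. Qed.
Let cz : c != z. Proof. by apply: contraNneq cC => ->. Qed.

Let inB x := [|| x == c, x == z | x \in W].

Let inB_C x : inB x -> x \in c |: C.
Proof. by rewrite /inB !inE => /or3P[->|/eqP ->|/andP[_ ->]]; rewrite ?zC ?orbT. Qed.

Let inB_P x : inB x -> x \notin P.
Proof. by case/or3P=> [/eqP ->|/eqP ->|]; rewrite // WE => /and3P[]. Qed.

Let card_C S : z \in S -> #|S :&: C| = (#|S :&: W| + #|S :&: P|).+1.
Proof.
move=> zS; rewrite -(cardsID P (S :&: C)) addnC.
have -> : S :&: C :&: P = S :&: P by rewrite -setIA (setIidPr sPC).
rewrite -addSn; congr (_ + _); rewrite (cardsD1 z) !inE zP zS zC add1n; congr _.+1.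
by apply: eq_card => x; rewrite in_setI WE !inE; do !case: (_ \in _); case: eqP.
Qed.

Let pair_cds u v : inB u -> inB v -> u != v -> ~~ e u v ->
  exists S, [/\ c \in S, z \in S, cds_on (add_edge e u v) [set: T] S &
    #|S :&: W| < #|D :&: W|].
Proof.
move=> uB vB uv nuv; have [S cds ltS] := critical_add crit uv nuv.
have sym' := add_edge_sym u v sym.
have cS := side_mem sym' (side_add (inB_C uB) (inB_C vB) sdC) cds.
have zS := side_mem sym' (side_add_out (inB_P uB) (inB_P vB) sdP) cds.
have cD := side_mem sym sdC cdsD; have zD := side_mem sym sdP cdsD.
exists S; split=> //.
have notC x : inB x -> x \notin ~: (c |: C) by move/inB_C; rewrite in_setC negbK.
have le1 := side_add_min sym crit cdsD cardD (side_compl sym sdC) uv (notC _ uB) (notC _ vB) cds.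
have le2 := side_add_min sym crit cdsD cardD sdP uv (inB_P uB) (inB_P vB) cds.
move: ltS; rewrite -cardD (card_side cC cS) (card_side cC cD) (card_C zS) (card_C zD).
by move: le1 le2; clear; lia.
Qed.

Let between_S u v S : inB u -> inB v -> c \in S -> z \in S ->
  cds_on (add_edge e u v) [set: T] S -> #|S :&: W| = 0 ->
  add_edge e u v c z /\ forall x, x \in W -> add_edge e u v x c || add_edge e u v x z.
Proof.
move=> uB vB cS zS cds /eqP; rewrite cards_eq0 => /eqP S0.
have notW x : x \in S -> x \notin W.
  by move=> xS; apply/negP=> xW; have /setP/(_ x) := S0; rewrite in_setI xS xW inE.
have sym' := add_edge_sym u v sym.
have sdC' := side_add (inB_C uB) (inB_C vB) sdC.
have sdP' := side_add_out (inB_P uB) (inB_P vB) sdP.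
have [_ _ _ outP] := sdP'; have [_ _ _ outC] := sdC'; have [_ conS domS] := cds.
split.
  have [||x [y []]] := connected_in_edge conS (subsetDl S C).
  - by apply/set0Pn; exists c; rewrite inE cC.
  - by apply/eqP=> /setP/(_ z); rewrite inE zS zC.
  rewrite !inE => /andP[xC xS] /andP[+ yS]; rewrite yS andbT negbK => yC.
  rewrite sym' => exy; rewrite -(outC y x yC xC exy).
  have [<-|yz] := eqVneq y z; first by rewrite sym'.
  have yP : y \in P by have := notW y yS; rewrite WE yC yz /= negbK.
  have xP : x \notin P by apply: contra xC; apply: (subsetP sPC).
  by rewrite (outP y x yP xP exy) zC in xC.
move=> x xW; have xS : x \notin S by apply: contraL xW => /notW.
have := xW; rewrite WE => /and3P[xC xz xP].
have [//|y yS exy] := domS x _ xS.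
have [yC|yC] := boolP (y \in C); last by rewrite -(outC x y xC yC exy) exy.
have [<-|yz] := eqVneq y z; first by rewrite exy orbT.
have yP : y \in P by have := notW y yS; rewrite WE yC yz /= negbK.
by move: xz; rewrite (outP y x yP xP) ?eqxx // sym'.
Qed.

Let pair_S u v : inB u -> inB v -> u != v -> ~~ e u v -> 0 < #|D :&: W| /\
  (add_edge e u v c z /\ forall x, x \in W -> add_edge e u v x c || add_edge e u v x z).
Proof.
move=> uB vB uv nuv; have [S [cS zS cds lt]] := pair_cds uB vB uv nuv.
split; first exact: leq_ltn_trans lt.
apply: (between_S uB vB cS zS cds); apply/eqP.
by rewrite -leqn0 -ltnS (leq_trans lt leW).
Qed.

Let cB : inB c. Proof. by rewrite /inB eqxx. Qed.
Let zB : inB z. Proof. by rewrite /inB eqxx orbT. Qed.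
Let WB x : x \in W -> inB x. Proof. by rewrite /inB => ->; rewrite !orbT. Qed.

Let cW : c \notin W. Proof. by rewrite WE (negbTE cC). Qed.

Let between_walk := exists s y, [/\ walk e c s y, e y z & perm_eq s (enum (c |: W))].

Let clique_between : (W != set0) || e c z ->
  {in c |: W &, forall u v, u != v -> e u v} -> {in W, forall w, e w z} -> between_walk.
Proof.
move=> W0 cl ez; have [WE0|] := eqVneq W set0.
  exists [:: c], c; split; first exact: walk1; first by move: W0; rewrite WE0 eqxx.
  rewrite WE0 setU0; apply: uniq_perm; rewrite ?enum_uniq // => x.
  by rewrite mem_enum !inE.
case/set0Pn=> w wW.
have cw : c != w by apply: contraNneq cW => ->.
have mem x : (x \in c :: enum (W :\ w)) = (x \in c |: W) && (x != w).
  rewrite inE mem_enum !inE; case: eqVneq => [->|_] /=; first by rewrite cw.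
  by rewrite andbC.
have u : uniq (c :: enum (W :\ w)).
  by rewrite /= enum_uniq mem_enum in_setD1 (negbTE cW) andbF.
have wcW : w \in c |: W by rewrite in_setU1 wW orbT.
exists (c :: enum (W :\ w) ++ [:: w]), w; split; last 2 first.
- exact: ez.
- apply: uniq_perm; last 2 [exact: enum_uniq].
    by rewrite -cat_cons cat_uniq u /= orbF andbT mem eqxx andbF.
  move=> x; rewrite -cat_cons mem_cat mem mem_enum [x \in [:: w]]inE.
  by case: eqVneq => [->|_]; rewrite ?wcW ?orbT ?orbF ?andbT.
apply: (clique_walk _ u _ (walk1 e w)).
  by move=> a b; rewrite !mem => /andP[aW _] /andP[bW _]; apply: cl.
by move=> a; rewrite mem => /andP[aW aw]; apply: cl.
Qed.

Lemma between : between_walk.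
Proof.
have [ecz|ncz] := boolP (e c z); last first.
  have [Wpos _] := pair_S cB zB cz ncz.
  have all u v : inB u -> inB v -> u != v -> (u, v) != (c, z) -> (u, v) != (z, c) -> e u v.
    move=> uB vB uv n1 n2; apply/negPn/negP=> nuv.
    have [_ [/or3P[] + _]] := pair_S uB vB uv nuv; first by rewrite (negbTE ncz).
      by case/andP=> /eqP E1 /eqP E2; rewrite E1 E2 eqxx in n1.
    by case/andP=> /eqP E1 /eqP E2; rewrite E1 E2 eqxx in n2.
  have Wz w : w \in W -> w != z by rewrite WE => /and3P[].
  have Wc w : w \in W -> w != c by move=> wW; apply: contraNneq cW => <-.
  apply: clique_between.
  - apply/orP; left; apply: contraTneq Wpos => ->; by rewrite setI0 cards0.
  - move=> u v; rewrite !in_setU1 => uW vW uv; apply: all => //.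
    + by case/orP: uW => [/eqP ->|/WB].
    + by case/orP: vW => [/eqP ->|/WB].
    + rewrite xpair_eqE negb_and; apply/orP; right.
      by case/orP: vW => [/eqP ->|/Wz].
    + rewrite xpair_eqE negb_and; apply/orP; left.
      by case/orP: uW => [/eqP ->|/Wz].
  - move=> w wW; have [wz wc] := (Wz w wW, Wc w wW).
    by apply: (all _ _ (WB wW) zB wz); rewrite xpair_eqE negb_and ?wc ?wz.
have [/exists_inP[r rW /andP[ncr nzr]]|/exists_inPn no] :=
    boolP [exists r in W, ~~ e c r && ~~ e z r]; last first.
  have all u v : inB u -> inB v -> u != v -> e u v.
    move=> uB vB uv; apply/negPn/negP=> nuv; have [Wpos _] := pair_S uB vB uv nuv.
    pose E := [set c; z] :|: D :&: (z |: P).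
    have zD := side_mem sym sdP cdsD.
    have cds1 : cds_on e (c |: (z |: W)) [set c; z].
      split.
      - by apply/subsetP=> x; rewrite !in_setU1 !inE => /orP[] /eqP ->; rewrite !eqxx ?orbT.
      - apply: (connected_in_add sym (y := z)); rewrite ?inE //; exact: connected_in1.
      - move=> x; rewrite !in_setU1 in_set1 => /or3P[->//|->|xW _]; first by rewrite orbT.
        have := no x xW; rewrite negb_and !negbK => /orP[ec|ez].
          by exists c; rewrite ?inE ?eqxx // sym.
        by exists z; rewrite ?inE ?eqxx ?orbT // sym.
    have cdsE : cds_on e (c |: C) E.
      have -> : c |: C = (c |: (z |: W)) :|: (z |: P).
        apply/setP=> x; rewrite !in_setU !in_set1 WE; case: eqP => //= _; case: eqP => [->|_] //=.
        by case: (boolP (x \in P)) => [/(subsetP sPC) ->|]; rewrite ?andbT ?orbT ?orbF.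
      apply: (cds_onU sym (c := z) _ _ cds1 (side_restrict sym sdP cdsD)).
        by rewrite !inE eqxx orbT.
      by rewrite !inE zD eqxx.
    have cE : c \in E by rewrite !inE eqxx.
    have zE : z \in E by rewrite !inE eqxx orbT.
    have := side_min sym crit cdsD cardD sdC cE cdsE; rewrite (card_C zD) (card_C zE).
    have -> : E :&: W = set0.
      apply/setP=> x; rewrite inE [x \in W]WE !inE; case: eqP => [->|_]; first by rewrite (negbTE cC) andbF.
      by case: eqP => [|_]; rewrite ?andbF //=; case: (x \in P); rewrite ?andbF.
    have /subset_leq_card : E :&: P \subset D :&: P.
      apply/subsetP=> x; rewrite !inE; case: eqP => [->|_]; first by rewrite (negbTE cP).
      by case: eqP => [->|_]; [rewrite (negbTE zP)|case/andP=> /andP[-> _] ->].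
    by rewrite cards0; move: Wpos; clear; lia.
  apply: clique_between; first by rewrite ecz orbT.
    move=> u v; rewrite !in_setU1 => uW vW; apply: all.
      by case/orP: uW => [/eqP ->|/WB].
    by case/orP: vW => [/eqP ->|/WB].
  by move=> w wW; apply: (all _ _ (WB wW) zB); move: wW; rewrite WE => /and3P[].
have rc : r != c by apply: contraNneq cW => <-.
have [rC rz rP] : [/\ r \in C, r != z & r \notin P] by move: rW; rewrite WE => /and3P.
have all u v : inB u -> inB v -> u != v -> u != r -> v != r -> e u v.
  move=> uB vB uv ur vr; apply/negPn/negP=> nuv.
  have [_ [_ /(_ r rW)]] := pair_S uB vB uv nuv.
  rewrite !add_edge_neq ?(eq_sym r) // sym (negbTE ncr) sym (negbTE nzr) //.
have allr w : w \in W -> w != r -> e r w.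
  move=> wW wr; apply/negPn/negP=> nrw; rewrite eq_sym in wr.
  have wc : c != w by apply: contraNneq cW => ->.
  have wz : z != w by apply: contraTneq wW => <-; rewrite WE eqxx andbF.
  have [_ [_ /(_ r rW)]] := pair_S (WB rW) (WB wW) wr nrw.
  by rewrite /add_edge /= !(sym r) (negbTE ncr) (negbTE nzr) eqxx (negbTE wr) (negbTE wc) (negbTE wz).
have nbr y : e r y -> (y \in W) && (y != r).
  move=> ery; rewrite WE; have -> : y != r by apply: contraTneq ery => ->; rewrite irr.
  have yc : y != c by apply: contraNneq ncr => <-; rewrite sym.
  have yz : y != z by apply: contraNneq nzr => <-; rewrite sym.
  have [_ _ _ outC] := sdC; have [_ _ _ outP] := sdP.
  have yC : y \in C by apply: contraNT yc => yC; apply/eqP; apply: outC ery.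
  rewrite yC yz andbT /=; apply: contraNN rz => yP; apply/eqP.
  by apply: outP yP rP _; rewrite sym.
have /card_gt1P[w1 [w2 []]] : 1 < #|W :\ r|.
  rewrite ltnNge; apply/negP=> /card_le1_eqP le1.
  have [|w [_ wr erw]] := connected_in_nbr con (in_setT r) (in_setT c); first by rewrite eq_sym.
  have /andP[wW _] := nbr w erw.
  have /negP := noW wW; apply; apply: (@side_cut w [set r]); split.
  - by rewrite inE.
  - by rewrite -card_gt0 cards1.
  - exists c; first by rewrite inE eq_sym.
    by apply: contraNneq cW => ->.
  - move=> x y; rewrite !inE => /eqP -> yr /nbr/andP[yW _].
    by apply: le1; rewrite in_setD1 ?yr ?yW ?wr ?wW.
rewrite !in_setD1 => /andP[w1r w1W] /andP[w2r w2W] w12.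
have cw1 : c != w1 by apply: contraNneq cW => ->.
have cw2 : c != w2 by apply: contraNneq cW => ->.
pose L := W :\ r :\ w1 :\ w2.
have LE x : (x \in L) = [&& x != w2, x != w1, x != r & x \in W].
  by rewrite !in_setD1.
have mem x : (x \in r :: enum L) = [&& x \in W, x != w1 & x != w2].
  rewrite in_cons mem_enum LE; case: eqVneq => [->|_]; last first.
    by case: (x \in W); rewrite /= ?andbF ?andbT // andbC.
  by rewrite /= rW (eq_sym r) w1r (eq_sym r) w2r.
exists (c :: w1 :: (r :: enum L ++ [:: w2])), w2; split.
- apply: (walk_cons (_ : e c w1)); first by apply: (all _ _ cB (WB w1W)); rewrite // eq_sym.
  apply: (walk_cons (_ : e w1 r)); first by rewrite sym; apply: allr.
  apply: (clique_walk _ _ _ (walk1 e w2)).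
  + move=> a b; rewrite !mem => /and3P[aW _ _] /and3P[bW _ _] ab.
    have [Ea|ar] := eqVneq a r; first by rewrite Ea in ab *; apply: allr; rewrite // eq_sym.
    have [Eb|br] := eqVneq b r; first by rewrite Eb sym; apply: allr.
    by apply: all; rewrite ?WB.
  + by rewrite /= enum_uniq mem_enum LE eqxx !andbF.
  + move=> a; rewrite mem => /and3P[aW _ aw].
    have [->|ar] := eqVneq a r; first exact: allr.
    by apply: all; rewrite ?WB.
- by apply: (all _ _ (WB w2W) zB _ w2r); [move: w2W; rewrite WE => /and3P[]|rewrite eq_sym].
- have memM x : (x \in (r :: enum L) ++ [:: w2]) = (x \in W) && (x != w1).
    rewrite mem_cat mem mem_seq1; case: (eqVneq x w2) => [->|_]; last by rewrite orbF andbT.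
    by rewrite w2W eq_sym w12 orbT.
  have uL : uniq (r :: enum L) by rewrite cons_uniq enum_uniq mem_enum LE eqxx !andbF.
  rewrite -cat_cons; apply: uniq_perm; last 2 [exact: enum_uniq].
    rewrite 2!cons_uniq memM in_cons memM eqxx andbF (negbTE cW) orbF cw1 cat_uniq uL.
    by rewrite has_seq1 mem eqxx !andbF.
  move=> x; rewrite 2!in_cons memM mem_enum in_setU1.
  case: eqVneq => //= _; case: eqVneq => [->|_]; first by rewrite w1W.
  by rewrite andbT.
Qed.

End Between.

Definition sideb c P := [&& c \notin P, P != set0, [exists w, (w \notin P) && (w != c)] &
  [forall x in P, forall y, (y \notin P) ==> e x y ==> (y == c)]].

Lemma sideP c P : reflect (side e c P) (sideb c P).
Proof.
apply: (iffP and4P) => [[cP P0 /existsP[w /andP[wP wc]] /forall_inP out]|[cP P0 [w wP wc] out]].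
  split=> //; first by exists w.
  by move=> x y xP yP exy; have /forallP/(_ y) := out x xP; rewrite yP exy => /eqP.
split=> //; first by apply/existsP; exists w; rewrite wP.
by apply/forall_inP=> x xP; apply/forallP=> y; apply/implyP=> yP; apply/implyP=> exy; apply/eqP/(out x).
Qed.

Lemma side_disjoint z P x Q : side e z P -> side e x Q -> z \notin Q -> x \notin P -> x != z ->
  forall y, y \in P -> y \notin Q.
Proof.
move=> [zP _ _ outP] sdQ zQ xP xz y yP; apply/negP=> yQ.
have conQ := side_connected sym crit cdsD cardD sdQ.
have E : Q :&: P = Q.
  apply: (connected_in_closed conQ (subsetIl _ _)); first by apply/set0Pn; exists y; rewrite inE yQ.
  move=> a b; rewrite !inE => /andP[aQ aP] bQ eab; rewrite bQ; apply: contraNT zQ => bP.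
  by rewrite -(outP a b aP bP eab).
have [q qQ exq] := side_nbr sym con sdQ.
have qP : q \in P by move: qQ; rewrite -E inE => /andP[].
by move: xz; rewrite (outP q x qP xP) ?eqxx // sym.
Qed.

Lemma card_disjoint3 (G A B C : {set T}) : (forall x, x \in A -> x \notin B) ->
  (forall x, x \in A -> x \notin C) -> (forall x, x \in B -> x \notin C) ->
  #|G :&: A| + #|G :&: B| + #|G :&: C| <= #|G|.
Proof.
move=> AB AC BC; rewrite -(cardsID A G) -addnA leq_add2l -(cardsID B (G :\: A)).
apply: leq_add; apply/subset_leq_card/subsetP=> x; rewrite !inE => /andP[-> xX]; rewrite ?xX /= ?andbT.
  by apply: contraL xX => /AB.
by apply/andP; split; apply: contraL xX; [apply: BC|apply: AC].
Qed.

Hypothesis few : #|F| <= 3.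

Lemma chain c C : side e c C -> spanned e c (c |: C).
Proof.
have [n] := ubnP #|C|; elim: n c C => // n IH c C le sd; have [cC _ _ _] := sd.
have [/exists_inP[z0 z0C z0Z]|/exists_inPn no] := boolP [exists z in C, z \in Z]; last first.
  apply: (leaf_span sym irr crit cdsD cardD sd).
    by move=> z P zC sdz; have := no z zC; rewrite (side_cut sdz).
  apply: leq_trans few; apply/subset_leq_card/subsetP=> x; rewrite !in_setI in_setD.
  by case/andP=> -> xC; rewrite no.
have cz0 : c != z0 by apply: contraNneq cC => ->.
have [P0 sdP0 cP0] := avoiding_side z0Z cz0.
pose ok p := [&& p.1 \in C, sideb p.1 p.2 & c \notin p.2].
have ok0 : ok (z0, P0) by rewrite /ok /= z0C cP0 andbT; apply/sideP.
case: (arg_maxnP (fun p : T * {set T} => #|p.2|) ok0) => -[z P] /= /and3P[/= zC /sideP sdP cP] max.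
have sPC := side_sub sd zC sdP cP; have [zP _ _ _] := sdP.
have sdC := side_compl sym sd.
have cz : c != z by apply: contraNneq cC => ->.
have disP x : x \in z |: P -> x \notin c |: ~: (c |: C).
  by rewrite setC_side // in_setC negbK !inE => /orP[/eqP->|/(subsetP sPC)].
set W := C :\: (z |: P).
have WE x : (x \in W) = [&& x \in C, x != z & x \notin P].
  by rewrite !inE negb_or andbC.
have disPC x : x \in P -> x \notin ~: (c |: C).
  by move=> xP; have := disP x; rewrite !in_setU1 xP orbT negb_or => /(_ isT)/andP[].
have noW x : x \in W -> x \notin Z.
  move=> xW; apply/negP=> xZ; have := xW; rewrite WE => /and3P[xC xz xP].
  have cx : c != x by apply: contraNneq cC => ->.
  have [Q sdQ cQ] := avoiding_side xZ cx.
  have sQC := side_sub sd xC sdQ cQ.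
  have [zQ|zQ] := boolP (z \in Q).
    have sPQ := side_sub sdQ zQ sdP xP.
    have /max : ok (x, Q) by rewrite /ok /= xC cQ andbT; apply/sideP.
    rewrite /= leqNgt => /negP; apply; apply/proper_card/properP; split=> //.
    by exists z.
  have PQ := side_disjoint sdP sdQ zQ xP xz.
  have disQ y : y \in x |: Q -> y \notin c |: ~: (c |: C).
    by rewrite setC_side // in_setC negbK !inE => /orP[/eqP->|/(subsetP sQC)].
  have disPQ y : y \in z |: P -> y \notin x |: Q.
    rewrite !in_setU1 negb_or => /orP[/eqP->|yP]; first by rewrite eq_sym xz.
    by rewrite (PQ _ yP) andbT; apply: contraTneq yP => ->.
  have QC y : y \in Q -> y \notin ~: (c |: C).
    by move=> yQ; have := disQ y; rewrite !in_setU1 yQ orbT negb_or => /(_ isT)/andP[].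
  have := card_disjoint3 F PQ disPC QC.
  have := two_sides sdP sdQ disPQ; have := two_sides sdP sdC disP; have := two_sides sdQ sdC disQ.
  move: few; clear; lia.
have leW : #|D :&: W| <= 1.
  have PW x : x \in P -> x \notin W by rewrite WE => ->; rewrite !andbF.
  have WC x : x \in ~: (c |: C) -> x \notin W.
    by rewrite in_setC in_setU1 negb_or WE => /andP[_ /negbTE ->].
  have := card_disjoint3 F disPC PW WC; have := two_sides sdP sdC disP.
  have -> : F :&: W = D :&: W.
    apply/setP=> x; rewrite !in_setI in_setD; case: (boolP (x \in W)) => [xW|]; last by rewrite !andbF.
    by rewrite (noW _ xW).
  move: few; clear; lia.
have [s [y [ws eyz ps]]] := between sd zC sdP cP noW leW.
have [|s' [y' [ws' ps']]] := IH z P _ sdP.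
  apply: leq_trans (_ : _ <= #|C|) le; apply/proper_card/properP; split=> //; by exists z.
exists (s ++ s'), y'; split; first exact: walk_cat ws ws' eyz.
apply: uniq_perm; last 2 [exact: enum_uniq].
  rewrite cat_uniq (perm_uniq ps) (perm_uniq ps') !enum_uniq /= andbT; apply/hasPn=> x.
  rewrite (perm_mem ps) (perm_mem ps') !mem_enum in_setU1 => /orP[/eqP ->|xP].
    by rewrite in_setU1 eq_sym (negbTE cz) WE eqxx andbF.
  by rewrite in_setU1 WE xP !andbF orbF; apply: contraNneq cP => <-.
move=> x; rewrite mem_cat (perm_mem ps) (perm_mem ps') !mem_enum !in_setU1 WE.
case: eqP => //= _; case: eqVneq => [->|_] /=; first by rewrite orbT zC.
by case: (boolP (x \in P)) => [/(subsetP sPC) ->|]; rewrite ?orbT ?orbF ?andbT.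
Qed.

Lemma few_traceable : traceable e.
Proof.
have [Z0|/set0Pn[c /cutP[P sd]]] := eqVneq Z set0; last first.
  have [cP _ _ _] := sd.
  have [s1 [y1 [w1 p1]]] := chain sd; have [s2 [y2 [w2 p2]]] := chain (side_compl sym sd).
  rewrite setC_side // in p2; case: s2 w2 p2 => //= a s2 /and3P[/eqP -> pth /eqP l2] p2.
  exists (rev s1 ++ s2); split.
  - have := walk_rev sym w1; case: s2 pth l2 {p2} => [|b s2] /=.
      by move=> _ _ /walk_sorted; rewrite cats0.
    case/andP=> ecb pth l2 w; apply: (walk_sorted (walk_cat w (_ : walk e b (b :: s2) y2) ecb)).
    by rewrite /= eqxx pth l2 eqxx.
  - have : uniq (c :: s2) by rewrite (perm_uniq p2) enum_uniq.
    rewrite cons_uniq => /andP[cs2 u2]; rewrite cat_uniq rev_uniq (perm_uniq p1) enum_uniq u2 /= andbT.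
    apply/hasPn=> x xs2; rewrite mem_rev (perm_mem p1) mem_enum in_setU1 negb_or.
    rewrite (contraTneq _ xs2) => [|->//]; rewrite -in_setC -mem_enum -(perm_mem p2).
    by rewrite inE xs2 orbT.
  - move=> v; rewrite mem_cat mem_rev (perm_mem p1) mem_enum in_setU1.
    have [->//|vc] := eqVneq v c; case: (boolP (v \in P)) => //= vP.
    have : v \in c :: s2 by rewrite (perm_mem p2) mem_enum in_setC.
    by rewrite inE (negbTE vc).
have k3 : k <= 3 by move: few; rewrite /F Z0 setD0 cardD.
apply: (traceable_triples sym irr con) => [v P sd|u v w].
  by have := side_cut sd; rewrite Z0 inE.
suff H x y S : x != w -> x != y -> w != y -> ~~ e x w -> ~~ e y w ->
    cds_on (add_edge e x y) [set: T] S -> #|S| <= 2 -> ~ cds_on e [set: T] S -> x \in S -> arrow e x y.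
  move=> uv uw vw nuv nuw nvw; have [S cds ltS] := critical_add crit uv nuv.
  have S2 : #|S| <= 2 by rewrite -ltnS (leq_trans ltS).
  have ncds : ~ cds_on e [set: T] S by move/(critical_min crit); rewrite leqNgt ltS.
  have [uS|uS] := boolP (u \in S); first by rewrite (H u v S) // eq_sym.
  have [vS|vS] := boolP (v \in S); last by case: ncds; apply: cds_on_add_notin cds.
  rewrite orbC (H v u S) //; [by rewrite eq_sym|by rewrite eq_sym|].
  exact: cds_on_addC cds.
move=> xw xy wy nxw nyw cds S2 ncds xS; have [_ conS domS] := cds.
have sym' := add_edge_sym x y sym.
have wx : w != x by rewrite eq_sym.
have addw z : add_edge e x y w z = e w z by rewrite add_edge_neq.
have wS : w \notin S.
  apply/negP=> wS; have [b [bS bw]] := connected_in_nbr conS wS xS xw; rewrite addw => ewb.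
  have : [set w; x; b] \subset S.
    by apply/subsetP=> a; rewrite !inE => /orP[/orP[]|] /eqP ->.
  move/subset_leq_card; rewrite -setUA cardsU1 cards2 !inE negb_or wx eq_sym bw.
  have xb : x != b by apply: contraNneq nxw => ->; rewrite sym.
  by rewrite xb => /leq_trans/(_ S2).
have [//|z zS] := domS w _ wS; rewrite addw => ewz.
have zx : z != x by apply: contraNneq nxw => <-; rewrite sym.
have zy : z != y by apply: contraNneq nyw => <-; rewrite sym.
have inS a : a \in S -> (a == x) || (a == z).
  move=> aS; apply/negPn/negP; rewrite negb_or => /andP[ax az].
  have : [set a; x; z] \subset S.
    by apply/subsetP=> b; rewrite !inE => /orP[/orP[]|] /eqP ->.
  move/subset_leq_card; rewrite -setUA cardsU1 cards2 !inE negb_or ax az eq_sym zx.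
  by move=> /leq_trans/(_ S2).
have yS : y \notin S by apply/negP=> /inS; rewrite !(eq_sym y) (negbTE xy) (negbTE zy).
have exz : e x z.
  have [|b [bS bz]] := connected_in_nbr conS zS xS; first by rewrite eq_sym.
  rewrite add_edge_neq // => ezb.
  by case/orP: (inS _ bS) bz ezb => /eqP ->; rewrite ?eqxx // sym.
apply/existsP; exists z; rewrite /fork exz /=; apply/andP; split.
  apply/negP=> ezy; apply: ncds; apply: (cds_on_add_dominated yS cds zS).
  by rewrite sym.
apply/forallP=> a; apply/implyP=> ay.
have [aS|aS] := boolP (a \in S); first by case/orP: (inS _ aS) => ->; rewrite ?orbT.
have [//|b bS] := domS a _ aS; rewrite add_edge_neq2 //; last by apply: contraNneq yS => <-.
by case/orP: (inS _ bS) => /eqP -> eab; rewrite [e x a]sym [e z a]sym eab !orbT.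
Qed.

End Chain.

(** * Expanding a simplicial vertex *)

Section Criticality.

Variables (T : finType) (e : rel T).
Hypothesis sym : symmetric e.
Implicit Types (S P : {set T}) (u v x y z : T).

Lemma cds_connected S : cds_on e [set: T] S -> connected_graph e.
Proof.
move=> [_ cS dS]; have [/set0Pn[x0 x0S] _] := connected_inP _ _ cS.
apply: (connected_in_base (x0 := x0)) => // P _ /set0Pn[x xP] Pcl.
have [y yP yS] : exists2 y, y \in P & y \in S.
  have [xS|xS] := boolP (x \in S); first by exists x.
  by have [//|y yS exy] := dS x _ xS; exists y => //; apply: (Pcl x).
suff E : P :&: S = S by move: x0S; rewrite -E inE => /andP[].
apply: (connected_in_closed cS (subsetIr _ _)); first by apply/set0Pn; exists y; rewrite inE yP.
move=> a b; rewrite !inE => /andP[aP aS] bS eab; rewrite bS andbT; exact: (Pcl a).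
Qed.

Lemma critical_intro k S : cds_on e [set: T] S -> #|S| <= k ->
  (forall S', cds_on e [set: T] S' -> k <= #|S'|) ->
  (forall u v, u != v -> ~~ e u v ->
     exists2 S', cds_on (add_edge e u v) [set: T] S' & #|S'| < k) ->
  gamma_c_critical k e.
Proof.
move=> cds Sk min pairs; have con := cds_connected cds; split=> //.
  apply/eqP; rewrite eqn_leq (leq_trans (gamma_c_le con cds) Sk) /=.
  by have [S' cds' <-] := gamma_c_ex con; apply: min.
move=> u v uv nuv; have [S' cds' lt] := pairs u v uv nuv.
exact: leq_ltn_trans (gamma_c_le (add_edge_connected u v con) cds') lt.
Qed.

Definition simplicial x := forall u v, e x u -> e x v -> u != v -> e u v.

Lemma simplicial_not_cut x : connected_graph e -> simplicial x -> ~~ cut_vertex e x.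
Proof.
move=> con simp; apply/negP=> /(cut_vertexP _ sym con)[P sd].
have [a aP exa] := side_nbr sym con sd; have [b] := side_nbr sym con (side_compl sym sd).
rewrite !inE negb_or => /andP[bx bP] exb.
have ab : a != b by apply: contraNneq bP => <-.
have [_ _ _ out] := sd; have := out a b aP bP (simp a b exa exb ab).
by move/eqP; rewrite (negbTE bx).
Qed.

Lemma cds_simplicial x S : simplicial x -> cds_on e [set: T] S -> x \in S -> S != [set x] ->
  cds_on e [set: T] (S :\ x).
Proof.
move=> simp [_ cS dS] xS Sx.
have [y0 y0S y0x] : exists2 y, y \in S & y != x.
  have [|y yS] := subsetPn (_ : ~~ (S \subset [set x])); last by rewrite inE; exists y.
  by apply: contra Sx => sS; rewrite eqEsubset sS sub1set xS.
have [z [zS zx exz]] := connected_in_nbr cS xS y0S y0x.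
split; first exact: subsetT.
  apply: (connected_in_base (x0 := z)) => //; first by rewrite !inE zx.
  move=> P sP /set0Pn[p pP] Pcl; apply/negPn/negP=> zP.
  have inP a : a \in P -> a != x /\ a \in S by move/(subsetP sP); rewrite !inE => /andP.
  have nx a : a \in P -> ~~ e x a.
    move=> aP; apply: contra (zP) => exa; apply: (Pcl a) => //; first by rewrite !inE zx.
    by apply: simp => //; apply: contraNneq zP => <-.
  suff E : P = S by have := inP x; rewrite E xS eqxx => /(_ isT)[].
  apply: (connected_in_closed cS); first by apply/subsetP=> a /inP[].
    by apply/set0Pn; exists p.
  move=> a b aP bS eab; apply: (Pcl a) => //; rewrite !inE bS andbT.
  by apply: contraTneq eab => ->; rewrite sym nx.
move=> v _; rewrite !inE negb_and negbK => /orP[/eqP ->|vS]; first by exists z; rewrite // !inE zx.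
have vz : v != z by apply: contraNneq vS => ->.
have [//|y yS evy] := dS v _ vS.
have [yx|yx] := eqVneq y x; last by exists y; rewrite // !inE yx.
exists z; first by rewrite !inE zx.
by apply: simp => //; rewrite sym -yx.
Qed.

End Criticality.

Section Expansion.

Variables (T B : finType) (e : rel T) (x : T).
Implicit Types (u v : T) (y z : T + option B).

Definition collapse (y : T + option B) : T := if y is inl v then v else x.

Definition tip : T + option B := inr None.

(* x is replaced by the clique of its twins (x itself and the elements of B) and
   the tip, and the tip has no other neighbour. *)
Definition expand : rel (T + option B)%type := [rel y z | (y != z) &&
  ((collapse y == x) && (collapse z == x) ||
   [&& e (collapse y) (collapse z), y != tip & z != tip])].

Hypothesis sym : symmetric e.
Hypothesis irr : irreflexive e.

Lemma expand_sym : symmetric expand.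
Proof.
move=> y z; rewrite /expand /= eq_sym sym andbC [in RHS]andbC.
by rewrite [(collapse y == x) && _]andbC [(y != tip) && _]andbC.
Qed.

Lemma expand_irr : irreflexive expand.
Proof. by move=> y; rewrite /expand /= eqxx. Qed.

Lemma expand_inl u v : expand (inl u) (inl v) = e u v.
Proof.
rewrite /expand /= !andbT.
have -> : (inl u == inl v :> T + option B) = (u == v) by [].
have [->|uv] := eqVneq u v; first by rewrite irr.
have [E|ux] := eqVneq u x; last by [].
by rewrite -E [v == u]eq_sym (negbTE uv).
Qed.

Lemma expand_collapse y z : expand y z -> (collapse y == collapse z) || e (collapse y) (collapse z).
Proof.
by rewrite /expand /= => /andP[_ /orP[/andP[/eqP -> /eqP ->]|/and3P[->]]]; rewrite ?eqxx ?orbT.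
Qed.

Lemma expand_twins y z : collapse y = x -> collapse z = x -> y != z -> expand y z.
Proof. by move=> yx zx yz; rewrite /expand /= yz yx zx eqxx. Qed.

Lemma expand_tip y : expand tip y = (y != tip) && (collapse y == x).
Proof.
rewrite /expand /= eq_sym eqxx; case: eqP => //= _.
by rewrite andbF orbF.
Qed.

Lemma expand_lift y z : y != tip -> z != tip -> e (collapse y) (collapse z) -> expand y z.
Proof.
move=> yt zt eyz; rewrite /expand /= yt zt eyz !andbT orbT andbT.
by apply: contraTneq eyz => ->; rewrite irr.
Qed.

Hypothesis simp : simplicial e x.

Lemma expand_cds k (S : {set T + option B}) : 1 < k -> gamma_c_critical k e ->
  cds_on expand [set: _] S -> k < #|S|.
Proof.
move=> k1 crit cdsS; have [_ cS dS] := cdsS.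
have big (R : {set T}) : cds_on e [set: T] R -> k <= #|R| := critical_min crit.
have [v vx] : exists v, v != x.
  have [v vx|all] := pickP (predC1 x); first by exists v.
  suff /big : cds_on e [set: T] [set x] by rewrite cards1 leqNgt k1.
  split; [exact: subsetT|exact: connected_in1|].
  by move=> u _; rewrite inE; have /negbFE -> := all u.
have [a aS [ax at_]] : exists2 a, a \in S & collapse a = x /\ a != tip.
  have [tS|tS] := boolP (tip \in S); last first.
    have [//|y yS] := dS tip _ tS; rewrite expand_tip => /andP[yt /eqP yx].
    by exists y.
  have [y yS yt] : exists2 y, y \in S & y != tip.
    have [vS|vS] := boolP (inl v \in S); first by exists (inl v).
    have [//|y yS] := dS _ _ vS; have [->|yt] := eqVneq y tip; last by exists y.
    by rewrite expand_sym expand_tip /= (negbTE vx).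
  have [z [zS zt]] := connected_in_nbr cS tS yS yt.
  by rewrite expand_tip => /andP[_ /eqP zx]; exists z.
pose R := collapse @: S.
have xR : x \in R by rewrite -ax imset_f.
have cdsR : cds_on e [set: T] R.
  split; first exact: subsetT.
    by apply: connected_in_imset cS _ => // y z /expand_collapse/orP[/eqP|]; [left|right].
  move=> u _ uR; have uS : inl u \notin S.
    by apply: contra uR => uS; apply/imsetP; exists (inl u).
  have [//|y yS /expand_collapse/= /orP[/eqP E|euy]] := dS (inl u) _ uS.
    by rewrite E imset_f in uR.
  by exists (collapse y); first exact: imset_f.
have Rx : R != [set x].
  apply: contraTneq k1 => E; rewrite -leqNgt -(cards1 x) -E; exact: big.
have := big _ (cds_simplicial sym simp cdsR xR Rx).
move=> /leq_ltn_trans; apply; apply: leq_trans (leq_imset_card collapse (mem S)).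
by rewrite -/R (cardsD1 x R) xR.
Qed.

(* a section of collapse, choosing one of the twins *)
Section Lift.

Variable a : T + option B.
Hypothesis ax : collapse a = x.
Hypothesis a_tip : a != tip.

Definition lift v : T + option B := if v == x then a else inl v.

Lemma collapse_lift v : collapse (lift v) = v.
Proof. by rewrite /lift; case: eqP => // ->. Qed.

Lemma lift_tip v : lift v != tip.
Proof. by rewrite /lift; case: (eqVneq v x). Qed.

Lemma lift_inj : injective lift.
Proof. exact: can_inj collapse_lift. Qed.

Lemma collapseK y : collapse y != x -> lift (collapse y) = y.
Proof. by case: y => [v|o] /=; rewrite /lift; [case: eqP|rewrite eqxx]. Qed.

Lemma lift_cds (e1 : rel T) (e2 : rel (T + option B)%type) (S : {set T}) :
  symmetric e1 -> symmetric e2 -> subrel expand e2 ->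
  (forall p q, e1 p q -> e2 (lift p) (lift q)) ->
  cds_on e1 [set: T] S -> cds_on e2 [set: _] [set lift w | w in x |: S].
Proof.
move=> sym1 sym2 sub adj [_ cS dS].
have cxS : connected_in e1 (x |: S).
  have [xS|xS] := boolP (x \in S); first by rewrite (setUidPr _) // sub1set.
  by have [//|y yS exy] := dS x _ xS; apply: connected_in_add sym1 cS yS exy.
split; first exact: subsetT.
  by apply: connected_in_imset cxS _ => // p q /adj; right.
move=> y _ yS; have [yx|yx] := eqVneq (collapse y) x.
  exists (lift x); first by rewrite imset_f ?setU11.
  apply: sub; apply: expand_twins; rewrite ?collapse_lift //.
  by apply: contraNneq yS => ->; rewrite imset_f ?setU11.
have cyS : collapse y \notin S.
  by apply: contra yS => cyS; rewrite -(collapseK yx) imset_f // in_setU1 cyS orbT.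
have [//|z zS eyz] := dS (collapse y) _ cyS.
exists (lift z); first by rewrite imset_f // in_setU1 zS orbT.
by rewrite -[y]collapseK //; apply: adj.
Qed.

Lemma card_lift (S : {set T}) : #|[set lift w | w in x |: S]| <= #|S|.+1.
Proof.
rewrite (leq_trans (leq_imset_card _ _)) // cardsU1; by case: (x \notin S).
Qed.

Lemma lift_cds_add u v (S : {set T}) : cds_on (add_edge e u v) [set: T] S ->
  cds_on (add_edge expand (lift u) (lift v)) [set: _] [set lift w | w in x |: S].
Proof.
apply: lift_cds; [exact: add_edge_sym|exact/add_edge_sym/expand_sym|exact: sub_add_edge|].
move=> p q; rewrite /add_edge [X in _ -> X]/= !(inj_eq lift_inj) => /or3P[epq|->|->]; rewrite ?orbT //.
by rewrite expand_lift ?lift_tip ?collapse_lift.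
Qed.

Lemma lift_cds_base (S : {set T}) : cds_on e [set: T] S ->
  cds_on expand [set: _] [set lift w | w in x |: S].
Proof.
apply: lift_cds => //; first exact: expand_sym.
by move=> p q epq; rewrite expand_lift ?lift_tip ?collapse_lift.
Qed.

End Lift.

Variable k : nat.
Hypothesis k1 : 1 < k.
Hypothesis crit : gamma_c_critical k e.
Hypothesis nbr_min : forall v, e x v -> exists S, [/\ cds_on e [set: T] S, #|S| = k & v \in S].

Lemma tip_simplicial : simplicial expand tip.
Proof.
move=> y z; rewrite !expand_tip => /andP[_ /eqP yx] /andP[_ /eqP zx]; exact: expand_twins.
Qed.

Lemma tip_nbr_min y : expand tip y ->
  exists S, [/\ cds_on expand [set: _] S, #|S| = k.+1 & y \in S].
Proof.
rewrite expand_tip => /andP[yt /eqP yx].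
have [D cdsD cardD] := critical_ex crit.
have cds := lift_cds_base yx yt cdsD; exists [set lift y w | w in x |: D]; split=> //.
  apply/eqP; rewrite eqn_leq (expand_cds k1 crit cds) andbT -cardD; exact: card_lift.
by apply/imsetP; exists x; rewrite ?setU11 // /lift eqxx.
Qed.

Lemma tip_pair v : v != x -> exists2 S,
  cds_on (add_edge expand tip (inl v)) [set: _] S & #|S| < k.+1.
Proof.
move=> vx; set e2 := add_edge _ _ _.
have sym2 : symmetric e2 by apply/add_edge_sym/expand_sym.
have sub2 : subrel expand e2 by apply: sub_add_edge.
have sub_inl u w : e u w -> e2 (inl u) (inl w) by rewrite -expand_inl; apply: sub2.
have tipv : e2 tip (inl v) by rewrite /e2 /add_edge /= !eqxx orbT.
have [exv|nxv] := boolP (e x v).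
  have [S [[_ cS dS] cardS vS]] := nbr_min exv.
  exists (inl @: S); last by rewrite ltnS -cardS leq_imset_card.
  split; first exact: subsetT.
    by apply: connected_in_imset cS _ => // p q /sub_inl; right.
  case=> [w _ wS|[b|] _ _].
  - have [//||z zS ewz] := dS w; first by apply: contra wS => wS; rewrite imset_f.
    by exists (inl z); [rewrite imset_f|apply: sub_inl].
  - by exists (inl v); [rewrite imset_f|apply/sub2/expand_lift].
  - by exists (inl v); [rewrite imset_f|].
rewrite eq_sym in vx; have [S cdsS ltS] := critical_add crit vx nxv.
have xvS : (x \in S) || (v \in S).
  apply/negPn/negP; rewrite negb_or => /andP[xS vS].
  by have := critical_min crit (cds_on_add_notin sym xS vS cdsS); rewrite leqNgt ltS.
have [_ cS dS] := cdsS.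
have etx : e2 tip (inl x) by apply: sub2; rewrite expand_tip /= eqxx.
exists (tip |: inl @: S); last first.
  rewrite ltnS (leq_trans (leq_card_setU _ _)) // cards1 add1n (leq_ltn_trans _ ltS) //.
  exact: leq_imset_card.
split; first exact: subsetT.
  apply: (connected_in_base (x0 := tip)) => //; first exact: setU11.
  move=> P sP /set0Pn[p pP] Pcl; apply/negPn/negP=> tP.
  have inP y : y \in P -> exists2 w, w \in S & y = inl w.
    move=> yP; have := subsetP sP _ yP; rewrite in_setU1 => /orP[/eqP E|/imsetP[w wS E]].
      by rewrite E (negbTE tP) in yP.
    by exists w.
  have xvP w : w \in [:: x; v] -> inl w \notin P.
    move=> wxv; apply: contra tP => wP; apply: (Pcl (inl w)) => //; first exact: setU11.
    by move: wxv; rewrite !inE => /orP[] /eqP ->; rewrite sym2.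
  suff E : [set w in S | inl w \in P] = S.
    by case/orP: xvS => wS; move: (wS); rewrite -E inE => /andP[_]; apply/negP/xvP;
      rewrite !inE eqxx ?orbT.
  apply: (connected_in_closed cS).
  - by apply/subsetP=> w; rewrite inE => /andP[].
  - by have [w wS E] := inP _ pP; apply/set0Pn; exists w; rewrite inE wS -E.
  - move=> w w'; rewrite !inE => /andP[wS wP] w'S.
    rewrite add_edge_neq.
    + move=> eww; rewrite w'S /=; apply: (Pcl (inl w)) => //; last exact: sub_inl.
      by rewrite in_setU1 imset_f ?orbT.
    + by apply: contraTneq wP => ->; apply: xvP; rewrite !inE eqxx.
    + by apply: contraTneq wP => ->; apply: xvP; rewrite !inE eqxx orbT.
case=> [w _ wS|[b|] _ yS].
- have [//||z zS] := dS w.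
    by apply: contra wS => wS; rewrite in_setU1 imset_f ?orbT.
  case/or3P=> [ewz|/andP[/eqP -> _]|/andP[/eqP -> _]].
  + by exists (inl z); [rewrite in_setU1 imset_f ?orbT|apply: sub_inl].
  + by exists tip; [exact: setU11|rewrite sym2].
  + by exists tip; [exact: setU11|rewrite sym2].
- exists tip; first exact: setU11.
  by apply/sub2/expand_twins.
- by rewrite setU11 in yS.
Qed.

Lemma expand_critical : gamma_c_critical k.+1 expand.
Proof.
have [D cdsD cardD] := critical_ex crit.
have inlx : collapse (inl x) = x by [].
apply: (critical_intro expand_sym (lift_cds_base inlx isT cdsD)).
- rewrite -cardD; exact: card_lift.
- by move=> S' cds'; apply: expand_cds cds'.
move=> y z yz nyz.
have tipcase w : w != tip -> ~~ expand tip w -> exists2 S,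
    cds_on (add_edge expand tip w) [set: _] S & #|S| < k.+1.
  rewrite expand_tip => -> /= wx; case: w wx => [w|o]; first exact: tip_pair.
  by rewrite eqxx.
have [yt|yt] := eqVneq y tip.
  by rewrite yt in yz nyz *; apply: tipcase; rewrite // eq_sym.
have [zt|zt] := eqVneq z tip.
  rewrite zt in yz nyz *; have [||S cds lt] := tipcase y; [by []|by rewrite expand_sym|].
  by exists S => //; apply: cds_on_addC.
have [a [ax at_ ay az]] : exists a, [/\ collapse a = x, a != tip,
    lift a (collapse y) = y & lift a (collapse z) = z].
  have [yx|yx] := eqVneq (collapse y) x.
    have zx : collapse z != x by apply: contraNneq nyz => zx; apply: expand_twins.
    by exists y; split=> //; [rewrite yx /lift eqxx|apply: collapseK].
  have [zx|zx] := eqVneq (collapse z) x.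
    by exists z; split=> //; [apply: collapseK|rewrite zx /lift eqxx].
  by exists (inl x); split=> //; apply: collapseK.
have uv : collapse y != collapse z by apply: contraNneq yz => E; rewrite -ay E az.
have nuv : ~~ e (collapse y) (collapse z) by apply: contra nyz; apply: expand_lift.
have [S cdsS ltS] := critical_add crit uv nuv.
exists [set lift a w | w in x |: S]; last by rewrite (leq_ltn_trans (card_lift _ _)).
by have := lift_cds_add ax at_ cdsS; rewrite ay az.
Qed.

Definition old (y : T + option B) : option T := if y is inl v then Some v else None.

Lemma expand_path (y : T + option B) (s : seq (T + option B)) u : path expand y s ->
  u \notin pmap old s -> uniq (pmap old s) ->
  (if y is inl v then u == v else (u == x) || e x u) -> path e u (pmap old s).
Proof.
elim: s y u => //= z s IH y u /andP[eyz pz].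
have near w : w \in [:: u] -> (w == x) || e x w -> forall w', (w' == x) || e x w' ->
    u != w' -> e u w'.
  rewrite inE => /eqP -> /orP[/eqP ->|exu] w' /orP[/eqP ->|exw] uw //.
  - by rewrite eqxx in uw.
  - by rewrite sym.
  - exact: simp.
have inr_nbr v o : expand (inl v) (inr o) -> (v == x) || e x v.
  by move/expand_collapse; rewrite /= [e v x]sym.
case: z eyz pz => [w|o] eyz pz /=.
  rewrite inE negb_or => /andP[uw us] /andP[ws uws] yu.
  rewrite (IH (inl w)) // andbT.
  case: y yu eyz => [v /eqP <-|o yu]; first by rewrite expand_inl.
  rewrite expand_sym => /inr_nbr wx; exact: near (mem_head _ _) yu _ wx uw.
move=> us uus yu; apply: (IH (inr o)) => //.
by case: y yu eyz => [v /eqP <-|//] /inr_nbr.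
Qed.

Lemma expand_traceable : traceable expand -> traceable e.
Proof.
case=> s [ss us alls]; exists (pmap old s); split; last 2 first.
- by apply: (pmap_uniq (g := inl)) us => -[v|o].
- by move=> v; rewrite mem_pmap; apply/mapP; exists (inl v).
elim: s ss us {alls} => //= -[v|o] s IH ps /andP[vs us] /=.
  apply: (expand_path ps); last exact: eqxx.
    by rewrite mem_pmap; apply: contra vs => /mapP[[w|//] ws [->]].
  by apply: (pmap_uniq (g := inl)) us => -[].
by apply: IH us; apply: path_sorted ps.
Qed.

Lemma expand_cut_inl v : v != x -> (inl v \in [set y | cut_vertex expand y]) =
  (v \in [set u | cut_vertex e u]).
Proof.
move=> vx; have con : connected_graph e by case: crit.
have con' : connected_graph expand by case: expand_critical.
rewrite !inE; apply/idP/idP.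
  move/(cut_vertexP _ expand_sym con')=> [P [vP /set0Pn[y yP] [w wP wv] out]].
  apply/(cut_vertexP _ sym con); exists [set u | inl u \in P].
  have step (Q : {set T + option B}) o : (forall y z, y \in Q -> z \notin Q -> expand y z -> z = inl v) ->
      inr o \in Q -> inl x \in Q.
    move=> outQ oQ; apply/negPn/negP=> xQ; have [E] : inl x = inl v :> T + option B.
      by apply: (outQ _ _ oQ xQ); apply: expand_twins.
    by rewrite E eqxx in vx.
  have outC y' z : y' \in ~: P -> z \notin ~: P -> expand y' z -> y' = inl v.
    by rewrite !inE negbK => yP' zP eyz; apply: (out z y') => //; rewrite expand_sym.
  split.
  - by rewrite inE.
  - apply/set0Pn; case: y yP => [u uP|o oP]; first by exists u; rewrite inE.
    by exists x; rewrite inE; apply: step oP.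
  - case: w wP wv => [u uP uv|o oP _]; first by exists u; rewrite ?inE.
    exists x; last by rewrite eq_sym.
    rewrite inE; apply/negP=> xP; suff: inr o = inl v :> T + option B by [].
    by apply: (out _ _ xP oP); apply: expand_twins.
  - move=> u w'; rewrite !inE => uP wP' euw; suff [->] : inl w' = inl v :> T + option B by [].
    by apply: (out _ _ uP wP'); rewrite expand_inl.
move/(cut_vertexP _ sym con)=> [P [vP /set0Pn[u uP] [w wP wv] out]].
apply/(cut_vertexP _ expand_sym con'); exists [set y | collapse y \in P]; split.
- by rewrite inE.
- by apply/set0Pn; exists (inl u); rewrite inE.
- by exists (inl w); rewrite ?inE.
- move=> y z; rewrite !inE => yP zP /expand_collapse/orP[/eqP E|eyz]; first by rewrite -E yP in zP.
  have zv := out _ _ yP zP eyz; have zx : collapse z != x by rewrite zv.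
  by rewrite -(collapseK (inl x) zx) zv /lift (negbTE vx).
Qed.

Lemma expand_cut_inr o : inr o \notin [set y | cut_vertex expand y].
Proof.
have con' : connected_graph expand by case: expand_critical.
rewrite inE; case: o => [b|]; last exact: (simplicial_not_cut expand_sym con' tip_simplicial).
apply/negP=> /(cut_vertexP _ expand_sym con')[P sd].
have [D cdsD cardD] := critical_ex crit.
have := side_mem expand_sym sd (lift_cds_base (erefl : collapse (inl x) = x) isT cdsD).
by case/imsetP=> w _; rewrite /lift; case: ifP.
Qed.

Lemma expand_cut_x : (inl x \in [set y | cut_vertex expand y]) = (#|B| == 0).
Proof.
have con' : connected_graph expand by case: expand_critical.
have [D cdsD cardD] := critical_ex crit.
rewrite inE; apply/idP/idP.
  move/(cut_vertexP _ expand_sym con')=> [P sd]; apply/negPn/negP=> B0.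
  have [b _] : exists b : B, b \in B by apply/existsP; rewrite -[[exists _, _]]/(~~ pred0b B) -lt0n lt0n.
  have := side_mem expand_sym sd (lift_cds_base (erefl : collapse (inr (Some b)) = x) isT cdsD).
  by case/imsetP=> w _; rewrite /lift; case: eqVneq => // wx [xw]; rewrite xw eqxx in wx.
move=> B0; apply/(cut_vertexP _ expand_sym con'); exists [set tip]; split.
- by rewrite inE.
- by rewrite -card_gt0 cards1.
- have [v vx] : exists v, v != x.
    have [v vx|all] := pickP (predC1 x); first by exists v.
    have : #|[set: T]| <= #|[set x]|.
      by apply/subset_leq_card/subsetP=> u _; rewrite inE; have /negbFE -> := all u.
    rewrite cards1 => /(leq_trans (subset_leq_card (subsetT D))); rewrite cardD.
    by rewrite leqNgt k1.
  by exists (inl v); rewrite ?inE.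
- move=> y z; rewrite !inE => /eqP -> zt; rewrite expand_tip zt => /eqP.
  case: z zt => [w _ /= ->//|[b|//]] _ _.
  by have := fintype0 b (eqP B0).
Qed.

Lemma expand_card_cut : #|[set y | cut_vertex expand y]| =
  #|[set v | cut_vertex e v]| + (#|B| == 0).
Proof.
have con : connected_graph e by case: crit.
have xZ : x \notin [set v | cut_vertex e v].
  by rewrite inE; apply: simplicial_not_cut.
set Z := [set v | _] in xZ *; set Z' := [set y | _].
rewrite (cardsD1 (inl x) Z') /Z' expand_cut_x addnC; congr (_ + _).
rewrite -(card_imset (mem Z) (can_inj (fun v => erefl : collapse (inl v) = v))).
apply: eq_card => y; rewrite in_setD1; case: y => [v|o].
  have -> : (inl v == inl x :> T + option B) = (v == x) by [].
  rewrite (mem_imset _ _ (can_inj (fun v => erefl : collapse (inl v) = v))).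
  have [->|vx] /= := eqVneq v x; first by rewrite (negbTE xZ).
  exact: expand_cut_inl.
rewrite (negbTE (expand_cut_inr o)) andbF; apply/esym/negbTE/negP.
by case/imsetP.
Qed.

End Expansion.

(** * A non-traceable 4-critical graph without cut-vertices *)

Section NatGraph.

Variable n : nat.
Implicit Types (r : rel nat) (l : seq nat) (i j : 'I_n.+1).

Definition graph_on r : rel 'I_n.+1 := [rel i j | r (val i) (val j)].

Definition verts l : {set 'I_n.+1} := [set i | val i \in l].

Definition nat_add r a b : rel nat :=
  [rel x y | [|| r x y, (x == a) && (y == b) | (x == b) && (y == a)]].

Fixpoint linked r l := if l is a :: l' then nilp l' || has (r a) l' && linked r l' else false.

Definition cds_check r l := [&& linked r l, all (ltn^~ n.+1) l &
  all (fun a => (a \in l) || has (r a) l) (iota 0 n.+1)].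

Lemma all_iota (p : pred nat) : all p (iota 0 n.+1) -> forall i, p (val i).
Proof. by move/allP=> H i; apply: H; rewrite mem_iota ltn_ord. Qed.

Lemma linked_connected r l : symmetric r -> linked r l -> all (ltn^~ n.+1) l ->
  connected_in (graph_on r) (verts l).
Proof.
move=> sym; have sym' : symmetric (graph_on r) by move=> i j; apply: sym.
elim: l => //= a l IH lk /andP[an ln].
have E : verts (a :: l) = Ordinal an |: verts l.
  by apply/setP=> i; rewrite !inE.
rewrite E; case/orP: lk => [/nilP ->|/andP[/hasP[b bl rab] lk]].
  rewrite (_ : verts [::] = set0) ?setU0; first exact: connected_in1.
  by apply/setP=> i; rewrite !inE.
have bn := allP ln _ bl.
by apply: (connected_in_add sym' (IH lk ln) (y := Ordinal bn)); rewrite ?inE.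
Qed.

Lemma cds_checkP r l : symmetric r -> cds_check r l ->
  cds_on (graph_on r) [set: _] (verts l).
Proof.
move=> sym /and3P[lk ln dm]; split; [exact: subsetT|exact: linked_connected|].
move=> i _; rewrite inE => il; have := all_iota dm i; rewrite (negbTE il) /=.
case/hasP=> b bl rib; have bn := allP ln _ bl.
by exists (Ordinal bn); rewrite ?inE.
Qed.

Lemma card_verts l : #|verts l| <= size l.
Proof.
rewrite cardE -(size_map val); apply: uniq_leq_size.
  by rewrite map_inj_uniq ?enum_uniq //; apply: val_inj.
by move=> _ /mapP[i + ->]; rewrite mem_enum inE.
Qed.

Lemma graph_on_add r i j : {in [set: 'I_n.+1] &, forall i' j',
  graph_on (nat_add r (val i) (val j)) i' j' -> add_edge (graph_on r) i j i' j'}.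
Proof. by []. Qed.

End NatGraph.

Lemma small_connected (T : finType) (e : rel T) (S : {set T}) : symmetric e ->
  connected_in e S -> #|S| <= 3 -> exists b a c, [/\ S \subset [set b; a; c],
    (a == b) || e b a & (c == b) || e b c].
Proof.
move=> sym cS S3; have [/set0Pn[x xS] _] := connected_inP _ _ cS.
have [<-|Sx] := eqVneq [set x] S.
  by exists x, x, x; rewrite !eqxx; split=> //; rewrite setUC subsetUl.
have [y' y'S y'x] : exists2 y, y \in S & y != x.
  have [|y yS] := subsetPn (_ : ~~ (S \subset [set x])); last by rewrite inE; exists y.
  by apply: contra Sx => sS; rewrite eqEsubset sS sub1set xS.
have [y [yS yx exy]] := connected_in_nbr cS xS y'S y'x.
have [<-|Sxy] := eqVneq [set x; y] S.
  by exists x, y, y; rewrite exy !orbT; split=> //; rewrite subsetUl.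
have sxy : [set x; y] \subset S by apply/subsetP=> z; rewrite !inE => /orP[] /eqP ->.
have [|p [z [pxy]]] := connected_in_edge cS sxy _ Sxy.
  by apply/set0Pn; exists x; rewrite !inE eqxx.
rewrite !inE negb_or in pxy * => /andP[/andP[zx zy] zS] epz.
have E : S = [set x; y; z].
  apply/esym/eqP; rewrite eqEcard; apply/andP; split.
    by apply/subsetP=> w; rewrite !inE => /orP[/orP[]|] /eqP ->.
  apply: leq_trans S3 _; rewrite setUC cardsU1 cards2 !inE negb_or zx zy eq_sym yx //.
case/orP: pxy epz => /eqP -> epz.
  by exists x, y, z; rewrite exy epz !orbT E.
exists y, x, z; rewrite sym exy epz !orbT; split=> //.
by rewrite E; apply/subsetP=> w; rewrite !inE => /orP[/orP[]|] ->; rewrite ?orbT.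
Qed.

Definition base_adj : seq (seq nat) :=
  [:: [:: 2; 3; 10; 11; 12; 13; 15]; [:: 2; 4; 5; 6; 8; 9; 10; 14; 15];
      [:: 0; 1; 4; 5; 6; 10; 11; 12; 13; 15]; [:: 0; 8; 9; 10; 11; 12; 13; 14];
      [:: 1; 2; 5; 6; 7; 8; 10; 11; 12; 14]; [:: 1; 2; 4; 6; 7; 8; 9; 10; 12; 13];
      [:: 1; 2; 4; 5; 7; 9; 10; 11; 13; 14]; [:: 4; 5; 6]; [:: 1; 3; 4; 5]; [:: 1; 3; 5; 6];
      [:: 0; 1; 2; 3; 4; 5; 6]; [:: 0; 2; 3; 4; 6]; [:: 0; 2; 3; 4; 5]; [:: 0; 2; 3; 5; 6];
      [:: 1; 3; 4; 6]; [:: 0; 1; 2]].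

Definition base_nat : rel nat := [rel a b | b \in nth [::] base_adj a].

Definition base_graph : rel 'I_16 := graph_on base_nat.

(* In row a, column b - a: a connected dominating set after adding the edge ab. *)
Definition base_pairs : seq (seq (seq nat)) :=
  [:: [:: [::]; [:: 4; 1; 0]; [::]; [::]; [:: 1; 4; 0]; [:: 1; 5; 0]; [:: 1; 6; 0]; [:: 1; 2; 0]; [:: 6; 2; 0]; [:: 4; 2; 0]; [::]; [::]; [::]; [::]; [:: 5; 2; 0]];
      [:: [::]; [::]; [:: 4; 2; 1]; [::]; [::]; [::]; [:: 1; 2; 0]; [::]; [::]; [::]; [:: 10; 5; 1]; [:: 10; 6; 1]; [:: 10; 4; 1]];
      [:: [::]; [:: 4; 2; 1]; [::]; [::]; [::]; [:: 1; 2; 0]; [:: 6; 2; 0]; [:: 4; 2; 0]; [::]; [::]; [::]; [::]; [:: 5; 2; 0]];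
      [:: [::]; [:: 4; 3; 0]; [:: 5; 3; 0]; [:: 6; 3; 0]; [:: 3; 2; 0]; [::]; [::]; [::]; [::]; [::]; [::]; [::]; [:: 4; 8; 3]];
      [:: [::]; [::]; [::]; [::]; [::]; [:: 4; 2; 0]; [::]; [::]; [::]; [:: 10; 4; 1]; [::]; [:: 4; 8; 3]];
      [:: [::]; [::]; [::]; [::]; [::]; [::]; [:: 10; 5; 1]; [::]; [::]; [:: 5; 2; 0]; [:: 5; 8; 3]];
      [:: [::]; [::]; [:: 6; 2; 0]; [::]; [::]; [::]; [:: 10; 6; 1]; [::]; [::]; [:: 6; 9; 3]];
      [:: [::]; [:: 8; 2; 1]; [:: 9; 2; 1]; [:: 1; 10; 0]; [:: 11; 2; 1]; [:: 12; 2; 1]; [:: 13; 2; 1]; [:: 14; 2; 1]; [:: 1; 15; 0]];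
      [:: [::]; [:: 8; 4; 2]; [:: 6; 10; 0]; [:: 6; 11; 0]; [:: 12; 6; 2]; [:: 6; 13; 0]; [:: 8; 5; 2]; [:: 4; 8; 3]];
      [:: [::]; [:: 4; 10; 0]; [:: 4; 11; 0]; [:: 4; 12; 0]; [:: 13; 4; 2]; [:: 14; 4; 2]; [:: 5; 9; 3]];
      [:: [::]; [:: 10; 5; 1]; [:: 10; 6; 1]; [:: 10; 4; 1]; [:: 5; 10; 0]; [:: 4; 10; 3]];
      [:: [::]; [:: 12; 5; 1]; [:: 11; 4; 1]; [:: 11; 5; 2]; [:: 4; 11; 3]];
      [:: [::]; [:: 12; 4; 1]; [:: 5; 12; 0]; [:: 4; 12; 3]];
      [:: [::]; [:: 5; 13; 0]; [:: 5; 13; 3]];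
      [:: [::]; [:: 4; 14; 3]];
      [::]].

Lemma base_check_sym :
  all (fun a => all (fun b => base_nat a b == base_nat b a) (iota 0 16)) (iota 0 16).
Proof. by vm_compute. Qed.

Lemma base_check_irr : all (fun a => ~~ base_nat a a) (iota 0 16).
Proof. by vm_compute. Qed.

Lemma base_check_small : all (fun b => all (fun a => all (fun c =>
  has (fun v => all (fun w => (v != w) && ~~ base_nat v w) [:: b; a; c]) (iota 0 16))
  (b :: nth [::] base_adj b)) (b :: nth [::] base_adj b)) (iota 0 16).
Proof. by vm_compute. Qed.

Lemma base_check_pairs : all (fun a => all (fun b => (a < b) && ~~ base_nat a b ==>
  let l := nth [::] (nth [::] base_pairs a) (b - a) in
  (size l <= 3) && cds_check 15 (nat_add base_nat a b) l) (iota 0 16)) (iota 0 16).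
Proof. by vm_compute. Qed.

Lemma base_nat_sym : symmetric base_nat.
Proof.
have rows a b : b \in nth [::] base_adj a -> a < 16 /\ b < 16.
  have /allP ok : all (all (ltn^~ 16)) base_adj by vm_compute.
  have [lt|ge] := ltnP a 16; last by rewrite nth_default.
  by move=> bl; split=> //; have /allP := ok _ (mem_nth [::] (lt : a < size base_adj)); apply.
move=> a b; have H c d : base_nat c d -> base_nat d c.
  move=> cd; have [c16 d16] := rows c d cd.
  have /allP/(_ c) := base_check_sym; rewrite mem_iota c16 => /(_ isT).
  by move/allP/(_ d); rewrite mem_iota d16 => /(_ isT)/eqP <-.
by apply/idP/idP; apply: H.
Qed.

Lemma base_simple : simple_graph base_graph.
Proof.
split=> [i j|i]; first exact: base_nat_sym.
by apply/negbTE; apply: (all_iota base_check_irr).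
Qed.

Lemma base_sym : symmetric base_graph.
Proof. by case: base_simple. Qed.

Lemma base_cds l : cds_check 15 base_nat l -> cds_on base_graph [set: _] (verts 15 l).
Proof. exact/cds_checkP/base_nat_sym. Qed.

Lemma base_critical : gamma_c_critical 4 base_graph.
Proof.
apply: (critical_intro base_sym (S := verts 15 [:: 4; 1; 2; 0])).
- exact: base_cds.
- exact: card_verts.
- move=> S [_ cS dS]; rewrite leqNgt ltnS; apply/negP=> /(small_connected base_sym cS).
  case=> b [a [c [sS ba bc]]].
  have mem i : (i == b) || base_graph b i -> val i \in val b :: nth [::] base_adj (val b).
    by rewrite inE.
  have := all_iota base_check_small b => /allP/(_ _ (mem _ ba))/allP/(_ _ (mem _ bc)).
  case/hasP=> v; rewrite mem_iota => /= v16 /and4P[/andP[vb eb] /andP[va ea] /andP[vc ec] _].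
  have inS j : j \in S -> (v != val j) && ~~ base_nat v (val j).
    by move/(subsetP sS); rewrite !inE => /orP[/orP[]|] /eqP ->; apply/andP.
  have vS : Ordinal v16 \notin S by apply/negP=> /inS; rewrite eqxx.
  have [//|j jS evj] := dS _ _ vS.
  by have /andP[_ /negP] := inS j jS; apply.
- suff H (i j : 'I_16) : i < j -> ~~ base_graph i j -> exists2 S,
      cds_on (add_edge base_graph i j) [set: _] S & #|S| < 4.
    move=> i j ij nij; have [lt|gt|E] := ltngtP i j; first exact: H.
      have [||S cds lt] := H j i; [by []|by rewrite base_sym|].
      by exists S => //; apply: cds_on_addC.
    by rewrite (val_inj E) eqxx in ij.
  move=> ij nij; have := all_iota (all_iota base_check_pairs i) j.
  rewrite ij nij /=; set l := nth _ _ _ => /andP[sl chk].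
  exists (verts 15 l); last by rewrite ltnS (leq_trans (card_verts _ _)).
  apply: (cds_on_sub (@graph_on_add _ _ i j)); apply: cds_checkP chk.
  by move=> a b; rewrite /nat_add /= base_nat_sym [X in _ || X = _]orbC; congr (_ || (_ || _)); rewrite andbC.
Qed.

Lemma base_no_cut : #|[set i | cut_vertex base_graph i]| = 0.
Proof.
apply/eqP; rewrite cards_eq0; apply/eqP/setP=> i; rewrite in_set0 inE; apply/negP.
have [con _ _] := base_critical; case/(cut_vertexP _ base_sym con)=> P sd.
have chk l : cds_check 15 base_nat l -> val i \in l.
  by move=> /base_cds/(side_mem base_sym sd); rewrite inE.
have := chk [:: 4; 1; 2; 0]; have := chk [:: 8; 4; 2; 1]; have := chk [:: 4; 3; 2; 0].
have := chk [:: 4; 1; 10; 0]; have := chk [:: 5; 1; 2; 0].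
move/(_ isT) => + /(_ isT) + /(_ isT) + /(_ isT) + /(_ isT).
by move: (val i); do 12!case=> //.
Qed.

Lemma count_independent (T : eqType) (e : rel T) (a : pred T) (s : seq T) : sorted e s ->
  {in a &, forall x y, ~~ e x y} -> count a s <= (count (predC a) s).+1.
Proof.
move=> + ind; suff H x s' : path e x s' -> count a (x :: s') <= (count (predC a) (x :: s')).+1 /\
    (~~ a x -> count a (x :: s') <= count (predC a) (x :: s')).
  by case: s => //= x s /H[].
elim: s' x => [|y s' IH] x /=; first by case: (a x).
case/andP=> exy /IH[le1 le2]; case: (boolP (a x)) => ax.
  split=> //; have ay : ~~ a y by apply: contraL exy => ay; apply: ind.
  by rewrite add1n add0n ltnS le2.
by rewrite add0n add1n; split=> [|_]; [apply: leqW|].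
Qed.

Lemma base_nontraceable : ~ traceable base_graph.
Proof.
case=> s [ss us alls].
have cnt (a : pred 'I_16) : count a s = #|a|.
  rewrite -size_filter cardE; apply/perm_size/uniq_perm; [exact: filter_uniq|exact: enum_uniq|].
  by move=> i; rewrite mem_filter alls andbT mem_enum.
have := count_independent (a := [pred i : 'I_16 | 6 < i]) ss; rewrite !cnt.
have card (p : pred nat) : #|[pred i : 'I_16 | p i]| = count p (iota 0 16).
  by rewrite -val_enum_ord count_map cardE size_filter -enumT.
rewrite (card (fun a => 6 < a)) (card (fun a => ~~ (6 < a))) => H.
have : 9 <= 8; last by [].
apply: H => i j /= i6 j6.
have /all_iota/(_ i)/implyP/(_ i6)/all_iota/(_ j)/implyP/(_ j6) // : all (fun a => (6 < a) ==>
  all (fun b => (6 < b) ==> ~~ base_nat a b) (iota 0 16)) (iota 0 16) by vm_compute.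
Qed.

Definition base_tip : 'I_16 := Ordinal (isT : 7 < 16).

Lemma base_simplicial : simplicial base_graph base_tip.
Proof.
have chk : all (fun a => all (fun b => [&& base_nat 7 a, base_nat 7 b & a != b] ==>
  base_nat a b) (iota 0 16)) (iota 0 16) by vm_compute.
move=> u v xu xv uv; have /implyP := all_iota (all_iota chk u) v; apply.
by apply/and3P.
Qed.

Lemma base_nbr_min v : base_graph base_tip v ->
  exists S, [/\ cds_on base_graph [set: _] S, #|S| = 4 & v \in S].
Proof.
have chk : all (fun a => base_nat 7 a ==> cds_check 15 base_nat [:: a; 1; 2; 0])
  (iota 0 16) by vm_compute.
move=> xv; have /implyP/(_ xv)/base_cds cds := all_iota chk v.
exists (verts 15 [:: val v; 1; 2; 0]); split=> //; last by rewrite !inE eqxx.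
apply/eqP; rewrite eqn_leq card_verts; exact: critical_min base_critical cds.
Qed.

Definition extendable k zeta := exists (T : finType) (e : rel T) (x : T),
  [/\ simple_graph e, gamma_c_critical k e, #|[set v | cut_vertex e v]| = zeta, ~ traceable e &
   simplicial e x /\
   forall v, e x v -> exists S, [/\ cds_on e [set: T] S, #|S| = k & v \in S]].

Lemma extendable_step (B : finType) k zeta : 1 < k -> extendable k zeta ->
  extendable k.+1 (zeta + (#|B| == 0)).
Proof.
move=> k1 [T [e [x [[sym irr] crit cardZ ntr [simp nbrs]]]]].
exists (T + option B)%type, (@expand T B e x), (@tip T B); split.
- split; [exact: expand_sym|exact: expand_irr].
- exact: expand_critical.
- by rewrite (expand_card_cut _ sym irr simp k1 crit nbrs) cardZ.
- by move/(expand_traceable sym irr simp).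
- split; [exact: tip_simplicial|exact: tip_nbr_min].
Qed.

Lemma extendable_all n zeta : zeta <= n -> extendable (n + 4) zeta.
Proof.
elim: n zeta => [|n IH] zeta.
  rewrite leqn0 => /eqP ->; exists 'I_16, base_graph, base_tip; split.
  - exact: base_simple.
  - exact: base_critical.
  - exact: base_no_cut.
  - exact: base_nontraceable.
  - split; [exact: base_simplicial|exact: base_nbr_min].
have k1 : 1 < n + 4 by rewrite addnC.
rewrite leq_eqVlt => /orP[/eqP ->|]; last rewrite ltnS => /IH.
  by have := extendable_step void k1 (IH n (leqnn n)); rewrite card_void addn1 addSn.
by move/(extendable_step unit k1); rewrite card_unit addn0 addSn.
Qed.

Theorem theorem5p3 (k zeta : nat) (k_ge1 : 1 <= k) :
  (exists (T : finType) (e : rel T),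
      [/\ simple_graph e,
          gamma_c_critical k e,
          #|[set v | cut_vertex e v]| = zeta &
          ~ traceable e])
  <-> (4 <= k /\ 0 <= zeta <= k - 4).
Proof.
split=> [[T [e [[sym irr] crit cardZ ntr]]]|[k4 /andP[_ le]]]; last first.
  by have [T [e [x [sg crit cardZ ntr _]]]] := extendable_all le; rewrite subnK // in crit; exists T, e.
have [D cdsD cardD] := critical_ex crit.
suff lt : zeta + 4 <= k by rewrite leq_subRL ?(leq_trans _ lt) ?leq_addl // addnC.
rewrite leqNgt; apply/negP=> gt; apply/ntr/(few_traceable sym irr crit cdsD cardD).
by rewrite cardsD (setIidPr (Z_sub sym crit cdsD)) cardD cardZ leq_subLR -ltnS -addnS.
Qed.
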